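(* Let $d\in\{2,3\}$, $\kappa>0$, $T>0$, and let $\mathbb{S}$ and $p(\cdot)$ satisfy the structural assumptions listed in the context. Let $(\varrho,u)$ be a (sufficiently regular) weak solution on $[0,T]\times\mathbb{T}^d$ to $$\partial_t\varrho+\mathrm{div}(\varrho u)=0,\qquad \partial_t(\varrho u)+\mathrm{div}(\varrho u\otimes u)-\mathrm{div}(\varrho\,\mathbb{S}(\mathbb{D}u))+\nabla p(\varrho)-\kappa\,\mathrm{div}(\varrho\nabla^2\ln\varrho)=0$$ with $\varrho|_{t=0}=\varrho_0$, $(\varrho u)|_{t=0}=\varrho_0u_0$, satisfying the energy inequality $$E(t)+\int_0^t\int_{\mathbb{T}^d}\varrho\,\mathbb{S}(\mathbb{D}u):\mathbb{D}u\,\mathrm{d}x\,\mathrm{d}s\le E(0).$$ Then for any smooth $(r,v)$ with $r>0$, the relative entropy $\mathcal{E}(t)=\mathcal{E}[(\varrho,u)|(r,v)](t)$ satisfies $$\mathcal{E}(t)\le\mathcal{E}(0)e^{Ct}+\int_0^tb(s)e^{C(t-s)}\,\mathrm{d}s,$$ where $C$ depends only on $\min r$, $\max r$ and the $L^\infty$ norm of $\nabla v$ (the data $d,\kappa,\mathbb{S},p(\cdot)$ being fixed), and $$b(t)=-\int_{\mathbb{T}^d}\varrho(u-v)\cdot\mathcal{A}_1\,\mathrm{d}x-\kappa\int_{\mathbb{T}^d}\varrho(\nabla\ln\varrho-\nabla\ln r)\cdot\mathcal{A}_2\,\mathrm{d}x-\int_{\mathbb{T}^d}(\varrho-r)\mathcal{A}_3\,\mathrm{d}x$$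 with $$\begin{aligned}\mathcal{A}_1&=\partial_tv+(v\cdot\nabla)v-\tfrac1r\mathrm{div}(r\mathbb{S}(\mathbb{D}v))+\tfrac1r\nabla p(r)-\kappa\tfrac1r\mathrm{div}(r\nabla^2\ln r),\\ \mathcal{A}_2&=\partial_t\nabla\ln r+(v\cdot\nabla)\nabla\ln r+\tfrac1r\mathrm{div}(r(\nabla v)^T),\\ \mathcal{A}_3&=\partial_tH'(r)+v\cdot\nabla H'(r)+p'(r)\,\mathrm{div}\,v.\end{aligned}$$
   Context: Notation. $\mathbb{T}^d$ is the $d$-dimensional flat torus (periodic boundary conditions). For a vector field $u$, $\nabla u=(\partial_ju_i)_{i,j}$, $\mathbb{D}u=\frac12(\nabla u+(\nabla u)^T)$; $u\otimes v=(u_jv_i)_{i,j}$; the divergence of a matrix field is taken row-wise, $(\mathrm{div}A)_i=\sum_j\partial_jA_{ij}$; $A:B=\sum_{i,j}A_{ij}B_{ij}$; $((v\cdot\nabla)w)_i=\sum_jv_j\partial_jw_i$. Initial data: $\varrho_0\ge0$, $\sqrt{\varrho_0}\in H^1(\mathbb{T}^d)$, $\sqrt{\varrho_0}u_0\in L^2(\mathbb{T}^d)$. Assumptions on $\mathbb{S}$. $\mathbb{S}:\mathbb{R}^{d\times d}_{\mathrm{sym}}\to\mathbb{R}^{d\times d}_{\mathrm{sym}}$ is differentiable and, for some exponent $p\ge1$ (a number, not to be confused with the pressure function $p(\cdot)$) and constants $C,c,c_1>0$: $|\mathbb{S}(A)|\le C|A|^{p-1}$ for all $A$; $\mathbb{S}(A):A\ge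 c|A|^p$ if $|A|>c_1$; and $(\mathbb{S}(A)-\mathbb{S}(B)):(A-B)\ge0$ for all $A,B\in\mathbb{R}^{d\times d}_{\mathrm{sym}}$. Assumptions on the pressure. $p(\cdot)\in C([0,\infty))\cap C^2((0,\infty))$, $p(0)=0$, $p'>0$, and $a\varrho^{\gamma-1}-b\le p'(\varrho)\le\frac1a\varrho^{\gamma-1}+b$ for some constants $a,b>0$ and some $\gamma>1$. Energy and relative entropy. $H(\varrho)=\varrho\int_{\bar\varrho}^{\varrho}\frac{p(s)}{s^2}\,\mathrm{d}s$ with $\bar\varrho$ a constant reference state, $H(\varrho|r)=H(\varrho)-H(r)-H'(r)(\varrho-r)$, $$E(t)=\frac12\int_{\mathbb{T}^d}\big(\varrho|u|^2+\kappa\varrho|\nabla\ln\varrho|^2\big)\,\mathrm{d}x+\int_{\mathbb{T}^d}H(\varrho)\,\mathrm{d}x,$$ $$\mathcal{E}(t)=\frac12\int_{\mathbb{T}^d}\big(\varrho|u-v|^2+\kappa\varrho|\nabla\ln\varrho-\nabla\ln r|^2\big)\,\mathrm{d}x+\int_{\mathbb{T}^d}H(\varrho|r)\,\mathrm{d}x.$$ A weak solution is a pair $(\varrho,u)$, $\varrho\ge0$, satisfying both equations in the sense of distributions together with the initial conditions; ''sufficiently regular'' means regular enough that all integrals in the statement are well defined and that the equations can be tested with smooth functions and the terms integrated by parts against smooth functions. *)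

(* Defs.v *)
From HB Require Import structures.
From mathcomp Require Import all_boot all_order all_algebra.
From mathcomp Require Import all_classical all_reals all_analysis.

Set Implicit Arguments.
Unset Strict Implicit.
Unset Printing Implicit Defensive.
Import Order.TTheory GRing.Theory Num.Theory.
Import numFieldNormedType.Exports.
Local Open Scope classical_set_scope.
Local Open Scope ring_scope.

(* Functions on T^d = (R/Z)^d are 1-periodic functions on 'rV[R]_d; integrals
   over T^d are Lebesgue integrals over the cell [0,1]^d. *)

Section TorusMeasure.
Context (R : realType).
Local Notation TR := (measurableTypeR R).

Definition tuple_cons n (z : TR * n.-tuple TR) : n.+1.-tuple TR :=
  [tuple of z.1 :: z.2].

Lemma measurable_tuple_cons n : measurable_fun setT (@tuple_cons n).
Proof.
exact: (measurable_cons (f := fst) (g := snd) measurable_fst measurable_snd).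
Qed.

HB.instance Definition _ n :=
  isMeasurableFun.Build _ _ _ _ (@tuple_cons n) (@measurable_tuple_cons n).

(* Lebesgue measure on [0,1]^n, as an iterated product. *)
Fixpoint torus_measure n : probability (n.-tuple TR) R :=
  match n with
  | 0 => \d_([tuple] : 0.-tuple TR)
  | m.+1 => distribution (uniform_prob (@ltr01 R) \x torus_measure m)%E
              (@tuple_cons m : {mfun _ >-> _})
  end.

End TorusMeasure.

Section Integrals.
Context (R : realType) (d : nat).
Local Notation X := 'rV[R]_d.
Local Notation TR := (measurableTypeR R).
Local Notation mu := (@lebesgue_measure R).

Definition torus_pt (y : d.-tuple TR) : X := \row_i tnth y i.

Definition tint (f : X -> R) : R := \int[torus_measure R d]_y f (torus_pt y).

Definition tintegrable (f : X -> R) : Prop :=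
  (torus_measure R d).-integrable setT (fun y => (f (torus_pt y))%:E).

Definition tL2 (f : X -> R) : Prop :=
  measurable_fun setT (fun y => f (torus_pt y)) /\
  tintegrable (fun x => f x ^+ 2).

Definition st_measurable (T : R) (f : R -> X -> R) : Prop :=
  measurable_fun (`[0, T] `*` setT)
    (fun z : TR * d.-tuple TR => f z.1 (torus_pt z.2)).

Definition st_integrable (T : R) (f : R -> X -> R) : Prop :=
  (mu \x torus_measure R d)%E.-integrable (`[0, T] `*` setT)
    (fun z => (f z.1 (torus_pt z.2))%:E).

Definition time_int (t : R) (g : R -> R) : R :=
  \int[mu]_(s in `[0, t]) g s.

End Integrals.

Section Calculus.
Context (R : realType).

Fixpoint Ck (V : normedModType R) (k : nat) (f : V -> R) : Prop :=
  match k with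
  | 0 => continuous f
  | l.+1 => (forall x, differentiable f x) /\ forall h, Ck l ('D_h f)
  end.

Definition smooth (V : normedModType R) (f : V -> R) : Prop :=
  forall k, Ck k f.

Definition fdot m n (A B : 'M[R]_(m, n)) : R := \sum_i \sum_j A i j * B i j.

Definition fnorm m n (A : 'M[R]_(m, n)) : R := Num.sqrt (fdot A A).

Variable d : nat.
Local Notation X := 'rV[R]_d.

Definition symm (A : 'M[R]_d) : 'M[R]_d := 2^-1 *: (A + A^T).

Definition outer (a b : X) : 'M[R]_d := \matrix_(i, j) (a 0 j * b 0 i).

Definition pd (j : 'I_d) (f : X -> R) (x : X) : R := 'D_(delta_mx 0 j) f x.

Definition grad (f : X -> R) (x : X) : X := \row_j pd j f x.

Definition gradv (g : X -> X) (x : X) : 'M[R]_d :=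
  \matrix_(i, j) pd j (fun y => g y 0 i) x.

Definition divv (g : X -> X) (x : X) : R := \sum_j pd j (fun y => g y 0 j) x.

Definition divm (A : X -> 'M[R]_d) (x : X) : X :=
  \row_i \sum_j pd j (fun y => A y i j) x.

Definition adv (a g : X -> X) (x : X) : X :=
  \row_i \sum_j a x 0 j * pd j (fun y => g y 0 i) x.

Definition dt (V : normedModType R) (f : R -> X -> V) (t : R) (x : X) : V :=
  derive1 (fun s => f s x) t.

Definition tperiodic (V : Type) (f : X -> V) : Prop :=
  forall x j, f (x + delta_mx 0 j) = f x.

(* A function is smooth on [0,T] x T^d iff it is the restriction of one that is
   smooth on R x T^d, so time ranges over R for r, v and the test functions. *)
Definition st_smooth (f : R -> X -> R) : Prop :=
  (forall t, tperiodic (f t)) /\ smooth (fun z : R * X => f z.1 z.2).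

Definition st_smoothv (g : R -> X -> X) : Prop :=
  forall i, st_smooth (fun t x => g t x 0 i).

Definition weak_partial (j : 'I_d) (f g : X -> R) : Prop :=
  forall psi, tperiodic psi -> smooth psi ->
    tint (fun x => f x * pd j psi x) = - tint (fun x => g x * psi x).

Definition H1 (f : X -> R) : Prop :=
  tL2 f /\ exists G : X -> X, forall j,
    tL2 (fun x => G x 0 j) /\ weak_partial j f (fun x => G x 0 j).

(* w = grad (ln rho) in the form grad rho = rho w, which makes sense with
   vacuum; w enters only through products with rho. *)
Definition log_grad (rho : X -> R) (w : X -> X) : Prop :=
  forall j, weak_partial j rho (fun x => rho x * w x 0 j).

(* g has gradient G under the weight rho:
   div(rho g_i F_i) = rho g_i div F_i + rho (G : F) + (g (x) grad rho) : F
   integrates to zero. The fields F are only differentiable, since S(Dv) is no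
   better when S is differentiable. *)
Definition weighted_grad (rho : X -> R) (w g : X -> X) (G : X -> 'M[R]_d) :
    Prop :=
  forall F : X -> 'M[R]_d, tperiodic F ->
    (forall x, differentiable F x) ->
    tintegrable (fun x => rho x * fdot (g x) (divm F x)) ->
    tint (fun x => rho x * fdot (g x) (divm F x)) =
    - tint (fun x => rho x * fdot (G x + outer (w x) (g x)) (F x)).

(* Pairing with Phi of the distribution
   rho grad^2 ln rho = grad (grad rho) - rho grad ln rho (x) grad ln rho. *)
Definition hess_log_pairing (rho : X -> R) (w : X -> X) (Phi : X -> 'M[R]_d) :
    R :=
  - tint (fun x => rho x * fdot (w x) (divm Phi x))
  - tint (fun x => rho x * fdot (outer (w x) (w x)) (Phi x)).

End Calculus.

Section Laws.
Context (R : realType).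

(* Only the values of S on symmetric matrices matter; S restricted to them is
   differentiable iff S \o symm is. *)
Record stress_law (d : nat) (S : 'M[R]_d -> 'M[R]_d) : Prop := StressLaw {
  stress_sym : forall A, A^T = A -> (S A)^T = S A;
  stress_diff : forall A, differentiable (fun B => S (symm B)) A;
  stress_growth : exists q C c c1 : R,
    [/\ 1 <= q, 0 < C, 0 < c, 0 < c1 &
      (forall A, A^T = A -> fnorm (S A) <= C * fnorm A `^ (q - 1)) /\
      (forall A, A^T = A -> c1 < fnorm A ->
        c * fnorm A `^ q <= fdot (S A) A)];
  stress_mono : forall A B, A^T = A -> B^T = B ->
    0 <= fdot (S A - S B) (A - B) }.

Record pressure_law (p : R -> R) : Prop := PressureLaw {
  pressure_cont : {within `[0, +oo[, continuous p};
  pressure_D1 : forall s, 0 < s -> derivable p s 1;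
  pressure_D2 : forall s, 0 < s -> derivable (derive1 p) s 1;
  pressure_C2 : forall s, 0 < s -> {for s, continuous (derive1 (derive1 p))};
  pressure0 : p 0 = 0;
  pressure_incr : forall s, 0 < s -> 0 < derive1 p s;
  pressure_growth : exists a b gamma : R, [/\ 0 < a, 0 < b, 1 < gamma &
    forall s, 0 < s -> a * s `^ (gamma - 1) - b <= derive1 p s /\
                       derive1 p s <= a^-1 * s `^ (gamma - 1) + b] }.

Definition oriented_int (a b : R) (f : R -> R) : R :=
  if a <= b then \int[@lebesgue_measure R]_(s in `[a, b]) f s
  else - \int[@lebesgue_measure R]_(s in `[b, a]) f s.

(* At s = 0 the factor s gives the value 0, the limit of H at vacuum. *)
Definition pot (p : R -> R) (rhobar s : R) : R :=
  s * oriented_int rhobar s (fun sigma => p sigma / sigma ^+ 2).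

Definition rel_pot (p : R -> R) (rhobar s r : R) : R :=
  pot p rhobar s - pot p rhobar r - derive1 (pot p rhobar) r * (s - r).

End Laws.

Section Solutions.
Context (R : realType) (d : nat).
Local Notation X := 'rV[R]_d.
Variables (kappa : R) (S : 'M[R]_d -> 'M[R]_d) (p : R -> R).

Record initial_data (rho0 : X -> R) (u0 : X -> X) : Prop := InitialData {
  data_periodic : tperiodic rho0 /\ tperiodic u0;
  data_ge0 : forall x, 0 <= rho0 x;
  data_H1 : H1 (fun x => Num.sqrt (rho0 x));
  data_L2 : forall i, tL2 (fun x => Num.sqrt (rho0 x) * u0 x 0 i) }.

(* Below w = grad (ln rho) in the sense of log_grad, and Gu = grad u in the sense
   of weighted_grad. *)

Record regular (rhobar T : R) (rho : R -> X -> R) (u w : R -> X -> X)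
    (Gu : R -> X -> 'M[R]_d) : Prop := Regular {
  reg_periodic : forall t,
    [/\ tperiodic (rho t), tperiodic (u t), tperiodic (w t)
      & tperiodic (Gu t)];
  reg_meas_rho : st_measurable T rho;
  reg_meas_u : forall i, st_measurable T (fun t x => u t x 0 i);
  reg_meas_w : forall i, st_measurable T (fun t x => w t x 0 i);
  reg_meas_Gu : forall i j, st_measurable T (fun t x => Gu t x i j);
  reg_energy : forall t, 0 <= t <= T ->
    [/\ tintegrable (rho t),
        tintegrable (fun x => rho t x * fdot (u t x) (u t x)),
        tintegrable (fun x => rho t x * fdot (w t x) (w t x)) &
        tintegrable (fun x => pot p rhobar (rho t x))];
  reg_st_energy :
    [/\ st_integrable T rho,
        st_integrable T (fun t x => rho t x * fdot (u t x) (u t x)),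
        st_integrable T (fun t x => rho t x * fdot (w t x) (w t x)) &
        st_integrable T (fun t x => pot p rhobar (rho t x))];
  reg_pressure : st_integrable T (fun t x => p (rho t x));
  reg_Gu : forall i j, st_integrable T (fun t x => rho t x * Gu t x i j);
  reg_stress : forall i j,
    st_integrable T (fun t x => rho t x * S (symm (Gu t x)) i j);
  reg_dissipation : st_integrable T (fun t x =>
    rho t x * fdot (S (symm (Gu t x))) (symm (Gu t x)));
  reg_log_grad : forall t, 0 <= t <= T -> log_grad (rho t) (w t);
  reg_grad : {ae @lebesgue_measure R, forall t, 0 <= t <= T ->
    forall eta : X -> X, tperiodic eta ->
      (forall i, smooth (fun x => eta x 0 i)) ->
      weighted_grad (rho t) (w t) (fun x => u t x - eta x)
        (fun x => Gu t x - gradv eta x)} }.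

(* Both equations tested on [0,tau] x T^d, for every tau: the distributional
   formulation with initial data for rho and rho u weakly continuous in time. *)
Record weak_solution (T : R) (rho0 : X -> R) (u0 : X -> X)
    (rho : R -> X -> R) (u w : R -> X -> X) (Gu : R -> X -> 'M[R]_d) : Prop :=
  WeakSolution {
  sol_ge0 : forall t x, 0 <= rho t x;
  sol_init : {ae torus_measure R d, forall y, let x := torus_pt y in
    rho 0 x = rho0 x /\ rho 0 x *: u 0 x = rho0 x *: u0 x};
  sol_mass : forall phi, st_smooth phi -> forall tau, 0 <= tau <= T ->
    tint (fun x => rho tau x * phi tau x) - tint (fun x => rho0 x * phi 0 x) =
    time_int tau (fun t => tint (fun x =>
      rho t x * dt phi t x + rho t x * fdot (u t x) (grad (phi t) x)));
  sol_momentum : forall phi, st_smoothv phi -> forall tau, 0 <= tau <= T ->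
    tint (fun x => rho tau x * fdot (u tau x) (phi tau x))
    - tint (fun x => rho0 x * fdot (u0 x) (phi 0 x)) =
    time_int tau (fun t =>
      tint (fun x => rho t x * fdot (u t x) (dt phi t x))
      + tint (fun x =>
          rho t x * fdot (outer (u t x) (u t x)) (gradv (phi t) x))
      - tint (fun x =>
          rho t x * fdot (S (symm (Gu t x))) (gradv (phi t) x))
      + tint (fun x => p (rho t x) * divv (phi t) x)
      - kappa * hess_log_pairing (rho t) (w t) (gradv (phi t))) }.

Definition energy (rhobar : R) (rho : R -> X -> R) (u w : R -> X -> X)
    (t : R) : R :=
  2^-1 * tint (fun x => rho t x * fnorm (u t x) ^+ 2
                        + kappa * rho t x * fnorm (w t x) ^+ 2)
  + tint (fun x => pot p rhobar (rho t x)).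

Definition energy_inequality (rhobar T : R) (rho : R -> X -> R)
    (u w : R -> X -> X) (Gu : R -> X -> 'M[R]_d) : Prop :=
  forall t, 0 <= t <= T ->
    energy rhobar rho u w t
    + time_int t (fun s => tint (fun x =>
        rho s x * fdot (S (symm (Gu s x))) (symm (Gu s x))))
    <= energy rhobar rho u w 0.

Section RelativeEntropy.
Variables (r : R -> X -> R) (v : R -> X -> X).

Definition grad_ln (t : R) (x : X) : X := grad (fun y => ln (r t y)) x.

Definition rel_entropy (rhobar : R) (rho : R -> X -> R) (u w : R -> X -> X)
    (t : R) : R :=
  2^-1 * tint (fun x =>
    rho t x * fnorm (u t x - v t x) ^+ 2
    + kappa * rho t x * fnorm (w t x - grad_ln t x) ^+ 2)
  + tint (fun x => rel_pot p rhobar (rho t x) (r t x)).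

Definition A1 (t : R) (x : X) : X :=
  dt v t x + adv (v t) (v t) x
  - (r t x)^-1 *: divm (fun y => r t y *: S (symm (gradv (v t) y))) x
  + (r t x)^-1 *: grad (fun y => p (r t y)) x
  - (kappa * (r t x)^-1) *: divm (fun y => r t y *: gradv (grad_ln t) y) x.

Definition A2 (t : R) (x : X) : X :=
  dt grad_ln t x + adv (v t) (grad_ln t) x
  + (r t x)^-1 *: divm (fun y => r t y *: (gradv (v t) y)^T) x.

Definition A3 (rhobar t : R) (x : X) : R :=
  let dH s y := derive1 (pot p rhobar) (r s y) in
  dt dH t x + fdot (v t x) (grad (dH t) x) + derive1 p (r t x) * divv (v t) x.

Definition remainder (rhobar : R) (rho : R -> X -> R) (u w : R -> X -> X)
    (t : R) : R :=
  - tint (fun x => rho t x * fdot (u t x - v t x) (A1 t x))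
  - kappa * tint (fun x => rho t x * fdot (w t x - grad_ln t x) (A2 t x))
  - tint (fun x => (rho t x - r t x) * A3 rhobar t x).

End RelativeEntropy.

Definition st_range (T : R) (f : R -> X -> R) : set R :=
  [set f z.1 z.2 | z in [set z : R * X | 0 <= z.1 <= T]].

End Solutions.

(* Main.v *)
Require Import Defs.
From HB Require Import structures.
From mathcomp Require Import all_boot all_order all_algebra.
From mathcomp Require Import all_classical all_reals all_analysis.
From mathcomp Require Import ring lra measurable_realfun.
Import Order.TTheory GRing.Theory Num.Theory.
Import numFieldNormedType.Exports.
Local Open Scope classical_set_scope.
Local Open Scope ring_scope.
Set Implicit Arguments.
Unset Strict Implicit.
Unset Printing Implicit Defensive.

(** Expanding the squares, the relative entropy is the energy of [(rho, u)] plus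
    terms that are linear in [rho] and [rho u]:
      energy - int rho u.v + int rho phi1 - int rho H'(r) + int p(r),
    where [phi1 = |v|^2/2 + kappa (Lap ln r + |grad ln r|^2/2)]. The cross term
    of the two logarithmic gradients is linear in [rho] as well, because
    [rho grad ln rho] is the gradient of [rho] ([rel_entropyE]). The evolution of
    every linear term is known: test the momentum equation with [v] and the mass
    equation with [phi1] and [H'(r)]. Together with the energy inequality this
    bounds the growth of the relative entropy by the time integral of an explicit
    rate ([rel_entropy_growth]).

    Pointwise, this rate is at most the density of [b], plus three expressions
    of zero integral, plus terms that are quadratic in the distance of the two
    states ([balance_le]). The only inequality used here is the monotonicity of
    [S], which replaces the stress of [u] by [S(Dv)]. The three expressions with
    zero integral come from integrating by parts [S(Dv)] against the weighted
    gradient of [u - v], a smooth field [Psi] against the weighted gradient of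
    the density, and [p(r) v]. With [g = u - v] and
    [z = grad ln rho - grad ln r], the quadratic terms are
    [- rho g(x)g : grad v], [- kappa rho z(x)z : grad v], [rho z(x)g : S(Dv)] and
    [- (p(rho) - p(r) - p'(r)(rho - r)) div v]. The growth of [S] bounds [S(Dv)],
    and [rel_pressure_le] bounds the pressure increment by [H(rho|r)], so these
    terms are at most [K] times the density of the relative entropy
    ([quadratic_le]), with [K] depending on the range of [r] and the bound of
    [grad v] only. The integral form of the Gronwall lemma concludes
    ([gronwall]).

    Two points need care. The function [H'(r)] need not be smooth, as the pressure
    is only C^2; it is admissible in the mass equation because polynomials of [r]
    approximate it in C^1 ([mass_eq_comp]). And [div S(Dv)] need not be
    bounded, so that its product with [rho (u - v)] is integrable only because
    the product with [A1] is, the other parts of [A1] being continuous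
    ([st_int_div]). *)

(** * Smooth functions and the symmetry of second derivatives *)

Section Ck.
Context (R : realType) (V : normedModType R).
Implicit Types f g : V -> R.

Lemma Ck_cont k f : Ck k f -> continuous f.
Proof.
case: k => [//|k] [df _] x; exact: differentiable_continuous.
Qed.

Lemma CkS k f : Ck k.+1 f -> Ck k f.
Proof.
elim: k f => [|k IH] f; first exact: Ck_cont.
by move=> [df Df]; split=> // h; exact: IH.
Qed.

Lemma Ck_cst k (c : R) : Ck k (fun _ : V => c).
Proof.
elim: k c => [|k IH] c; first by move=> x; exact: cst_continuous.
split=> [x|h]; first exact: differentiable_cst.
rewrite (_ : 'D_h _ = fun=> 0); first exact: IH.
by apply/funext => x; exact: derive_cst.
Qed.

Lemma Ck_add k f g : Ck k f -> Ck k g -> Ck k (fun x => f x + g x).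
Proof.
elim: k f g => [|k IH] f g; first by move=> cf cg x; exact: cvgD (cf x) (cg x).
move=> [df Df] [dg Dg]; split=> [x|h]; first exact: (@differentiableD _ _ _ f g x (df x) (dg x)).
rewrite (_ : 'D_h _ = fun x => 'D_h f x + 'D_h g x); first exact: IH (Df h) (Dg h).
by apply/funext => x; apply: deriveD; exact: diff_derivable.
Qed.

Lemma Ck_mul k f g : Ck k f -> Ck k g -> Ck k (fun x => f x * g x).
Proof.
elim: k f g => [|k IH] f g; first by move=> cf cg x; exact: cvgM (cf x) (cg x).
move=> Cf Cg; have [[df Df] [dg Dg]] := (Cf, Cg).
split=> [x|h]; first exact: (@differentiableM _ _ f g x (df x) (dg x)).
rewrite (_ : 'D_h _ = fun x => f x * 'D_h g x + g x * 'D_h f x); last first.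
  by apply/funext => x; apply: deriveM; exact: diff_derivable.
exact: Ck_add (IH _ _ (CkS Cf) (Dg h)) (IH _ _ (CkS Cg) (Df h)).
Qed.

Lemma Ck_inv k f : (forall x, f x != 0) -> Ck k f -> Ck k (fun x => (f x)^-1).
Proof.
move=> f0; elim: k f f0 => [|k IH] f f0.
  by move=> cf x; exact: cvgV (f0 x) (cf x).
move=> Cf; have [df Df] := Cf.
split=> [x|h]; first exact: differentiableV.
rewrite (_ : 'D_h _ = fun x => (-1) * (((f x)^-1 * (f x)^-1) * 'D_h f x)); last first.
  apply/funext => x; rewrite deriveV//; last exact: diff_derivable.
  by rewrite /GRing.scale/= expr2 invfM; ring.
have ? := IH _ f0 (CkS Cf).
exact: Ck_mul (Ck_cst _ _) (Ck_mul (Ck_mul _ _) (Df h)).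
Qed.

Lemma derive_chain (g : R -> R) f x h :
  differentiable f x -> derivable g (f x) 1 ->
  differentiable (fun y => g (f y)) x /\
  'D_h (fun y => g (f y)) x = derive1 g (f x) * 'D_h f x.
Proof.
move=> df dg; have dg' : differentiable g (f x) by exact/derivable1_diffP.
have dgf : differentiable (g \o f) x by exact: differentiable_comp.
split; first exact: dgf.
rewrite (deriveE _ dgf) diff_comp//= diff1E// -deriveE//.
by rewrite /GRing.scale/= mulrC.
Qed.

Lemma Ck_ln k f : (forall x, 0 < f x) -> Ck k f -> Ck k (fun x => ln (f x)).
Proof.
move=> f0; have f0' x : f x != 0 by rewrite gt_eqF.
have dl x : derivable (@ln R) (f x) 1 by case: (is_derive1_ln (f0 x)).
case: k => [|k].
  move=> cf x; apply: (continuous_comp (cf x)); apply: differentiable_continuous.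
  by apply/derivable1_diffP; exact: dl.
move=> Cf; have [df Df] := Cf.
split=> [x|h]; first exact: (derive_chain 0 (df x) (dl x)).1.
rewrite (_ : 'D_h _ = fun x => (f x)^-1 * 'D_h f x).
  by apply: Ck_mul; [exact: Ck_inv f0' (CkS Cf)|exact: Df].
apply/funext => x; rewrite (derive_chain h (df x) (dl x)).2 derive1E.
by rewrite (@derive_val _ _ _ _ _ _ _ (is_derive1_ln (f0 x))).
Qed.

Lemma smooth_derive f h : smooth f -> smooth ('D_h f).
Proof. by move=> sf k; have [_ Df] := sf k.+1; exact: Df. Qed.

Lemma smooth_diff f x : smooth f -> differentiable f x.
Proof. by move=> /(_ 1%N) [df _]; exact: df. Qed.

End Ck.

(** The difference quotients agree when [phi] is affine along [l]. It is used
    for lines, for slices of [R * X] and for prepended coordinates. *)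
Lemma derive_reparam (R : realType) (U V W : normedModType R) (g : V -> W)
    (phi : U -> V) (l : U) (L : V) (t : U) :
  (forall h : R, phi (h *: l + t) = h *: L + phi t) ->
  (derivable (fun x => g (phi x)) t l <-> derivable g (phi t) L) /\
  'D_l (fun x => g (phi x)) t = 'D_L g (phi t).
Proof.
move=> phiE; rewrite /derivable /derive.
have -> : (fun h : R => h^-1 *: (((fun x => g (phi x)) \o shift t) (h *: l) -
    g (phi t))) = (fun h : R => h^-1 *: ((g \o shift (phi t)) (h *: L) - g (phi t))).
  by apply/funext => h /=; rewrite phiE.
by [].
Qed.

Section Schwarz.
Context (R : realType) (V : normedModType R).
Implicit Types f g : V -> R.

Lemma smooth_line_derive g (y l : V) (t : R) : smooth g ->
  is_derive t 1 (fun t : R => g (y + t *: l)) ('D_l g (y + t *: l)).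
Proof.
move=> sg.
have phiE (h : R) : y + (h *: (1 : R) + t) *: l = h *: l + (y + t *: l).
  by rewrite [h *: 1]mulr1 scalerDl addrCA.
have [dE DE] := @derive_reparam R R V R g (fun t : R => y + t *: l) 1 l t phiE.
apply: DeriveDef; last by rewrite DE.
by apply/dE; apply: diff_derivable; exact: smooth_diff.
Qed.

(** Both orders of differentiation are values of one symmetric second
    difference, by the mean value theorem applied in each order. *)
Lemma second_difference f z h k (s : R) : smooth f -> 0 < s ->
  exists a b, [/\ 0 <= a <= s, 0 <= b <= s &
    f (z + s *: k + s *: h) - f (z + s *: h) - f (z + s *: k) + f z =
    s ^+ 2 * 'D_k ('D_h f) (z + a *: h + b *: k)].
Proof.
move=> sf s0.
have line_cont (g : R -> R) dg : (forall t : R, is_derive t 1 g (dg t)) ->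
    {within `[0, s], continuous g}.
  move=> gd; apply: continuous_subspaceT => t; apply: differentiable_continuous.
  by apply/derivable1_diffP; case: (gd t).
pose g (t : R) := f (z + s *: k + t *: h) - f (z + t *: h).
have gd (t : R) : is_derive t 1 g
    ('D_h f (z + s *: k + t *: h) - 'D_h f (z + t *: h)).
  by apply: is_deriveB; exact: smooth_line_derive.
have [a + ga] := MVT_segment (ltW s0) (fun t _ => gd t) (line_cont _ _ gd).
rewrite in_itv/= => a0s.
have kd (t : R) : is_derive t 1 (fun t : R => 'D_h f (z + a *: h + t *: k))
    ('D_k ('D_h f) (z + a *: h + t *: k)).
  by apply: smooth_line_derive; exact: smooth_derive.
have [b + kb] := MVT_segment (ltW s0) (fun t _ => kd t) (line_cont _ _ kd).
rewrite in_itv/= => b0s.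
exists a, b; split=> //; move: ga kb; rewrite /g !scale0r !addr0 !subr0.
move=> ga kb.
transitivity (f (z + s *: k + s *: h) - f (z + s *: h) -
   (f (z + s *: k) - f z)); first by ring.
rewrite ga (addrAC z (s *: k) (a *: h)) kb expr2; ring.
Qed.

(** The sample points tend to [z] with [s]. *)
Lemma continuous_agree (P Q : V -> R) z h k : continuous P -> continuous Q ->
  (forall s : R, 0 < s -> exists a b c d : R,
     [/\ 0 <= a <= s, 0 <= b <= s, 0 <= c <= s, 0 <= d <= s &
        P (z + a *: h + b *: k) = Q (z + c *: k + d *: h)]) ->
  P z = Q z.
Proof.
move=> cP cQ PQ.
apply/eqP; rewrite -subr_eq0 -normr_le0; apply/ler_addgt0Pl => e e0.
rewrite addr0.
have e2 : 0 < e / 2 by rewrite divr_gt0.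
have near0 (G : V -> R) h' k' : continuous G -> \forall s \near (0 : R)^'+,
    forall a b : R, 0 <= a <= s -> 0 <= b <= s ->
    `|G z - G (z + a *: h' + b *: k')| < e / 2.
  move=> /(_ z)/cvgrPdist_lt/(_ _ e2)/nbhs_normP[d /= d0 dP].
  pose M := `|h'| + `|k'| + 1.
  have M0 : 0 < M by rewrite ltr_wpDl// addr_ge0.
  near=> s => a b /andP[a0 aS] /andP[b0 bs]; apply: dP => /=.
  rewrite -addrA opprD addNKr normrN.
  rewrite (le_lt_trans (ler_normD _ _))// !normrZ !ger0_norm//.
  apply: (@le_lt_trans _ _ (s * M)).
    rewrite /M -addrA mulrDr lerD// ?ler_wpM2r//.
    by rewrite mulrDr mulr1 ler_wpDr ?ler_wpM2r// (le_trans a0).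
  rewrite -ltr_pdivlMr//; near: s; apply: nbhs_right_lt; exact: divr_gt0.
have [s [[s0 H1] H2]] := filter_ex (filterI (filterI (nbhs_right_gt (0 : R))
  (near0 P h k cP)) (near0 Q k h cQ)).
have [a [b [c [d [ha hb hc hd E]]]]] := PQ s s0.
have {}H1 := ltW (H1 _ _ ha hb); have {}H2 := ltW (H2 _ _ hc hd).
rewrite distrC in H2; rewrite -E in H2.
by rewrite -(subrKA (P (z + a *: h + b *: k))) (le_trans (ler_normD _ _))// (splitr e) lerD.
Unshelve. all: by end_near. Qed.

Lemma derive_comm f z h k : smooth f -> 'D_k ('D_h f) z = 'D_h ('D_k f) z.
Proof.
move=> sf; apply: (@continuous_agree ('D_k ('D_h f)) ('D_h ('D_k f)) z h k).
- exact: (smooth_derive k (smooth_derive h sf) 0%N).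
- exact: (smooth_derive h (smooth_derive k sf) 0%N).
move=> s s0.
have [a [b [ha hb E1]]] := second_difference z h k sf s0.
have [c [d [hc hd E2]]] := second_difference z k h sf s0.
exists a, b, c, d; split; [exact: ha|exact: hb|exact: hc|exact: hd|].
apply: (@mulfI _ (s ^+ 2)); first by rewrite expf_neq0// gt_eqF.
apply: etrans (esym E1) (etrans _ E2).
by rewrite (addrAC z (s *: k)) (addrAC _ (- f (z + s *: h))).
Qed.

End Schwarz.

(** * Partial derivatives of space-time functions *)

(** Locked, so that two derivatives are compared by their functions and not by
    unfolding the limits that define them. *)
HB.lock Definition Dt (R : realType) (d : nat) (f : R -> 'rV[R]_d -> R) :
  R -> 'rV[R]_d -> R := fun t x => derive1 (fun s => f s x) t.
HB.lock Definition Dx (R : realType) (d : nat) (j : 'I_d)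
  (f : R -> 'rV[R]_d -> R) : R -> 'rV[R]_d -> R := fun t x => pd j (f t) x.

Section StSmooth.
Context (R : realType) (d : nat).
Local Notation X := 'rV[R]_d.
Implicit Types (f g : R -> X -> R).

Definition uncur f : R * X -> R := fun z => f z.1 z.2.

Lemma derive_x f t x (h : X) :
  'D_h (f t) x = 'D_((0, h) : R * X) (uncur f) (t, x).
Proof.
have phiE (s : R) : (t, s *: h + x) = s *: ((0, h) : R * X) + (t, x).
  by congr pair; rewrite /= scaler0 add0r.
exact: (@derive_reparam R X (R * X)%type R (uncur f) (fun x => (t, x)) h (0, h) x phiE).2.
Qed.

Lemma derivable_x f t x (h : X) : smooth (uncur f) -> derivable (f t) x h.
Proof.
move=> sf.
have phiE (s : R) : (t, s *: h + x) = s *: ((0, h) : R * X) + (t, x).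
  by congr pair; rewrite /= scaler0 add0r.
apply/(@derive_reparam R X (R * X)%type R (uncur f) (fun x => (t, x)) h (0, h) x phiE).1.
by apply: diff_derivable; exact: smooth_diff.
Qed.

Lemma derive_t f t x :
  derive1 (fun s => f s x) t = 'D_((1, 0) : R * X) (uncur f) (t, x).
Proof.
have phiE (s : R) : (s *: (1 : R) + t, x) = s *: ((1, 0) : R * X) + (t, x).
  by congr pair; rewrite /= scaler0 add0r.
rewrite derive1E.
exact: (@derive_reparam R R (R * X)%type R (uncur f) (fun t => (t, x)) 1 (1, 0) t phiE).2.
Qed.

Lemma derivable_t f t x : smooth (uncur f) -> derivable (fun s => f s x) t 1.
Proof.
move=> sf.
have phiE (s : R) : (s *: (1 : R) + t, x) = s *: ((1, 0) : R * X) + (t, x).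
  by congr pair; rewrite /= scaler0 add0r.
apply/(@derive_reparam R R (R * X)%type R (uncur f) (fun t => (t, x)) 1 (1, 0) t phiE).1.
by apply: diff_derivable; exact: smooth_diff.
Qed.

Lemma DtE f t x : Dt f t x = derive1 (fun s => f s x) t.
Proof. by rewrite unlock. Qed.

Lemma DxE j f t x : Dx j f t x = pd j (f t) x.
Proof. by rewrite unlock. Qed.

Lemma uncur_Dt f : uncur (Dt f) = 'D_((1, 0) : R * X) (uncur f).
Proof. by apply/funext => -[t x]; rewrite /uncur/= DtE; exact: derive_t. Qed.

Lemma uncur_Dx j f : uncur (Dx j f) = 'D_((0, delta_mx 0 j) : R * X) (uncur f).
Proof. by apply/funext => -[t x]; rewrite /uncur/= DxE; exact: derive_x. Qed.

Lemma derive_periodic (W : normedModType R) (f : X -> W) h :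
  tperiodic f -> tperiodic ('D_h f).
Proof.
move=> pf x j; rewrite /derive.
rewrite (_ : (fun s : R => s^-1 *: ((f \o shift (x + delta_mx 0 j)) (s *: h) -
  f (x + delta_mx 0 j))) = (fun s : R => s^-1 *: ((f \o shift x) (s *: h) - f x)))//.
by apply/funext => s /=; rewrite pf addrA pf.
Qed.

Lemma st_smooth_Dx j f : st_smooth f -> st_smooth (Dx j f).
Proof.
move=> [pf sf]; split; first by move=> t x k; rewrite !DxE; apply: derive_periodic; exact: pf.
by rewrite -/(uncur _) uncur_Dx; exact: smooth_derive.
Qed.

Lemma st_smooth_Dt f : st_smooth f -> st_smooth (Dt f).
Proof.
move=> [pf sf]; split; last by rewrite -/(uncur _) uncur_Dt; exact: smooth_derive.
move=> t x j; rewrite !DtE; have -> // : (fun s => f s (x + delta_mx 0 j)) = f^~ x.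
by apply/funext => s; exact: pf.
Qed.

Lemma st_smooth_cst (c : R) : st_smooth (fun (_ : R) (_ : X) => c).
Proof. by split=> // k; exact: Ck_cst. Qed.

Lemma st_smoothD f g : st_smooth f -> st_smooth g ->
  st_smooth (fun t x => f t x + g t x).
Proof.
move=> [pf sf] [pg sg]; split=> [t x j|k]; first by rewrite pf pg.
by apply: Ck_add; [exact: sf|exact: sg].
Qed.

Lemma st_smoothM f g : st_smooth f -> st_smooth g ->
  st_smooth (fun t x => f t x * g t x).
Proof.
move=> [pf sf] [pg sg]; split=> [t x j|k]; first by rewrite pf pg.
by apply: Ck_mul; [exact: sf|exact: sg].
Qed.

Lemma st_smooth_sum (I : finType) (F : I -> R -> X -> R) :
  (forall i, st_smooth (F i)) -> st_smooth (fun t x => \sum_i F i t x).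
Proof.
move=> sF; rewrite (_ : (fun t x => _) = \big[(fun f g => fun t x => f t x + g t x)/(fun _ _ => 0)]_i F i).
  by elim/big_ind: _ => //; [exact: st_smooth_cst|exact: st_smoothD].
apply/funext => t; apply/funext => x.
by elim/big_rec2: _ => // i y1 y2 _ ->.
Qed.

Lemma st_smoothV f : (forall t x, 0 < f t x) -> st_smooth f ->
  st_smooth (fun t x => (f t x)^-1).
Proof.
move=> f0 [pf sf]; split=> [t x j|k]; first by rewrite pf.
by apply: Ck_inv; [move=> z; rewrite gt_eqF|exact: sf].
Qed.

Lemma st_smooth_ln f : (forall t x, 0 < f t x) -> st_smooth f ->
  st_smooth (fun t x => ln (f t x)).
Proof.
move=> f0 [pf sf]; split=> [t x j|k]; first by rewrite pf.
by apply: Ck_ln; [move=> z; exact: f0|exact: sf].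
Qed.

Lemma Dx_comm i j f : st_smooth f -> Dx i (Dx j f) = Dx j (Dx i f).
Proof.
move=> [_ sf]; apply/funext => t; apply/funext => x.
change (uncur (Dx i (Dx j f)) (t, x) = uncur (Dx j (Dx i f)) (t, x)).
rewrite (uncur_Dx i (Dx j f)) (uncur_Dx j f) (uncur_Dx j (Dx i f)) (uncur_Dx i f).
exact: derive_comm.
Qed.

Lemma Dt_Dx j f : st_smooth f -> Dt (Dx j f) = Dx j (Dt f).
Proof.
move=> [_ sf]; apply/funext => t; apply/funext => x.
change (uncur (Dt (Dx j f)) (t, x) = uncur (Dx j (Dt f)) (t, x)).
rewrite (uncur_Dt (Dx j f)) (uncur_Dx j f) (uncur_Dx j (Dt f)) (uncur_Dt f).
exact: derive_comm.
Qed.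

Lemma DxD j f g t x : st_smooth f -> st_smooth g ->
  Dx j (fun t x => f t x + g t x) t x = Dx j f t x + Dx j g t x.
Proof.
move=> [_ sf] [_ sg]; rewrite !DxE /pd.
exact: deriveD (@derivable_x f t x _ sf) (@derivable_x g t x _ sg).
Qed.

Lemma DxM j f g t x : st_smooth f -> st_smooth g ->
  Dx j (fun t x => f t x * g t x) t x = f t x * Dx j g t x + g t x * Dx j f t x.
Proof.
move=> [_ sf] [_ sg]; rewrite !DxE /pd.
exact: deriveM (@derivable_x f t x _ sf) (@derivable_x g t x _ sg).
Qed.

Lemma DtD f g t x : st_smooth f -> st_smooth g ->
  Dt (fun t x => f t x + g t x) t x = Dt f t x + Dt g t x.
Proof.
move=> [_ sf] [_ sg]; rewrite !DtE !derive1E.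
exact: deriveD (@derivable_t f t x sf) (@derivable_t g t x sg).
Qed.

Lemma DtM f g t x : st_smooth f -> st_smooth g ->
  Dt (fun t x => f t x * g t x) t x = f t x * Dt g t x + g t x * Dt f t x.
Proof.
move=> [_ sf] [_ sg]; rewrite !DtE !derive1E.
exact: deriveM (@derivable_t f t x sf) (@derivable_t g t x sg).
Qed.

Lemma Dx_cst j (c t : R) (x : X) : Dx j (fun _ _ => c) t x = 0.
Proof. by rewrite DxE; exact: derive_cst. Qed.

Lemma Dt_cst (c t : R) (x : X) : Dt (fun _ _ => c) t x = 0.
Proof. by rewrite DtE; exact: derive1_cst. Qed.

Lemma Dx_sum (I : finType) (F : I -> R -> X -> R) j t x :
  (forall i, st_smooth (F i)) ->
  Dx j (fun t x => \sum_i F i t x) t x = \sum_i Dx j (F i) t x.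
Proof.
move=> sF; suff : forall s : seq I, st_smooth (fun t x => \sum_(i <- s) F i t x) /\
    Dx j (fun t x => \sum_(i <- s) F i t x) t x = \sum_(i <- s) Dx j (F i) t x.
  by move=> /(_ (index_enum I)) [].
elim=> [|i s [IH1 IH2]].
  under eq_fun do under eq_fun do rewrite big_nil.
  by rewrite big_nil Dx_cst; split=> //; exact: st_smooth_cst.
under eq_fun do under eq_fun do rewrite big_cons.
by rewrite big_cons DxD// IH2; split=> //; exact: st_smoothD.
Qed.

Lemma Dt_sum (I : finType) (F : I -> R -> X -> R) t x :
  (forall i, st_smooth (F i)) ->
  Dt (fun t x => \sum_i F i t x) t x = \sum_i Dt (F i) t x.
Proof.
move=> sF; suff : forall s : seq I, st_smooth (fun t x => \sum_(i <- s) F i t x) /\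
    Dt (fun t x => \sum_(i <- s) F i t x) t x = \sum_(i <- s) Dt (F i) t x.
  by move=> /(_ (index_enum I)) [].
elim=> [|i s [IH1 IH2]].
  under eq_fun do under eq_fun do rewrite big_nil.
  by rewrite big_nil Dt_cst; split=> //; exact: st_smooth_cst.
under eq_fun do under eq_fun do rewrite big_cons.
by rewrite big_cons DtD// IH2; split=> //; exact: st_smoothD.
Qed.

(** Differentiability of [g] suffices; the pressure and its potential need not be
    smooth. *)
Lemma Dx_comp j (g : R -> R) f t x : st_smooth f -> derivable g (f t x) 1 ->
  Dx j (fun t x => g (f t x)) t x = derive1 g (f t x) * Dx j f t x.
Proof.
move=> [_ sf] dg; rewrite !DxE /pd (derive_x (fun t x => g (f t x))) (derive_x f).
exact: (@derive_chain R (R * X)%type g (uncur f) (t, x) (0, delta_mx 0 j) (smooth_diff (t, x) sf) dg).2.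
Qed.

Lemma Dt_comp (g : R -> R) f t x : st_smooth f -> derivable g (f t x) 1 ->
  Dt (fun t x => g (f t x)) t x = derive1 g (f t x) * Dt f t x.
Proof.
move=> [_ sf] dg; rewrite !DtE (derive_t (fun t x => g (f t x))) (derive_t f).
exact: (@derive_chain R (R * X)%type g (uncur f) (t, x) (1, 0) (smooth_diff (t, x) sf) dg).2.
Qed.

End StSmooth.

(** * Continuous functions on space-time *)

Section Cell.
Context (R : realType) (d : nat).
Local Notation X := 'rV[R]_d.
Local Notation TR := (measurableTypeR R).
Implicit Types (f g : R -> X -> R).

Definition st_cont f := (forall t, tperiodic (f t)) /\ continuous (uncur f).

Lemma st_smooth_cont f : st_smooth f -> st_cont f.
Proof. by move=> [pf sf]; split=> //; exact: (sf 0%N). Qed.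

Lemma st_cont_cst (c : R) : st_cont (fun _ _ => c).
Proof. by split=> // z; exact: cst_continuous. Qed.

Lemma st_contD f g : st_cont f -> st_cont g -> st_cont (fun t x => f t x + g t x).
Proof.
move=> [pf cf] [pg cg]; split=> [t x j|z]; first by rewrite pf pg.
exact: cvgD (cf z) (cg z).
Qed.

Lemma st_contM f g : st_cont f -> st_cont g -> st_cont (fun t x => f t x * g t x).
Proof.
move=> [pf cf] [pg cg]; split=> [t x j|z]; first by rewrite pf pg.
exact: cvgM (cf z) (cg z).
Qed.

Lemma st_contN f : st_cont f -> st_cont (fun t x => - f t x).
Proof.
move=> [pf cf]; split=> [t x j|z]; first by rewrite pf.
exact: cvgN (cf z).
Qed.

Lemma st_cont_sum (I : finType) (F : I -> R -> X -> R) :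
  (forall i, st_cont (F i)) -> st_cont (fun t x => \sum_i F i t x).
Proof.
move=> sF; rewrite (_ : (fun t x => _) = \big[(fun f g => fun t x => f t x + g t x)/(fun _ _ => 0)]_i F i).
  by elim/big_ind: _ => //; [exact: st_cont_cst|exact: st_contD].
apply/funext => t; apply/funext => x.
by elim/big_rec2: _ => // i y1 y2 _ ->.
Qed.

Lemma st_cont_comp (g : R -> R) f : st_cont f ->
  (forall t x, {for f t x, continuous g}) -> st_cont (fun t x => g (f t x)).
Proof.
move=> [pf cf] cg; split=> [t x j|z]; first by rewrite pf.
exact: continuous_comp (cf z) (cg z.1 z.2).
Qed.

(** Periodicity reduces all suprema to the compact cell. *)
Lemma tperiodic_int (W : Type) (f : X -> W) (z : 'I_d -> int) x :
  tperiodic f -> f (x + \row_j (z j)%:~R) = f x.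
Proof.
move=> pf.
have pn j (n : nat) y : f (y + delta_mx 0 j *+ n) = f y.
  elim: n y => [|n IH] y; first by rewrite mulr0n addr0.
  by rewrite mulrS addrA IH pf.
have pz j (m : int) y : f (y + delta_mx 0 j *~ m) = f y.
  case: m => n; first exact: pn.
  by rewrite NegzE mulrNz -[LHS](pn j n.+1) subrK.
have -> : \row_j (z j)%:~R = \sum_j (delta_mx 0 j *~ z j) :> X.
  rewrite [LHS]row_sum_delta; apply: eq_bigr => j _.
  by rewrite mxE scaler_int.
elim: (index_enum _) x => [|j s IH] x; first by rewrite big_nil addr0.
by rewrite big_cons addrA IH pz.
Qed.

Definition cell : set X := [set y | forall i, `[0 : R, 1]%classic (y ord0 i)].

Lemma cell_repr (x : X) : exists2 y, cell y &
  forall (W : Type) (f : X -> W), tperiodic f -> f x = f y.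
Proof.
pose z j : int := Num.floor (x 0 j).
exists (x - \row_j (z j)%:~R).
  move=> i /=; rewrite in_itv/= !mxE /z.
  by have /andP[] := floor_itv (x ord0 i); rewrite intrD; lra.
by move=> W f pf; rewrite -(tperiodic_int z (x - _) pf) subrK.
Qed.

Lemma cell_compact : compact cell.
Proof. exact: (@rV_compact R d (fun=> `[0 : R, 1]%classic) (fun i => @segment_compact R 0 1)). Qed.

Lemma stcell_compact T : compact (`[0, T]%classic `*` cell : set (R * X)).
Proof. exact: compact_setX (@segment_compact _ _ _) cell_compact. Qed.

Lemma st_cont_max T f : 0 <= T -> st_cont f ->
  exists2 z : R * X, 0 <= z.1 <= T & forall t x, 0 <= t <= T -> f t x <= f z.1 z.2.
Proof.
move=> T0 [pf cf].
have C0 : (`[0, T]%classic `*` cell : set (R * X)) !=set0.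
  exists (0, 0); split=> /=; first by rewrite in_itv/= lexx.
  by move=> i /=; rewrite in_itv/= mxE lexx ler01.
have [z zC zmax] := compact_EVT_max C0 (@stcell_compact T) (continuous_subspaceT cf).
move: zC; rewrite inE => -[/=]; rewrite in_itv/= => z1 z2.
exists z => // t x tT; have [y Cy ->//] := cell_repr x.
by apply: (zmax (t, y)); apply/mem_set; split=> //=; rewrite in_itv.
Qed.

Lemma st_cont_min T f : 0 <= T -> st_cont f ->
  exists2 z : R * X, 0 <= z.1 <= T & forall t x, 0 <= t <= T -> f z.1 z.2 <= f t x.
Proof.
move=> T0 /st_contN /(st_cont_max T0)[z zT zm]; exists z => // t x tT.
by rewrite -lerN2 zm.
Qed.

Lemma st_cont_bounded T f : st_cont f ->
  exists2 B, 0 <= B & forall t x, 0 <= t <= T -> `|f t x| <= B.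
Proof.
move=> cf; have [T0|T0] := leP 0 T; last first.
  by exists 0 => // t x /andP[t0 tT]; move: (le_lt_trans (le_trans t0 tT) T0); rewrite ltxx.
have [z zT zm] := st_cont_max T0 cf; have [y yT ym] := st_cont_min T0 cf.
exists (`|f z.1 z.2| + `|f y.1 y.2|); first by rewrite addr_ge0.
move=> t x tT; have := zm t x tT; have := ym t x tT.
have := ler_norm (f z.1 z.2); have := ler_norm (- f y.1 y.2); rewrite normrN.
have := normr_ge0 (f z.1 z.2); have := normr_ge0 (f y.1 y.2).
by rewrite ler_norml; lra.
Qed.

(** An open subset of [R * X] is a countable union of boxes with rational
    centre and radius. *)
Lemma measurable_cont_comp dd (Z : measurableType dd) (F : R * X -> R)
    (zeta : Z -> TR) (xi : Z -> d.-tuple TR) :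
  continuous F -> measurable_fun setT zeta -> measurable_fun setT xi ->
  measurable_fun setT (fun z => F (zeta z, torus_pt (xi z))).
Proof.
move=> cF mz mx.
apply: (measurability _ (RGenOInfty.measurableE R)) => /= _ [_ [a ->]] <-.
rewrite setTI.
pose W := F @^-1` `]a, +oo[%classic.
have oW : open W.
  apply: open_comp; first by move=> z _; exact: cF.
  exact: interval_open.
pose I : Type := (rat * {ffun 'I_d -> rat} * rat)%type.
pose box (q : I) : set (R * X) :=
  [set z : R * X | `|z.1 - ratr q.1.1| < ratr q.2 /\
     forall i, `|z.2 0 i - ratr (q.1.2 i)| < ratr q.2].
rewrite (_ : _ @^-1` _ = \bigcup_(q : I)
   (if `[< box q `<=` W >] then
     [set z | `|zeta z - ratr q.1.1| < ratr q.2] `&`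
      \bigcap_(i in [set: 'I_d]) [set z | `|tnth (xi z) i - ratr (q.1.2 i)| < ratr q.2]
    else set0)).
  apply: countable_bigcupT_measurable; first exact: countableP.
  move=> q; case: ifP => // _; apply: measurableI.
    rewrite -[X in measurable X]setTI.
    have -> : [set z | `|zeta z - ratr q.1.1| < ratr q.2] =
       zeta @^-1` (ball (ratr q.1.1 : R) (ratr q.2)).
      by apply/seteqP; split=> z /=; rewrite /ball/= distrC.
    by apply: mz => //; exact: measurable_ball.
  apply: fin_bigcap_measurable => // i _.
  rewrite -[X in measurable X]setTI.
  have -> : [set z | `|tnth (xi z) i - ratr (q.1.2 i)| < ratr q.2] =
     (fun z => tnth (xi z) i) @^-1` (ball (ratr (q.1.2 i) : R) (ratr q.2)).
    by apply/seteqP; split=> z /=; rewrite /ball/= distrC.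
  apply: (measurableT_comp (measurable_tnth i) mx) => //.
  exact: measurable_ball.
apply/seteqP; split=> [z Wz|z [q _]]; last first.
  case: ifPn => [/asboolP bW [/= b1 b2]|//].
  apply: (bW (zeta z, torus_pt (xi z))); split=> //= i.
  by rewrite mxE; exact: b2.
have : nbhs ((zeta z, torus_pt (xi z)) : R * X) W.
  by apply: open_nbhs_nbhs; split.
move=> /nbhs_ballP[e /= e0 eW].
have e4 : 0 < e / 4 by rewrite divr_gt0.
have [p pe] := rat_in_itvoo (ltr_pwDr e4 (lexx (zeta z))).
have /choice[c ce] : forall i : 'I_d, exists q : rat,
    ratr q \in `]tnth (xi z) i, (tnth (xi z) i + e / 4)[.
  by move=> i; exact: rat_in_itvoo (ltr_pwDr e4 (lexx _)).
have [q qe] : exists q : rat, ratr q \in `](e / 4), (e / 2)[.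
  by apply: rat_in_itvoo; lra.
exists (p, [ffun i => c i], q) => //=.
move: pe qe; rewrite !in_itv/= => pe qe.
rewrite ifT; last first.
  apply/asboolP => -[s x] /= [b1 b2]; apply: eW; split=> /=.
    by rewrite /ball/=; move: b1; rewrite /= !ltr_norml; lra.
  rewrite /ball/= /mx_ball; split=> [|i j]; first by lra.
  rewrite ord1 mxE /ball/=; move: (b2 j) (ce j); rewrite /= ffunE in_itv/=.
  by rewrite !ltr_norml; lra.
split=> [|i _] /=; first by rewrite ltr_norml; lra.
by move: (ce i); rewrite /= ffunE in_itv/= ltr_norml; lra.
Qed.
End Cell.

(** * Integrability and Fubini on the strip *)

Section RealIntegrable.
Context dd (Z : measurableType dd) (R : realType) (m : {measure set Z -> \bar R}).
Variables (D : set Z) (mD : measurable D).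
Implicit Types f g : Z -> R.
Local Notation rint f := (m.-integrable D (fun z => (f z)%:E)).

Lemma rintD f g : rint f -> rint g -> rint (fun z => f z + g z).
Proof. by move=> hf hg; have := integrableD mD hf hg. Qed.

Lemma rintZ (c : R) f : rint f -> rint (fun z => c * f z).
Proof. by move=> hf; have := integrableZl mD c hf. Qed.

Lemma rintN f : rint f -> rint (fun z => - f z).
Proof. by move=> /(rintZ (-1)); under eq_fun do rewrite mulN1r. Qed.

Lemma rintB f g : rint f -> rint g -> rint (fun z => f z - g z).
Proof. by move=> hf /rintN; exact: rintD. Qed.

Lemma rint0 : rint (fun _ => 0).
Proof. exact: integrable0. Qed.

Lemma rint_sum (I : finType) (F : I -> Z -> R) :
  (forall i, rint (F i)) -> rint (fun z => \sum_i F i z).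
Proof.
move=> hF; have := @integrable_sum _ _ _ m _ mD I (index_enum I) xpredT
  (fun i z => (F i z)%:E) (fun i _ => hF i).
by under eq_fun do rewrite sumEFin.
Qed.

Lemma rint_measurable f : rint f -> measurable_fun D f.
Proof. by move=> /measurable_int /measurable_EFinP. Qed.

Lemma rint_dom f g : measurable_fun D f -> (forall z, D z -> `|f z| <= g z) ->
  rint g -> rint f.
Proof.
move=> mf fg; apply: le_integrable => //; first exact/measurable_EFinP.
by move=> z Dz; rewrite lee_fin (le_trans (fg z Dz))// ler_norm.
Qed.

Lemma rint_bounded f g B : measurable_fun D f -> (forall z, D z -> `|f z| <= B) ->
  rint g -> rint (fun z => f z * g z).
Proof.
move=> mf fB hg; apply: (@rint_dom _ (fun z => `|B * g z|)).
- by apply: measurable_funM => //; exact: rint_measurable.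
- by move=> z Dz; rewrite !normrM ler_wpM2r// (le_trans (fB z Dz))// ler_norm.
- by have /rintZ - /(_ B)/integrable_norm := hg.
Qed.

Lemma Rintegral_sum (I : finType) (F : I -> Z -> R) :
  (forall i, rint (F i)) ->
  \int[m]_(z in D) (\sum_i F i z) = \sum_i \int[m]_(z in D) F i z.
Proof.
move=> hF; suff : forall s : seq I, rint (fun z => \sum_(i <- s) F i z) /\
    \int[m]_(z in D) (\sum_(i <- s) F i z) = \sum_(i <- s) \int[m]_(z in D) F i z.
  by move=> /(_ (index_enum I)) [].
elim=> [|i s [IH1 IH2]].
  under eq_fun do rewrite big_nil; under eq_Rintegral do rewrite big_nil.
  by rewrite big_nil Rintegral_cst// mul0r; split=> //; exact: rint0.
under eq_fun do rewrite big_cons; under eq_Rintegral do rewrite big_cons.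
rewrite big_cons (RintegralD mD (hF i) IH1) IH2; split=> //.
exact: rintD (hF i) IH1.
Qed.

Lemma RintegralN f : rint f -> \int[m]_(z in D) (- f z) = - \int[m]_(z in D) f z.
Proof.
by move=> hf; under eq_Rintegral do rewrite -mulN1r; rewrite RintegralZl// mulN1r.
Qed.

Lemma ae_le_Rintegral f g : rint f -> rint g ->
  {ae m, forall z, D z -> f z <= g z} ->
  \int[m]_(z in D) f z <= \int[m]_(z in D) g z.
Proof.
move=> hf hg fg; rewrite -subr_ge0 -RintegralB//.
rewrite (_ : \int[m]_(z in D) _ = \int[m]_(z in D) `|g z - f z|).
  by apply: Rintegral_ge0 => z _.
congr fine; apply: ae_eq_integral => //.
- by apply: measurable_int; exact: rintB hg hf.
- apply/measurable_EFinP; apply: measurableT_comp => //.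
  by apply: measurable_funB; exact: rint_measurable.
apply: filterS fg => z fg Dz.
by rewrite ger0_norm// subr_ge0 fg.
Qed.

End RealIntegrable.

Section Fubini.
Context (R : realType) (d : nat).
Local Notation X := 'rV[R]_d.
Local Notation TR := (measurableTypeR R).
Local Notation mu := (@lebesgue_measure R).
Local Notation tau := (torus_measure R d).
Implicit Types (f g : R -> X -> R).

Lemma measurable_strip (T : R) :
  measurable (`[0, T]%classic `*` setT : set (TR * d.-tuple TR)).
Proof. by apply: measurableX => //; exact: measurable_itv. Qed.

Lemma st_cont_measurable T f : st_cont f -> st_measurable T f.
Proof.
move=> [_ cf]; apply: (@measurable_funS _ _ _ _ setT) => //.
exact: (measurable_cont_comp cf (@measurable_fst _ _ TR _) (@measurable_snd _ _ _ _)).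
Qed.

Lemma st_measurable_section T f t : 0 <= t <= T -> st_measurable T f ->
  measurable_fun setT (fun y : d.-tuple TR => f t (torus_pt y)).
Proof.
move=> tT mf.
have := @measurable_comp _ _ _ _ _ _ _ (fun z : TR * d.-tuple TR => f z.1 (torus_pt z.2)) setT (pair t)
  (measurable_strip T) _ mf.
apply; last exact: measurable_pair1.
by move=> _ [y _ <-]; split=> //=; rewrite in_itv.
Qed.

Lemma st_integrableM T c f : st_cont c -> st_integrable T f ->
  st_integrable T (fun t x => c t x * f t x).
Proof.
move=> cc; have [B B0 cB] := st_cont_bounded T cc.
apply: (rint_bounded (f := fun z => c z.1 (torus_pt z.2)) (measurable_strip T) (B := B)).
  exact: st_cont_measurable.
by move=> z [/= zT _]; apply: cB; rewrite in_itv in zT.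
Qed.

Lemma tintegrableM T c (f : X -> R) t : 0 <= t <= T -> st_cont c ->
  tintegrable f -> tintegrable (fun x => c t x * f x).
Proof.
move=> tT cc; have [B B0 cB] := st_cont_bounded T cc.
apply: (rint_bounded (f := fun y => c t (torus_pt y)) measurableT (B := B)).
  exact: st_measurable_section tT (st_cont_measurable cc).
by move=> y _; apply: cB.
Qed.

Lemma tintegrable_cst (c : R) : tintegrable (fun _ : X => c).
Proof.
apply/integrableP; split; first exact: measurable_cst.
by rewrite integral_cst//= probability_setT mule1 ltry.
Qed.

Lemma st_integrable_cst T (c : R) : st_integrable T (fun _ (_ : X) => c).
Proof.
apply/integrableP; split; first exact: measurable_cst.
rewrite integral_cst//=; last exact: measurable_strip.
rewrite product_measure1E//= probability_setT mule1 lebesgue_measure_itv/=.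
by case: ifPn => _; rewrite -?EFinD -?EFinM ?mule0 ltry.
Qed.

Lemma st_cont_integrable T f : st_cont f -> st_integrable T f.
Proof.
move=> cf; have := st_integrableM cf (@st_integrable_cst T 1).
by rewrite (_ : (fun t x => f t x * 1) = f)//; apply/funext => t; apply/funext => x; rewrite mulr1.
Qed.

Lemma st_cont_tintegrable f t : st_cont f -> tintegrable (f t).
Proof.
move=> cf; have [t0|t0] := leP 0 t.
  have := @tintegrableM t f _ t _ cf (@tintegrable_cst 1).
  rewrite t0 lexx => /(_ isT).
  by rewrite (_ : (fun x => f t x * 1) = f t)//; apply/funext => x; rewrite mulr1.
have cf' : st_cont (fun s x => f (s + t) x).
  case: cf => pf cf; split=> // z.
  apply: (@continuous_comp _ _ _ (fun z : R * X => (z.1 + t, z.2)) (uncur f)); last exact: cf.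
  apply: (@cvg_pair _ _ _ _ (nbhs (z.1 + t)) (nbhs z.2)); last exact: cvg_snd.
  by apply: cvgD; [exact: cvg_fst|exact: cvg_cst].
have := @tintegrableM 0 _ _ 0 _ cf' (@tintegrable_cst 1).
rewrite lexx => /(_ isT).
by rewrite (_ : (fun x => f (0 + t) x * 1) = f t)//; apply/funext => x; rewrite mulr1 add0r.
Qed.

Lemma st_integrable_ae T f : st_integrable T f ->
  {ae mu, forall t, 0 <= t <= T -> tintegrable (f t)}.
Proof.
move=> /integrable_mkcond - /(_ (@measurable_strip T))/ae_integrable1.
apply: filterS => t /= ft tT; move: ft; rewrite /tintegrable.
congr (integrable _ _ _); apply/funext => y; rewrite patchE ifT//.
by apply/mem_set; split=> //=; rewrite in_itv.
Qed.

Lemma st_integrable_time T f t : st_integrable T f -> 0 <= t <= T ->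
  mu.-integrable `[0, t] (fun s => (tint (f s))%:E).
Proof.
move=> /integrable_mkcond - /(_ (@measurable_strip T)) hf /andP[t0 tT].
have hF := integrable_fubini_F hf; set G := fubini_F _ _ in hF.
have GE s : 0 <= s <= t -> G s = (\int[tau]_y (f s (torus_pt y))%:E)%E.
  move=> /andP[s0 st]; apply: eq_integral => y _; rewrite patchE ifT//.
  by apply/mem_set; split=> //=; rewrite in_itv/= s0 (le_trans st).
apply: (@le_integrable _ _ _ _ _ _ _ G) => //.
- apply: (eq_measurable_fun (fun s => (fine (G s))%:E)).
    by move=> s; rewrite inE/= in_itv/= => /GE ->.
  apply: (@measurable_funS _ _ _ _ setT) => //.
  apply/measurable_EFinP; apply: measurableT_comp => //.
  exact: (measurable_int mu hF).
- move=> s /=; rewrite in_itv/= => /GE; rewrite /tint /Rintegral => <-.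
  by case: (G s) => [r| |]/=; rewrite ?lexx ?normr0 ?leey.
- exact: integrableS hF.
Qed.
End Fubini.

(** * Integration by parts on the torus *)

Lemma continuous_pairr (U V : topologicalType) (a : U) :
  continuous (fun x : V => (a, x)).
Proof. by move=> x; apply: cvg_pair; [exact: cvg_cst|exact: cvg_id]. Qed.

Lemma continuous_pairl (U V : topologicalType) (x : V) :
  continuous (fun a : U => (a, x)).
Proof. by move=> a; apply: cvg_pair; [exact: cvg_id|exact: cvg_cst]. Qed.

Section TorusIBP.
Context (R : realType).
Local Notation TR := (measurableTypeR R).
Local Notation mu := (@lebesgue_measure R).

(** Prepends a coordinate, as [tuple_cons] does in the recursive definition of
    the torus measure; partial derivatives are moved through it below. *)
Definition row_ext n (a : R) (x : 'rV[R]_n) : 'rV[R]_n.+1 :=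
  \row_i (if unlift ord0 i is Some k then x 0 k else a).

Lemma torus_pt_cons n a (y : n.-tuple TR) :
  torus_pt (tuple_cons (a, y)) = row_ext a (torus_pt y).
Proof.
apply/rowP => i; rewrite !mxE; case: unliftP => [k|] ->.
  by rewrite mxE tnthS.
by rewrite tnth0.
Qed.

Lemma row_extD n a b (x y : 'rV[R]_n) :
  row_ext (a + b) (x + y) = row_ext a x + row_ext b y.
Proof. by apply/rowP => i; rewrite !mxE; case: unliftP => [k|] _; rewrite ?mxE. Qed.

Lemma row_extZ n c a (x : 'rV[R]_n) : row_ext (c * a) (c *: x) = c *: row_ext a x.
Proof. by apply/rowP => i; rewrite !mxE; case: unliftP => [k|] _; rewrite ?mxE. Qed.

Lemma row_ext_delta0 n : row_ext 1 (0 : 'rV[R]_n) = delta_mx 0 ord0.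
Proof. by apply/rowP => i; rewrite !mxE; case: unliftP => [k|] ->; rewrite ?mxE ?eqxx. Qed.

Lemma row_ext_deltaS n (j : 'I_n) :
  row_ext 0 (delta_mx 0 j : 'rV[R]_n) = delta_mx 0 (lift ord0 j).
Proof.
apply/rowP => i; rewrite !mxE; case: unliftP => [k|] ->; rewrite ?mxE ?eqxx//=.
Qed.

Lemma row_ext_continuous n : continuous (fun z : R * 'rV[R]_n => row_ext z.1 z.2).
Proof.
move=> z A /nbhs_ballP[e /= e0 eA]; apply/nbhs_ballP; exists e => //= w [w1 w2].
apply: eA; split=> // i j; rewrite !mxE; case: unliftP => [k|] _ //.
by case: w2 => _ /(_ 0 k).
Qed.

Lemma is_derive_row_extS n (f : 'rV[R]_n.+1 -> R) a x j l :
  is_derive (row_ext a x) (delta_mx 0 (lift ord0 j)) f l ->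
  is_derive x (delta_mx 0 j) (fun x => f (row_ext a x)) l.
Proof.
move=> [df Df].
have E (h : R) : row_ext a (h *: delta_mx 0 j + x) =
    h *: delta_mx 0 (lift ord0 j) + row_ext a x.
  by rewrite -{1}[a]add0r -(mulr0 h) row_extD row_extZ row_ext_deltaS.
have [H1 H2] := derive_reparam f E.
by apply: DeriveDef; [exact/H1|rewrite H2].
Qed.

Lemma is_derive_row_ext0 n (f : 'rV[R]_n.+1 -> R) a (x : 'rV[R]_n) l :
  is_derive (row_ext a x) (delta_mx 0 ord0) f l ->
  is_derive a 1 (fun a => f (row_ext a x)) l.
Proof.
move=> [df Df].
have E (h : R) : row_ext (h *: (1 : R) + a) x =
    h *: delta_mx 0 ord0 + row_ext a x.
  by rewrite -{1}[x]add0r -(scaler0 _ h) row_extD row_extZ row_ext_delta0.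
have [H1 H2] := @derive_reparam R R _ R f (fun a => row_ext a x) 1 _ a E.
by apply: DeriveDef; [exact/H1|rewrite H2].
Qed.

Lemma integral_unit_derive (f G : R -> R) (B : R) :
  (forall a : R, is_derive a 1 f (G a)) -> continuous G -> f 1 = f 0 ->
  (forall a, 0 <= G a + B) ->
  (\int[uniform_prob (@ltr01 R)]_a (G a + B)%:E = B%:E)%E.
Proof.
move=> df cG f10 G0.
have cGB : continuous (fun a => G a + B).
  by move=> a; apply: cvgD; [exact: cG|exact: cvg_cst].
rewrite integral_uniform; last 2 first.
- by apply/measurable_EFinP; apply: continuous_measurable_fun.
- by move=> a; rewrite lee_fin.
rewrite subr0 invr1 mul1e.
have dF (a : R) : is_derive a 1 (fun a => f a + B * a) (G a + B).
  have dB : is_derive a 1 (fun a : R => B * a) B.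
    by have := is_deriveZ B (is_derive_id a (1 : R)); rewrite [B *: 1]mulr1.
  exact: is_deriveD.
have cF : continuous (fun a => f a + B * a).
  move=> a; apply: differentiable_continuous; apply/derivable1_diffP.
  by case: (dF a).
rewrite (@continuous_FTC2 _ (fun a => G a + B) (fun a => f a + B * a))//.
- by rewrite f10 mulr1 mulr0 addr0 -EFinB addrAC subrr add0r.
- exact: continuous_subspaceT.
- split=> [a _||]; first by case: (dF a).
  + by apply: cvg_at_right_filter; exact: cF.
  + by apply: cvg_at_left_filter; exact: cF.
- by move=> a _; rewrite derive1E; case: (dF a).
Qed.

(** Shifting the derivative by a constant makes the integrand nonnegative, so
    that only the Tonelli form of the iterated integrals is needed. *)
Lemma torus_integral_derive n (j : 'I_n) (f G : 'rV[R]_n -> R) B :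
  (forall x, is_derive x (delta_mx 0 j) f (G x)) -> continuous G ->
  (forall x, f (x + delta_mx 0 j) = f x) -> (forall x, 0 <= G x + B) ->
  (\int[torus_measure R n]_y (G (torus_pt y) + B)%:E = B%:E)%E.
Proof.
elim: n j f G => [[]//|n IH] j f G df cG pf G0.
have mGn (k : nat) (H : 'rV[R]_k -> R) : continuous H ->
    measurable_fun setT (fun y : k.-tuple TR => (H (torus_pt y) + B)%:E).
  move=> cH; apply/measurable_EFinP; apply: measurable_funD => //.
  apply: (@measurable_cont_comp R k _ _ (fun z => H z.2) (fun=> 0) id) => //.
  move=> z; apply: (@continuous_comp _ _ _ (fun z : R * 'rV[R]_k => z.2) H).
    exact: cvg_snd.
  exact: cH.
rewrite /= ge0_integral_pushforward//=; last 2 first.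
- exact: mGn.
- by move=> y _; rewrite lee_fin.
have mG2 : measurable_fun setT (fun z : TR * n.-tuple TR =>
    (G (torus_pt (tuple_cons z)) + B)%:E).
  apply: (measurableT_comp (mGn _ _ cG)); exact: measurable_tuple_cons.
have cont_ext x : continuous (fun a => G (row_ext a x)).
  move=> a; apply: (@continuous_comp _ _ _ (fun a => row_ext a x) G); last exact: cG.
  apply: (@continuous_comp _ _ _ (fun a => (a, x)) (fun z => row_ext z.1 z.2)).
    exact: continuous_pairl.
  exact: row_ext_continuous.
have cont_ext2 a : continuous (fun x : 'rV[R]_n => G (row_ext a x)).
  move=> x; apply: (@continuous_comp _ _ _ (fun x => row_ext a x) G); last exact: cG.
  apply: (@continuous_comp _ _ _ (fun x => (a, x)) (fun z => row_ext z.1 z.2)).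
    exact: continuous_pairr.
  exact: row_ext_continuous.
case: (unliftP ord0 j) => [k|] jE.
- rewrite fubini_tonelli1//=; last by move=> z; rewrite lee_fin.
  rewrite /fubini_F/= (eq_integral (fun=> B%:E)).
    by rewrite integral_cst//= probability_setT mule1.
  move=> a _.
  transitivity (\int[torus_measure R n]_y (G (row_ext a (torus_pt y)) + B)%:E)%E.
    by apply: eq_integral => y _; rewrite torus_pt_cons.
  apply: (IH k (fun x => f (row_ext a x)) (fun x => G (row_ext a x))) => //.
  + by move=> x; apply: is_derive_row_extS; rewrite -jE.
  + by move=> x; rewrite -{1}[a]addr0 row_extD row_ext_deltaS -jE pf.
- rewrite fubini_tonelli2//=; last by move=> z; rewrite lee_fin.
  rewrite /fubini_G/= (eq_integral (fun=> B%:E)).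
    by rewrite integral_cst//= probability_setT mule1.
  move=> y _.
  transitivity (\int[uniform_prob (@ltr01 R)]_a (G (row_ext a (torus_pt y)) + B)%:E)%E.
    by apply: eq_integral => a _; rewrite torus_pt_cons.
  apply: (@integral_unit_derive (fun a => f (row_ext a (torus_pt y)))
    (fun a => G (row_ext a (torus_pt y)))) => //.
  + by move=> a; apply: is_derive_row_ext0; rewrite -jE.
  + rewrite -{1}[1]add0r -{1}[torus_pt y]addr0 row_extD row_ext_delta0 -jE.
    exact: pf.
Qed.

Lemma st_cont_section d (f : R -> 'rV[R]_d -> R) t : st_cont f -> continuous (f t).
Proof.
move=> [_ cf] x; apply: (@continuous_comp _ _ _ (fun x => (t, x)) (uncur f)).
  exact: continuous_pairr.
exact: cf.
Qed.

(** The constant [B] of [torus_integral_derive] is removed again, the torus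
    having measure one. *)
Lemma tint_Dx_eq0 d (j : 'I_d) (f : R -> 'rV[R]_d -> R) t : 0 <= t ->
  (forall x, derivable (f t) x (delta_mx 0 j)) -> tperiodic (f t) ->
  st_cont (Dx j f) -> tint (Dx j f t) = 0.
Proof.
move=> t0 df pf cD.
have [B B0 H] := st_cont_bounded t cD.
have GB x : `|Dx j f t x| <= B by apply: H; rewrite t0 lexx.
have iD := st_cont_tintegrable t cD.
have : tint (fun x => Dx j f t x + B) = B.
  rewrite /tint /Rintegral; set I := (\int[_]_(y in _) _)%E.
  suff -> : I = B%:E by [].
  apply: (@torus_integral_derive d j (f t) (Dx j f t)) => //.
  - by move=> x; rewrite DxE; exact: derivableP.
  - exact: st_cont_section.
  - by move=> x; have := GB x; rewrite ler_norml; lra.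
rewrite /tint RintegralD//; last exact: tintegrable_cst.
rewrite Rintegral_cst//= probability_setT/= mulr1; lra.
Qed.
End TorusIBP.

Section TimeFTC.
Context (R : realType) (d : nat).
Local Notation X := 'rV[R]_d.
Local Notation TR := (measurableTypeR R).
Local Notation mu := (@lebesgue_measure R).
Local Notation tau := (torus_measure R d).

Lemma st_cont_time_integrable T (g : R -> X -> R) x : st_cont g ->
  mu.-integrable `[0, T] (fun s => (g s x)%:E).
Proof.
move=> [_ cg]; apply: continuous_compact_integrable; first exact: segment_compact.
apply: continuous_subspaceT => s.
by apply: (@continuous_comp _ _ _ (fun s => (s, x)) (uncur g));
  [exact: continuous_pairl|exact: cg].
Qed.

Lemma time_swap T (g : R -> X -> R) : st_cont g ->
  time_int T (fun s => tint (g s)) = tint (fun x => time_int T (fun s => g s x)).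
Proof.
move=> cg; have [T0|T0] := leP 0 T; last first.
  have E f : time_int T f = 0.
    by rewrite /time_int set_itv_ge ?Rintegral_set0// bnd_simp -ltNge.
  rewrite E; under [X in tint X]eq_fun do rewrite E.
  by rewrite /tint Rintegral_cst// mul0r.
have hg0 := st_cont_integrable T cg.
move/integrable_mkcond : (hg0) => /(_ (@measurable_strip _ _ T)) hg.
set h := _ \_ _ in hg; have := Fubini hg.
have -> : (\int[mu]_x \int[tau]_y
   h (x, y) =
   \int[mu]_(s in `[0%R, T]) \int[tau]_y (g s (torus_pt y))%:E)%E.
  rewrite [RHS]integral_mkcond; apply: eq_integral => s _; rewrite /h patchE.
  case: ifPn => sT.
    apply: eq_integral => y _; rewrite /h patchE ifT//.
    by apply/mem_set; split=> //; move: sT; rewrite inE.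
  rewrite -[RHS](integral0 tau setT); apply: eq_integral => y _.
  by rewrite /h patchE ifN//; apply: contra sT; rewrite !inE => -[].
have -> : (\int[tau]_y \int[mu]_x
   h (x, y) =
   \int[tau]_y \int[mu]_(s in `[0%R, T]) (g s (torus_pt y))%:E)%E.
  apply: eq_integral => y _; rewrite [RHS]integral_mkcond; apply: eq_integral => s _.
  rewrite /h !patchE; congr (if _ then _ else _).
  by apply/idP/idP; rewrite !inE; [case|move=> sT; split].
move=> H.
rewrite /time_int /tint /Rintegral; congr fine.
transitivity (\int[mu]_(s in `[0%R, T]) \int[tau]_y (g s (torus_pt y))%:E)%E.
  apply: eq_integral => s _; rewrite fineK//.
  by apply: integrable_fin_num => //; exact: st_cont_tintegrable.
rewrite H; apply: eq_integral => y _; rewrite fineK//.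
apply: integrable_fin_num => //; exact: st_cont_time_integrable.
Qed.

(** After exchanging the integrals this is the fundamental theorem of calculus at
    each point of the torus. *)
Lemma tint_FTC T (P : R -> X -> R) : 0 <= T -> st_cont P -> st_cont (Dt P) ->
  (forall t x, derivable (fun s => P s x) t 1) ->
  tint (P T) - tint (P 0) = time_int T (fun s => tint (Dt P s)).
Proof.
move=> T0 cP cD dP; rewrite time_swap//.
rewrite -[LHS]RintegralB//; [|exact: st_cont_tintegrable..].
congr (Rintegral _ _ _); apply/funext => y.
move: T0; rewrite le_eqVlt => /predU1P[<-|T0].
  by rewrite /time_int set_itv1 Rintegral_set1 subrr.
have cfl (g : R -> X -> R) x : st_cont g -> continuous (fun s => g s x).
  move=> [_ cg] s.
  by apply: (@continuous_comp _ _ _ (fun s => (s, x)) (uncur g));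
    [exact: continuous_pairl|exact: cg].
rewrite /time_int /Rintegral.
rewrite (@continuous_FTC2 _ (fun s => Dt P s (torus_pt y)) (fun s => P s (torus_pt y)))//.
- by apply: continuous_subspaceT; exact: cfl.
- split=> [s _||]; first exact: dP.
  + by apply: cvg_at_right_filter; exact: cfl.
  + by apply: cvg_at_left_filter; exact: cfl.
- by move=> s _; rewrite DtE.
Qed.
End TimeFTC.

(** * The Gronwall lemma *)

Section Gronwall.
Context (R : realType).
Local Notation TR := (measurableTypeR R).
Local Notation mu := (@lebesgue_measure R).
Implicit Types (f g : R -> R).

Lemma rint_mkcond dd (Z : measurableType dd) (m : {measure set Z -> \bar R})
    (D : set Z) (f : Z -> R) : measurable D ->
  m.-integrable D (EFin \o f) <-> m.-integrable setT (EFin \o (f \_ D)).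
Proof. by move=> mD; rewrite -restrict_EFin; exact: integrable_mkcond. Qed.

Lemma mem_itvcc (a b x : R) : (x \in (`[a, b]%classic : set R)) = (a <= x <= b).
Proof. by apply/idP/idP; rewrite inE/= in_itv. Qed.

Lemma integrable_prod_fun f g :
  mu.-integrable setT (EFin \o f) -> mu.-integrable setT (EFin \o g) ->
  (mu \x mu)%E.-integrable setT (fun z : TR * TR => (f z.1 * g z.2)%:E).
Proof.
move=> hf hg.
have mf := rint_measurable hf; have mg := rint_measurable hg.
have mfg : measurable_fun setT (fun z : TR * TR => (f z.1 * g z.2)%:E).
  apply/measurable_EFinP; apply: measurable_funM.
    exact: (measurableT_comp mf measurable_fst).
  exact: (measurableT_comp mg measurable_snd).
have [_] := @integrable12ltyP _ _ _ _ R mu mu _ mfg; apply => /=.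
have [_ fo] := integrableP _ _ _ hf; have [_ go] := integrableP _ _ _ hg.
rewrite (eq_integral (fun x : TR => `|(f x)%:E| * \int[mu]_(y in [set: TR]) `|(g y)%:E|))%E; last first.
  move=> x _; rewrite -ge0_integralZl//; last first.
    by apply: measurableT_comp => //; exact/measurable_EFinP.
  by apply: eq_integral => y _; rewrite /= normrM EFinM.
rewrite ge0_integralZr//; last 2 first.
- by apply: measurableT_comp => //; exact/measurable_EFinP.
- exact: integral_ge0.
by apply: lte_mul_pinfty => //; [exact: integral_ge0|rewrite ge0_fin_numE//; exact: integral_ge0].
Qed.

Lemma continuous_expRM (c : R) : continuous (fun s : R => expR (c * s)).
Proof.
move=> s; apply: (@continuous_comp _ _ _ (fun s => c * s) expR); last exact: continuous_expR.
by apply: cvgM; [exact: cvg_cst|exact: cvg_id].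
Qed.

Lemma exp_integral (K a t : R) : a <= t ->
  (\int[mu]_(s in `[a, t]) (K * expR (- K * s))%:E =
   (expR (- K * a) - expR (- K * t))%:E)%E.
Proof.
rewrite le_eqVlt => /predU1P[->|at_].
  by rewrite set_itv1 integral_set1 subrr.
have dE (s : R) : is_derive s 1 (fun s => - expR (- K * s)) (K * expR (- K * s)).
  have dK : is_derive s 1 (fun s : R => - K * s) (- K).
    by have := is_deriveZ (- K) (is_derive_id s (1 : R)); rewrite [- K *: 1]mulr1.
  have := is_deriveN (is_derive1_comp (is_derive_expR (- K * s)) dK).
  by move=> H; apply: is_derive_eq H _; rewrite /GRing.scale/=; ring.
have dc : continuous (fun s => - expR (- K * s)).
  by move=> s; apply: cvgN; exact: continuous_expRM.
have cc : continuous (fun s : R => K * expR (- K * s)).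
  by move=> s; apply: cvgM; [exact: cvg_cst|exact: continuous_expRM].
rewrite (@continuous_FTC2 _ _ (fun s => - expR (- K * s)))//.
- by rewrite -EFinB opprK addrC.
- exact: continuous_subspaceT.
- split=> [s _||]; first by case: (dE s).
  + by apply: cvg_at_right_filter; exact: dc.
  + by apply: cvg_at_left_filter; exact: dc.
- by move=> s _; rewrite derive1E; case: (dE s).
Qed.

(** The product rule for [expR (- K * t)] and a primitive of an integrable
    function, by exchanging the order of integration over the triangle. *)
Lemma exp_primitive (K t : R) f : 0 <= t -> mu.-integrable `[0, t] (EFin \o f) ->
  time_int t (fun s => K * expR (- K * s) * time_int s f) =
  time_int t (fun s => f s * (expR (- K * s) - expR (- K * t))).
Proof.
move=> t0 hf.
pose a := (fun s => K * expR (- K * s)) \_ `[0, t].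
pose b := f \_ `[0, t].
have ha : mu.-integrable setT (EFin \o a).
  apply: (rint_mkcond mu _ (measurable_itv `[0, t])).1.
  apply: continuous_compact_integrable; first exact: segment_compact.
  apply: continuous_subspaceT => s; apply: cvgM; first exact: cvg_cst.
  exact: continuous_expRM.
have hb : mu.-integrable setT (EFin \o b).
  exact: (rint_mkcond mu f (measurable_itv `[0, t])).1 hf.
pose E : set (TR * TR) := [set z | z.2 <= z.1].
have mE : measurable E.
  have := measurable_fun_ler (@measurable_snd _ _ TR TR) (@measurable_fst _ _ TR TR).
  by move=> /(_ measurableT [set true]); rewrite setTI; apply.
have memE s y : ((s, y) \in E) = (y <= s) by apply/idP/idP; rewrite inE.
have hk := integrable_prod_fun ha hb.
have hE : (mu \x mu)%E.-integrable setT
    (EFin \o ((fun z : TR * TR => a z.1 * b z.2) \_ E)).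
  apply: (rint_mkcond (mu \x mu)%E _ mE).1.
  exact: integrableS hk.
have := Fubini hE.
set h := _ \_ E.
have hv s y : h (s, y) = if [&& 0 <= s <= t, 0 <= y <= t & y <= s]
    then K * expR (- K * s) * f y else 0.
  rewrite /h /a /b !patchE memE/= !mem_itvcc.
  case: (y <= s); rewrite ?andbF//= andbT.
  by case: (0 <= s <= t); case: (0 <= y <= t); rewrite /= ?mul0r ?mulr0.
have L : (\int[mu]_s \int[mu]_y (EFin \o h) (s, y) =
   \int[mu]_(s in `[0%R, t]) (K * expR (- K * s) * time_int s f)%:E)%E.
  rewrite [RHS]integral_mkcond; apply: eq_integral => s _; rewrite patchE mem_itvcc.
  case: ifPn => s0t; last first.
    rewrite -[RHS](integral0 mu setT); apply: eq_integral => y _.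
    by rewrite /= hv (negbTE s0t).
  have /andP[s0 st] := s0t.
  have hfs : mu.-integrable `[0, s] (EFin \o f).
    apply: integrableS hf => //; exact: subset_itvl.
  rewrite EFinM /time_int /Rintegral fineK; last exact: integrable_fin_num.
  rewrite -integralZl// integral_mkcond; apply: eq_integral => y _.
  rewrite /= hv patchE mem_itvcc s0t/= andbC andbCA.
  rewrite (_ : (y <= s) && (y <= t) = (y <= s)); last first.
    by apply/andb_idr => ys; exact: le_trans st.
  by case: ifP.
have Rr : (\int[mu]_y \int[mu]_s (EFin \o h) (s, y) =
   \int[mu]_(y in `[0%R, t]) (f y * (expR (- K * y) - expR (- K * t)))%:E)%E.
  rewrite [RHS]integral_mkcond; apply: eq_integral => y _; rewrite patchE mem_itvcc.
  case: ifPn => y0t; last first.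
    rewrite -[RHS](integral0 mu setT); apply: eq_integral => s _.
    by rewrite /= hv (negbTE y0t) andbF.
  have /andP[y0 yt] := y0t.
  rewrite EFinM -exp_integral// -integralZl//; last first.
    apply: continuous_compact_integrable; first exact: segment_compact.
    apply: continuous_subspaceT => s; apply: cvgM; first exact: cvg_cst.
    exact: continuous_expRM.
  rewrite integral_mkcond; apply: eq_integral => s _.
  rewrite /= hv patchE mem_itvcc y0t/= andbC.
  rewrite (_ : (y <= s) && (0 <= s <= t) = (y <= s <= t)); last first.
    by have [ys|//] := leP y s; rewrite (le_trans y0 ys).
  by case: ifP => // _; rewrite -EFinM mulrC.
by rewrite L Rr /time_int /Rintegral => ->.
Qed.

(** As [y] and [b] are merely integrable, nothing is differentiated: the
    primitive [F] of [b + K y] dominates [y], and [exp_primitive] integrates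
    [expR (- K s) (b + K y - K F)], which is at most [expR (- K s) b]. *)
Lemma gronwall (T K y0 : R) (y b : R -> R) : 0 <= K ->
  mu.-integrable `[0, T] (EFin \o y) -> mu.-integrable `[0, T] (EFin \o b) ->
  (forall t, 0 <= t <= T -> y t <= y0 + time_int t (fun s => b s + K * y s)) ->
  forall t, 0 <= t <= T ->
    y t <= y0 * expR (K * t) + time_int t (fun s => b s * expR (K * (t - s))).
Proof.
move=> K0 hy hb yle t /andP[t0 tT].
have sub s : 0 <= s <= t -> `[0, s]%classic `<=` (`[0, T]%classic : set R).
  move=> /andP[s0 st]; apply: subset_itvl; rewrite bnd_simp; exact: le_trans tT.
have tt : 0 <= t <= t by rewrite t0 lexx.
have hyt : mu.-integrable `[0, t] (EFin \o y).
  by apply: integrableS hy => //; exact: sub.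
have hbt : mu.-integrable `[0, t] (EFin \o b).
  by apply: integrableS hb => //; exact: sub.
pose f s := b s + K * y s.
have mt : measurable (`[0, t]%classic : set TR) by exact: measurable_itv.
have hf : mu.-integrable `[0, t] (EFin \o f) by exact: (rintD mt hbt (rintZ mt K hyt)).
pose F s := y0 + time_int s f.
have bddM g (c : R -> R) : continuous c -> mu.-integrable `[0, t] (EFin \o g) ->
    mu.-integrable `[0, t] (fun s => (c s * g s)%:E).
  move=> cc hg.
  have [M [Mr MP]] : bounded_set (c @` `[0, t]).
    by apply/compact_bounded/continuous_compact; [exact: continuous_subspaceT|exact: segment_compact].
  apply: (rint_bounded mt (B := M + 1)) hg.
    by apply: (@measurable_funS _ _ _ _ setT) => //; exact: continuous_measurable_fun.
  by move=> z zt; apply: (MP (M + 1)); [rewrite ltrDl|exists z].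
have hPhi : mu.-integrable `[0, t] (fun s => (K * expR (- K * s) * time_int s f)%:E).
  apply: (bddM _ (fun s => K * expR (- K * s))).
    by move=> s; apply: cvgM; [exact: cvg_cst|exact: continuous_expRM].
  apply: continuous_compact_integrable; first exact: segment_compact.
  exact: parameterized_integral_continuous.
have hef := bddM f _ (@continuous_expRM (- K)) hf.
have heb := bddM b _ (@continuous_expRM (- K)) hbt.
have hKe : mu.-integrable `[0, t] (fun s => (K * expR (- K * s))%:E).
  apply: continuous_compact_integrable; first exact: segment_compact.
  apply: continuous_subspaceT => s; apply: cvgM; first exact: cvg_cst.
  exact: continuous_expRM.
have E1 : expR (- K * t) * time_int t f =
    time_int t (fun s => expR (- K * s) * f s - K * expR (- K * s) * time_int s f).
  rewrite [RHS]RintegralB// [X in _ = _ - X](exp_primitive K t0 hf).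
  rewrite (_ : time_int t (fun s => f s * (expR (- K * s) - expR (- K * t))) =
     time_int t (fun s => expR (- K * s) * f s) - expR (- K * t) * time_int t f).
    by rewrite /time_int; ring.
  rewrite -[in RHS]RintegralZl// -[RHS]RintegralB//; last exact: (rintZ mt _ hf).
  by apply: eq_Rintegral => s _; ring.
have E2 : y0 * expR (- K * t) = y0 - time_int t (fun s => y0 * (K * expR (- K * s))).
  rewrite /time_int RintegralZl// /Rintegral exp_integral//= mulr0 expR0; ring.
have main : expR (- K * t) * F t <= y0 + time_int t (fun s => expR (- K * s) * b s).
  rewrite /F mulrDr [_ * y0]mulrC E1 E2 -addrA lerD2l addrC -[X in X <= _]RintegralB//; first last.
  - exact: (rintZ mt _ hKe).
  - exact: (rintB mt hef hPhi).
  apply: le_Rintegral => //.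
    by apply: (rintB mt _ (rintZ mt _ hKe)); exact: (rintB mt hef hPhi).
  move=> s /=; rewrite in_itv/= => /andP[s0 st].
  have := expR_gt0 (- K * s).
  have : y s <= y0 + time_int s f by apply: yle; rewrite s0 (le_trans st).
  move: (time_int s f) => Phi; set e := expR _ => ys e0.
  have : 0 <= e * K * (y0 + Phi - y s).
    by rewrite mulr_ge0// ?subr_ge0// mulr_ge0// ltW.
  move=> H; rewrite -subr_ge0 [leRHS](_ : _ = e * K * (y0 + Phi - y s))//.
  by rewrite /f; ring.
have yF : y t <= F t by apply: yle; rewrite t0 tT.
apply: (le_trans yF).
have -> : F t = expR (K * t) * (expR (- K * t) * F t).
  by rewrite mulrA -expRD mulNr subrr expR0 mul1r.
apply: (le_trans (ler_wpM2l (expR_ge0 _) main)).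
rewrite mulrDr [_ * y0]mulrC lerD2l /time_int -RintegralZl//.
rewrite le_eqVlt; apply/orP; left; apply/eqP; apply: eq_Rintegral => s _.
by rewrite mulrA -expRD mulrC; congr (_ * expR _); ring.
Qed.
End Gronwall.

(** * The pressure potential *)

Section Pressure.
Context (R : realType).
Local Notation mu := (@lebesgue_measure R).

Lemma MVT_pos (f f' : R -> R) (x y : R) : (forall s : R, 0 < s -> is_derive s 1 f (f' s)) ->
  0 < x -> x <= y -> exists2 c, x <= c <= y & f y - f x = f' c * (y - x).
Proof.
move=> df x0 xy.
have d1 s : s \in `]x, y[ -> is_derive s 1 f (f' s).
  by rewrite in_itv/= => /andP[xs _]; apply: df; exact: lt_trans xs.
have c1 : {within `[x, y], continuous f}.
  apply: derivable_within_continuous => s; rewrite in_itv/= => /andP[xs _].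
  by case: (df s (lt_le_trans x0 xs)).
have [c cxy E] := MVT_segment xy d1 c1.
by exists c.
Qed.

Lemma ge0_derive_le (f f' : R -> R) (x y : R) : (forall s : R, 0 < s -> is_derive s 1 f (f' s)) ->
  0 < x -> x <= y -> (forall s, x <= s <= y -> 0 <= f' s) -> f x <= f y.
Proof.
move=> df x0 xy f0; have [c cxy E] := MVT_pos df x0 xy.
by rewrite -subr_ge0 E mulr_ge0 ?subr_ge0// f0.
Qed.

Lemma le0_derive_ge (f f' : R -> R) (x y : R) : (forall s : R, 0 < s -> is_derive s 1 f (f' s)) ->
  0 < x -> x <= y -> (forall s, x <= s <= y -> f' s <= 0) -> f y <= f x.
Proof.
move=> df x0 xy f0; have [c cxy E] := MVT_pos df x0 xy.
by rewrite -subr_le0 E mulr_le0_ge0 ?subr_ge0// f0.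
Qed.

Variable p : R -> R.
Hypothesis Hp : pressure_law p.
Local Notation p' := (derive1 p).

Lemma pressure_derive (s : R) : 0 < s -> is_derive s 1 p (p' s).
Proof. by move=> s0; rewrite derive1E; apply: derivableP; exact: pressure_D1. Qed.

Lemma pressure_derive2 (s : R) : 0 < s -> is_derive s 1 p' (derive1 p' s).
Proof. by move=> s0; rewrite derive1E; apply: derivableP; exact: pressure_D2. Qed.

Lemma derive_cont (f : R -> R) (s l : R) : is_derive s 1 f l -> {for s, continuous f}.
Proof.
by case=> df _; apply: differentiable_continuous; exact/derivable1_diffP.
Qed.

Lemma pressure_quot_cont s : 0 < s -> {for s, continuous (fun x => p x / x ^+ 2)}.
Proof.
move=> s0; apply: cvgM; first exact: derive_cont (pressure_derive s0).
apply: cvgV; first by rewrite expf_neq0// gt_eqF.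
exact: exprn_continuous.
Qed.

Lemma pressure_quot_integrable a b : 0 < a ->
  mu.-integrable `[a, b] (EFin \o (fun x => p x / x ^+ 2)).
Proof.
move=> a0; apply: continuous_compact_integrable; first exact: segment_compact.
apply: continuous_in_subspaceT => s; rewrite inE/= in_itv/= => /andP[xs _].
exact: pressure_quot_cont (lt_le_trans a0 xs).
Qed.

Definition pot_slope rhobar s := oriented_int rhobar s (fun x => p x / x ^+ 2).

(** Splitting at a base point [c] below both arguments turns the oriented
    integral into a primitive with fixed lower end. *)
Lemma pot_slopeE rhobar c s : 0 < c -> c <= rhobar -> c <= s ->
  pot_slope rhobar s = \int[mu]_(x in `[c, s]) (p x / x ^+ 2) -
                       \int[mu]_(x in `[c, rhobar]) (p x / x ^+ 2).
Proof.
move=> c0 cr cs; rewrite /pot_slope /oriented_int.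
have key a b : c <= a -> a <= b -> \int[mu]_(x in `[a, b]) (p x / x ^+ 2) =
   \int[mu]_(x in `[c, b]) (p x / x ^+ 2) - \int[mu]_(x in `[c, a]) (p x / x ^+ 2).
  move=> ca ab; rewrite Rintegral_itvB ?bnd_simp//; last exact: pressure_quot_integrable.
  rewrite Rintegral_itv_obnd_cbnd//.
  apply: integrableS (pressure_quot_integrable b (lt_le_trans c0 ca)) => //.
  exact: subset_itv_oc_cc.
case: ifPn => [rs|]; first exact: key.
by rewrite -ltNge => /ltW sr; rewrite (key s rhobar cs sr) opprB.
Qed.

Lemma pot_slope_derive rhobar (s : R) : 0 < rhobar -> 0 < s ->
  is_derive s 1 (pot_slope rhobar) (p s / s ^+ 2).
Proof.
move=> r0 s0; pose c := Num.min rhobar s / 2.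
have m0 : 0 < Num.min rhobar s by rewrite lt_min r0 s0.
have c0 : 0 < c by rewrite /c; lra.
have mr : Num.min rhobar s <= rhobar by rewrite ge_min lexx.
have ms : Num.min rhobar s <= s by rewrite ge_min lexx orbT.
have cr : c <= rhobar by rewrite /c; lra.
have cs : c < s by rewrite /c; lra.
have su : s < s + 1 by rewrite ltrDl.
have [dF DF] := continuous_FTC1_closed su (pressure_quot_integrable (s + 1) c0)
  cs (pressure_quot_cont s0).
have dF' : is_derive s 1 (fun x => \int[mu]_(x in `[c, x]) (p x / x ^+ 2)) (p s / s ^+ 2).
  by apply: DeriveDef; [exact: dF|rewrite -derive1E; exact: DF].
have := is_deriveB dF' (is_derive_cst (\int[mu]_(x in `[c, rhobar]) (p x / x ^+ 2)) s 1).
rewrite subr0; apply: near_eq_is_derive => //.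
near=> x; rewrite (pot_slopeE c0 cr)//.
by near: x; apply: filterS (lt_nbhsr cs) => x /ltW.
Unshelve. all: by end_near. Qed.

Lemma pot_derive rhobar (s : R) : 0 < rhobar -> 0 < s ->
  is_derive s 1 (pot p rhobar) (pot_slope rhobar s + p s / s).
Proof.
move=> r0 s0.
have := is_deriveM (is_derive_id s 1) (pot_slope_derive r0 s0).
move=> H; apply: is_derive_eq H _; rewrite /GRing.scale/= mulr1 addrC; congr (_ + _).
by field; rewrite gt_eqF.
Qed.

Lemma derive1_potE rhobar (s : R) : 0 < rhobar -> 0 < s ->
  derive1 (pot p rhobar) s = pot_slope rhobar s + p s / s.
Proof. by move=> r0 s0; rewrite derive1E; case: (pot_derive r0 s0). Qed.

Lemma derive1_pot_derive rhobar (s : R) : 0 < rhobar -> 0 < s ->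
  is_derive s 1 (derive1 (pot p rhobar)) (p' s / s).
Proof.
move=> r0 s0.
have s0' : s != 0 by rewrite gt_eqF.
have dV : is_derive s 1 (fun x : R => x^-1) (- s ^- 2).
  apply: DeriveDef; first by apply: derivableV.
  by rewrite deriveV// derive_id /GRing.scale/= mulr1.
have := is_deriveD (pot_slope_derive r0 s0) (is_deriveM (pressure_derive s0) dV).
move=> H; have {H} : is_derive s 1 (pot_slope rhobar \+ p \* (fun x => x^-1)) (p' s / s).
  apply: is_derive_eq H _; rewrite /GRing.scale/=; field.
  by rewrite gt_eqF.
apply: near_eq_is_derive => //; near=> x.
rewrite derive1_potE//.
by near: x; apply: filterS (lt_nbhsr s0).
Unshelve. all: by end_near. Qed.

Lemma rel_potE rhobar (s r : R) : 0 < rhobar -> 0 < r -> rel_pot p rhobar s r =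
  s * (pot_slope rhobar s - pot_slope rhobar r) - p r * (s - r) / r.
Proof.
move=> r0 s0; rewrite /rel_pot derive1_potE// /pot -!/(pot_slope _ _).
by field; rewrite gt_eqF.
Qed.

Lemma rel_pot0 rhobar r : 0 < rhobar -> 0 < r -> rel_pot p rhobar 0 r = p r.
Proof. by move=> r0 s0; rewrite rel_potE//; field; rewrite gt_eqF. Qed.

Lemma rel_pot_derive rhobar r (s : R) : 0 < rhobar -> 0 < s ->
  is_derive s 1 (fun s => rel_pot p rhobar s r)
    (derive1 (pot p rhobar) s - derive1 (pot p rhobar) r).
Proof.
move=> r0 s0; rewrite /rel_pot.
have dl : is_derive s 1 (fun x : R => derive1 (pot p rhobar) r * (x - r))
    (derive1 (pot p rhobar) r).
  have := is_deriveZ (derive1 (pot p rhobar) r)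
    (is_deriveB (is_derive_id s (1 : R)) (is_derive_cst r s (1 : R))).
  by move=> H; apply: is_derive_eq H _; rewrite /GRing.scale/=; ring.
have := is_deriveB (is_deriveB (pot_derive r0 s0) (is_derive_cst (pot p rhobar r) s (1 : R))) dl.
by move=> H; apply: is_derive_eq H _; rewrite subr0 -derive1_potE.
Qed.

Lemma pressure_gt0 x : 0 < x -> 0 < p x.
Proof.
move=> x0.
have d1 s : s \in `]0, x[ -> is_derive s 1 p (p' s).
  by rewrite in_itv/= => /andP[xs _]; exact: pressure_derive.
have c1 : {within `[0, x], continuous p}.
  apply: continuous_subspaceW (pressure_cont Hp); exact: subset_itvl.
have [c] := MVT x0 d1 c1.
rewrite in_itv/= => /andP[c0 _]; rewrite (pressure0 Hp) !subr0 => ->.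
by rewrite mulr_gt0//; exact: pressure_incr.
Qed.

Lemma pressure_le x y : 0 <= x -> x <= y -> p x <= p y.
Proof.
rewrite le_eqVlt => /predU1P[<-|x0 xy].
  rewrite (pressure0 Hp) le_eqVlt => /predU1P[<-|/pressure_gt0/ltW//].
  by rewrite (pressure0 Hp).
apply: (ge0_derive_le pressure_derive x0 xy) => s /andP[xs _].
by apply/ltW/(pressure_incr Hp); exact: lt_le_trans xs.
Qed.

Lemma compact_bound (f : R -> R) a b : a <= b -> {in `[a, b], continuous f} ->
  exists2 A, 0 <= A & forall x, a <= x <= b -> `|f x| <= A.
Proof.
move=> ab cf.
have [|c _ cm] := @EVT_max R (fun x => `|f x|) a b ab.
  apply: continuous_in_subspaceT => x; rewrite inE => xab.
  by apply: (@continuous_comp _ _ _ f (fun y : R => `|y|)); [exact: cf|exact: norm_continuous].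
by exists `|f c| => // x xab; apply: cm; rewrite in_itv.
Qed.

(** Near the range of [r] both increments are compared through the mean value
    theorem; far away the growth assumptions on the pressure take over. *)
Lemma pressure_slope_le (m M : R) : 0 < m -> m <= M -> exists P B : R,
  [/\ 0 <= P, 0 < B & forall rhobar r s, 0 < rhobar -> m <= r <= M -> m / 2 <= s ->
    `|p' s - p' r| <= P * `|derive1 (pot p rhobar) s - derive1 (pot p rhobar) r| /\
    (s <= r -> B * (r - s) <= derive1 (pot p rhobar) r - derive1 (pot p rhobar) s)].
Proof.
move=> m0 mM.
have [a [b [gamma [a0 b0 g1 growth]]]] := pressure_growth Hp.
(* beyond [N] the constant [b] is at most half of [a s `^ e], so [p'] is
   comparable with [s `^ e] *)
pose e := gamma - 1; have e0 : 0 < e by rewrite subr_gt0.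
pose N := Num.max M ((2 * b / a) `^ e^-1).
have MN : M <= N by rewrite le_max lexx.
have N0 : 0 < N by rewrite (lt_le_trans m0)// (le_trans mM).
have Ne : 2 * b / a <= N `^ e.
  have -> : 2 * b / a = ((2 * b / a) `^ e^-1) `^ e.
    by rewrite -powRrM mulVf ?gt_eqF// powRr1// ltW// divr_gt0// mulr_gt0.
  apply: ge0_ler_powR; rewrite ?nnegrE ?powR_ge0 ?(ltW e0) ?(ltW N0)//.
  by rewrite /N le_max lexx orbT.
have m2 : 0 < m / 2 by rewrite divr_gt0.
have mN : m / 2 <= 2 * N by lra.
have pos s : m / 2 <= s -> 0 < s by apply: lt_le_trans.
have [A A0 HA] : exists2 A, 0 <= A & forall x, m / 2 <= x <= 2 * N -> `|derive1 p' x| <= A.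
  apply: compact_bound mN _ => x; rewrite in_itv/= => /andP[/pos x0 _].
  exact: pressure_C2 x0.
have [c cI cm] : exists2 c, c \in `[m / 2, 2 * N] & forall t, t \in `[m / 2, 2 * N] ->
    p' c / c <= p' t / t.
  apply: EVT_min mN _; apply: continuous_in_subspaceT => x.
  rewrite inE/= in_itv/= => /andP[/pos x0 _].
  apply: cvgM; first exact: derive_cont (pressure_derive2 x0).
  by apply: cvgV; [rewrite gt_eqF|exact: cvg_id].
pose B := p' c / c.
have B0 : 0 < B.
  by move: cI; rewrite in_itv/= => /andP[/pos c0 _]; rewrite divr_gt0// pressure_incr.
have Bm t : m / 2 <= t <= 2 * N -> B <= p' t / t by move=> tI; apply: cm; rewrite in_itv.
pose C2 := (2 / a + a) * (2 `^ e * 4 / a).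
have C20 : 0 <= C2.
  by rewrite mulr_ge0// ?addr_ge0// ?divr_ge0// ?mulr_ge0 ?powR_ge0// ltW.
exists (A / B + C2), B; split=> //.
  by rewrite addr_ge0// divr_ge0// ltW.
move=> rhobar r s rb0 /andP[mr rM] ms.
set h := derive1 (pot p rhobar).
have hder (x : R) : 0 < x -> is_derive x 1 h (p' x / x) by exact: derive1_pot_derive.
clearbody h.
have near x y : m / 2 <= x -> x <= y -> y <= 2 * N ->
    `|p' y - p' x| <= A * (y - x) /\ B * (y - x) <= h y - h x.
  move=> mx xy yN; have x0 := pos _ mx; split.
    have [z /andP[xz zy] ->] := MVT_pos pressure_derive2 x0 xy.
    rewrite normrM [X in _ * X]ger0_norm ?subr_ge0// ler_wpM2r ?subr_ge0// HA//.
    by rewrite (le_trans mx)// (le_trans zy).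
  have [z /andP[xz zy] ->] := MVT_pos hder x0 xy.
  by rewrite ler_wpM2r ?subr_ge0// Bm// (le_trans mx)// (le_trans zy).
have [r0 mr2] : 0 < r /\ m / 2 <= r by lra.
have rN : r <= 2 * N by lra.
have conv x y D : 0 <= D -> `|p' y - p' x| <= A * (y - x) -> B * (y - x) <= D ->
    `|p' y - p' x| <= (A / B + C2) * D.
  move=> D0 H1 H2; rewrite mulrDl (le_trans H1)//.
  apply: ler_wpDr; first exact: mulr_ge0.
  rewrite -[leRHS]mulrA ler_wpM2l// [B^-1 * _]mulrC ler_pdivlMr// mulrC.
  exact: H2.
have [sr|rs] := leP s r.
  have [H1 H2] := near s r ms sr rN.
  split=> // ; rewrite distrC [X in _ <= _ * X]distrC.
  have D0 : 0 <= h r - h s by rewrite (le_trans _ H2)// mulr_ge0 ?subr_ge0// ltW.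
  by rewrite [X in _ <= _ * X]ger0_norm//; exact: conv.
split; last by [].
have [sN|Ns] := leP s (2 * N).
  have [H1 H2] := near r s mr2 (ltW rs) sN.
  have D0 : 0 <= h s - h r by rewrite (le_trans _ H2)// mulr_ge0 ?subr_ge0// ltW.
  by rewrite [X in _ <= _ * X]ger0_norm//; exact: conv.
have s0 := pos _ ms.
have hmono x y : 0 < x -> x <= y -> h x <= h y.
  move=> x0 xy; apply: (ge0_derive_le hder x0 xy) => z /andP[xz _].
  have z0 := lt_le_trans x0 xz.
  by rewrite divr_ge0// ltW// pressure_incr.
have s20 : 0 < s / 2 by rewrite divr_gt0.
have s2s : s / 2 <= s by lra.
have [z /andP[sz zs] hz] := MVT_pos hder s20 s2s.
have z0 := lt_le_trans s20 sz.
have Nz : N <= z by apply: (le_trans _ sz); rewrite ler_pdivlMr// mulrC ltW.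
have Nse : N `^ e <= s `^ e.
  by apply: ge0_ler_powR; rewrite ?nnegrE ?(ltW e0) ?(ltW N0) ?(ltW s0)// (le_trans Nz).
have Nze : N `^ e <= z `^ e.
  by apply: ge0_ler_powR; rewrite ?nnegrE ?(ltW e0) ?(ltW N0) ?(ltW z0).
have sze : s `^ e <= 2 `^ e * z `^ e.
  rewrite -powRM ?(ltW z0)//.
  by apply: ge0_ler_powR; rewrite ?nnegrE ?(ltW e0) ?(ltW s0)//; [rewrite mulr_ge0// ltW|rewrite -ler_pdivrMl// mulrC].
have rse : r `^ e <= s `^ e.
  by apply: ge0_ler_powR; rewrite ?nnegrE ?(ltW e0) ?(ltW r0) ?(ltW s0) ?(ltW rs).
have [gs1 gs2] := growth s s0; have [gr1 gr2] := growth r r0; have [gz1 gz2] := growth z z0.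
rewrite -/e in gs1 gs2 gr1 gr2 gz1 gz2.
have b2 : 2 * b <= a * N `^ e by rewrite -ler_pdivrMl// mulrC.
have low : a / 2 * z `^ e <= p' z.
  apply: (le_trans _ gz1).
  have : a * N `^ e <= a * z `^ e by rewrite ler_wpM2l// ltW.
  by lra.
(* half of the interval below [s] lies beyond [N], and there [h' = p' / s] is of
   order [s `^ e / s] *)
have hlow : (2 `^ e * 4 / a)^-1 * s `^ e <= h s - h r.
  have p2 : 0 < 2 `^ e :> R by rewrite powR_gt0.
  have H1 : h r <= h (s / 2) by apply: hmono => //; lra.
  have H2 : a / 4 * z `^ e <= h s - h (s / 2).
    rewrite hz; have -> : s - s / 2 = s / 2 by field.
    have -> : p' z / z * (s / 2) = p' z * (s / 2 / z) by field; rewrite gt_eqF.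
    have H3 : 2^-1 <= s / 2 / z by rewrite ler_pdivlMr//; lra.
    have : p' z * 2^-1 <= p' z * (s / 2 / z).
      by rewrite ler_wpM2l// ltW// pressure_incr.
    by lra.
  have H3 : (2 `^ e * 4 / a)^-1 * s `^ e <= a / 4 * z `^ e.
    rewrite ler_pdivrMl; last by rewrite divr_gt0// mulr_gt0.
    have -> : 2 `^ e * 4 / a * (a / 4 * z `^ e) = 2 `^ e * z `^ e by field; rewrite gt_eqF.
    exact: sze.
  by lra.
have D0 : 0 <= h s - h r.
  by rewrite subr_ge0; apply: hmono => //; exact: ltW.
rewrite [X in _ <= _ * X]ger0_norm//.
have up : `|p' s - p' r| <= (2 / a + a) * s `^ e.
  have ps := pressure_incr Hp s0; have pr := pressure_incr Hp r0.
  have : a^-1 * r `^ e <= a^-1 * s `^ e by rewrite ler_wpM2l// invr_ge0 ltW.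
  have : a * N `^ e <= a * s `^ e by rewrite ler_wpM2l// ltW.
  by rewrite ler_norml; lra.
apply: (le_trans up); rewrite [leRHS]mulrDl; apply: ler_wpDl.
  by rewrite mulr_ge0// divr_ge0// ltW.
rewrite /C2 -[leRHS]mulrA; apply: ler_wpM2l.
  by rewrite addr_ge0// ?divr_ge0// ltW.
rewrite -ler_pdivrMl//.
by rewrite divr_gt0// mulr_gt0// powR_gt0.
Qed.

(** With [g] the relative potential and [k] the pressure increment, [P1 g + k] and
    [P1 g - k] vanish at [r]; by [pressure_slope_le] they decrease before [r] and
    increase after it, as long as [s >= m / 2]. Closer to vacuum [k] is bounded,
    while [g] stays above the positive constant [c2]. The reference state drops
    out because [g] involves only differences of [H']. *)
Lemma rel_pressure_le (m M : R) : 0 < m -> m <= M -> exists2 P : R, 0 <= P &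
  forall rhobar r s, 0 < rhobar -> m <= r <= M -> 0 <= s ->
    0 <= rel_pot p rhobar s r /\
    `|p s - p r - p' r * (s - r)| <= P * rel_pot p rhobar s r.
Proof.
move=> m0 mM; have [P1 [B [P10 B0 HP]]] := pressure_slope_le m0 mM.
have [A A0 HA] : exists2 A, 0 <= A & forall x, m <= x <= M -> `|p' x| <= A.
  apply: compact_bound mM _ => x; rewrite in_itv/= => /andP[mx _].
  exact: derive_cont (pressure_derive2 (lt_le_trans m0 mx)).
pose c2 := Num.min (B * m ^+ 2 / 8) (p m).
have c20 : 0 < c2 by rewrite lt_min pressure_gt0// divr_gt0// mulr_gt0// exprn_gt0.
pose A2 := 2 * p M + A * M.
have pM : 0 <= p M by apply/ltW/pressure_gt0; lra.
have A20 : 0 <= A2 by rewrite addr_ge0 ?mulr_ge0//; lra.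
exists (P1 + A2 / c2); first by rewrite addr_ge0// divr_ge0// ltW.
move=> rhobar r s rb0 /andP[mr rM] s0.
have r0 : 0 < r by lra.
pose g x := rel_pot p rhobar x r.
pose k x := p x - p r - p' r * (x - r).
set h := derive1 (pot p rhobar).
have gr : g r = 0 by rewrite /g /rel_pot !subrr mulr0 subr0.
have kr : k r = 0 by rewrite /k !subrr mulr0 subr0.
have gder (x : R) : 0 < x -> is_derive x 1 g (h x - h r) by move=> x0; exact: rel_pot_derive.
have kder (x : R) : 0 < x -> is_derive x 1 k (p' x - p' r).
  move=> x0.
  have dl : is_derive x 1 (fun x : R => p' r * (x - r)) (p' r).
    have H := is_deriveZ (p' r)
      (is_deriveB (is_derive_id x (1 : R)) (is_derive_cst r x (1 : R))).
    by apply: is_derive_eq H _; rewrite /GRing.scale/=; ring.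
  have H := is_deriveB (is_deriveB (pressure_derive x0) (is_derive_cst (p r) x (1 : R))) dl.
  by apply: is_derive_eq H _; rewrite subr0.
have hmono x y : 0 < x -> x <= y -> h x <= h y.
  move=> x0 xy; apply: (ge0_derive_le (fun z z0 => derive1_pot_derive rb0 z0) x0 xy) => z /andP[xz _].
  have z0 := lt_le_trans x0 xz.
  by rewrite divr_ge0// ltW// pressure_incr.
have comb (sg x : R) : 0 < x ->
    is_derive x 1 (fun x => P1 * g x + sg * k x) (P1 * (h x - h r) + sg * (p' x - p' r)).
  by move=> x0; exact: (is_deriveD (is_deriveZ P1 (gder x x0)) (is_deriveZ sg (kder x x0))).
have mrM : m <= r <= M by rewrite mr rM.
have HPr y : m / 2 <= y -> `|p' y - p' r| <= P1 * `|h y - h r| /\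
    (y <= r -> B * (r - y) <= h r - h y) by exact: HP.
clear HP; clearbody h.
have near x : m / 2 <= x -> 0 <= g x /\ `|k x| <= P1 * g x.
  move=> mx; have x0 : 0 < x by lra.
  suff H sg : sg = 1 \/ sg = -1 -> 0 <= g x /\ 0 <= P1 * g x + sg * k x.
    have [? H1] := H 1 (or_introl erefl); have [_ H2] := H (-1) (or_intror erefl).
    by split=> //; rewrite ler_norml; lra.
  move=> sgE.
  have sgb y : m / 2 <= y -> sg * (p' y - p' r) <= P1 * `|h y - h r| /\
      - (P1 * `|h y - h r|) <= sg * (p' y - p' r).
    move=> my; have [+ _] := HPr y my; rewrite ler_norml => /andP[].
    by case: sgE => -> H1 H2; split; rewrite ?mulN1r ?mul1r// ?lerN2// lerNl.
  have [xr|/ltW rx] := leP x r; split.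
  - rewrite -[leLHS]gr; apply: (le0_derive_ge gder x0 xr) => y /andP[xy yr].
    by rewrite subr_le0 hmono//; lra.
  - have E : P1 * g r + sg * k r = 0 by rewrite gr kr !mulr0 addr0.
    rewrite -[leLHS]E; apply: (le0_derive_ge (comb sg) x0 xr) => y /andP[xy yr].
    have [|H _] := sgb y; first by lra.
    have hyr : h y <= h r by apply: hmono => //; lra.
    rewrite ler0_norm ?subr_le0// mulrN in H.
    by rewrite addrC -[P1 * _]opprK subr_le0.
  - rewrite -[leLHS]gr; apply: (ge0_derive_le gder r0 rx) => y /andP[ry yx].
    by rewrite subr_ge0 hmono//; lra.
  - have E : P1 * g r + sg * k r = 0 by rewrite gr kr !mulr0 addr0.
    rewrite -[leLHS]E; apply: (ge0_derive_le (comb sg) r0 rx) => y /andP[ry yx].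
    have [|_ H] := sgb y; first by lra.
    have hyr : h r <= h y by exact: hmono.
    rewrite ger0_norm ?subr_ge0// in H.
    by rewrite addrC -[P1 * _]opprK subr_ge0.
have [ms|sm] := leP (m / 2) s.
  have [g0 kg] := near s ms; split=> //; apply: (le_trans kg).
  by rewrite mulrDl lerDl mulr_ge0// divr_ge0// ltW.
have kA : `|k s| <= A2.
  have pr0 : 0 < p' r by exact: pressure_incr.
  have Hr : p' r <= A by have := HA r mrM; rewrite ler_norml; lra.
  have p1 : 0 <= p s by rewrite -(pressure0 Hp) pressure_le.
  have p2 : p s <= p M by apply: pressure_le => //; lra.
  have p3 : p r <= p M by apply: pressure_le; lra.
  have p4 : 0 < p r by exact: pressure_gt0.
  have : p' r * (r - s) <= A * M by apply: ler_pM; lra.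
  have : 0 <= p' r * (r - s) by rewrite mulr_ge0//; lra.
  by rewrite ler_norml /A2 /k; lra.
have gc : c2 <= g s.
  move: s0; rewrite le_eqVlt => /predU1P[<-|s0].
    rewrite /g rel_pot0// ge_min; apply/orP; right.
    by apply: pressure_le; lra.
  have m20 : 0 < m / 2 by lra.
  rewrite ge_min; apply/orP; left.
  have sr : s <= m / 2 by lra.
  have H1 : g (m / 2) <= g s.
    apply: (le0_derive_ge gder s0 sr) => y /andP[sy ym].
    by rewrite subr_le0 hmono//; lra.
  (* [B] bounds the slope of [h] from below, so [g] dominates a parabola at [r] *)
  have qder (x : R) : 0 < x -> is_derive x 1 (fun x => g x - B * (x - r) ^+ 2 / 2)
      (h x - h r - B * (x - r)).
    move=> x0.
    have dd := is_deriveB (is_derive_id x (1 : R)) (is_derive_cst r x (1 : R)).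
    have H := is_deriveB (gder x x0) (is_deriveZ (B / 2) (is_deriveM dd dd)).
    have {}H : is_derive x 1 (fun x => g x - (B / 2) *: ((x - r) * (x - r)))
      (h x - h r - B * (x - r)).
      by apply: is_derive_eq H _; rewrite /GRing.scale/= !fctE/=; field.
    rewrite (_ : (fun x => g x - B * (x - r) ^+ 2 / 2) =
      (fun x => g x - (B / 2) *: ((x - r) * (x - r))))//.
    by apply/funext => y; rewrite expr2 /GRing.scale/=; ring.
  have mr2 : m / 2 <= r by lra.
  have := le0_derive_ge qder m20 mr2.
  rewrite gr subrr expr0n/= mulr0 mul0r subrr => H.
  have {}H : 0 <= g (m / 2) - B * (m / 2 - r) ^+ 2 / 2.
    apply: H => y /andP[my yr].
    have [_ /(_ yr)] := HPr y my.
    by rewrite -(opprB r y) mulrN opprK -subr_ge0 => H; rewrite -oppr_ge0; apply: (le_trans H); rewrite le_eqVlt; apply/orP; left; apply/eqP; ring.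
  apply: (le_trans _ H1).
  have : B * (m ^+ 2 / 4) <= B * (m / 2 - r) ^+ 2.
    rewrite ler_wpM2l// ?(ltW B0)//.
    have -> : m ^+ 2 / 4 = (m / 2) ^+ 2 by field.
    by rewrite -sqrrN; nra.
  lra.
split; first by rewrite (le_trans _ gc)// ltW.
apply: (le_trans kA).
rewrite mulrDl ler_wpDl//; first by rewrite mulr_ge0// (le_trans _ gc)// ltW.
by rewrite -mulrA ler_peMr// ler_pdivlMl// mulr1.
Qed.
End Pressure.

(** The derivative of [H'] is [p' / s]; the mass equation is tested with [H'(r)]
    through polynomials, which takes a Lipschitz bound of this derivative. *)
Lemma pressure_quot_lipschitz (R : realType) (p : R -> R) (m M : R) :
  pressure_law p -> 0 < m -> m <= M -> exists2 L : R, 0 <= L &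
  forall x y, m <= x <= M -> m <= y <= M ->
    `|derive1 p x / x - derive1 p y / y| <= L * `|x - y|.
Proof.
move=> Hp m0 mM.
have [x mxM|A A0 hA] := compact_bound (f := derive1 (derive1 p)) mM.
  apply: (pressure_C2 Hp); apply: lt_le_trans m0 _.
  by move: mxM; rewrite inE/= => /andP[].
have [x mxM|B B0 hB] := compact_bound (f := derive1 p) mM.
  apply: (derive_cont (pressure_derive2 Hp _)); apply: lt_le_trans m0 _.
  by move: mxM; rewrite inE/= => /andP[].
exists (A / m + B / m ^+ 2).
  by rewrite addr_ge0// divr_ge0// ?exprn_ge0// ltW.
have lipA x y : m <= x <= M -> m <= y <= M -> `|derive1 p x - derive1 p y| <= A * `|x - y|.
  wlog xy : x y / x <= y.
    move=> H hx hy; case: (leP x y) => [xy|/ltW yx]; first exact: H.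
    by rewrite distrC [`|x - y|]distrC H.
  move=> /andP[mx xM] /andP[my yM].
  have [c /andP[xc cy] E] := MVT_pos (fun s s0 => pressure_derive2 Hp s0) (lt_le_trans m0 mx) xy.
  rewrite distrC E normrM [`|x - y|]distrC ler_wpM2r// hA//.
  by rewrite (le_trans mx xc) (le_trans cy yM).
move=> x y hx hy; have /andP[mx _] := hx; have /andP[my _] := hy.
have x0 := lt_le_trans m0 mx; have y0 := lt_le_trans m0 my.
have -> : derive1 p x / x - derive1 p y / y =
    (derive1 p x - derive1 p y) / x - derive1 p y * ((x - y) / (x * y)).
  by field; rewrite !gt_eqF.
apply: le_trans (ler_normB _ _) _; rewrite [leRHS]mulrDl; apply: lerD.
  rewrite normrM normfV (gtr0_norm x0) [leRHS]mulrAC; apply: ler_pM => //.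
  - by rewrite invr_ge0 ltW.
  - exact: lipA.
  - by rewrite lef_pV2 ?posrE.
rewrite !normrM normfV normrM (gtr0_norm x0) (gtr0_norm y0) -mulrA.
apply: ler_pM => //; first by rewrite mulr_ge0// invr_ge0 mulr_ge0 ?ltW.
  exact: hB.
rewrite mulrC; apply: ler_wpM2r => //.
rewrite lef_pV2 ?posrE ?mulr_gt0// expr2.
by apply: ler_pM => //; exact: ltW.
Qed.

(** * Polynomial approximation in C^1 *)

Section Bernstein.
Context (R : realType).

(** The Bernstein polynomial with nodal values [g 0, ..., g n], by the Pascal
    recursion that expresses it as an expectation over [n] coin tosses. *)
Fixpoint bernstein (n : nat) (g : nat -> R) : {poly R} :=
  if n is k.+1 then
    (1 - 'X) * bernstein k g + 'X * bernstein k (fun i => g i.+1)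
  else (g 0)%:P.

Lemma bernsteinS n g x : (bernstein n.+1 g).[x] =
  (1 - x) * (bernstein n g).[x] + x * (bernstein n (fun i => g i.+1)).[x].
Proof. by rewrite /= hornerD !hornerM hornerD hornerN hornerC hornerX. Qed.

Lemma bernstein_le n (g1 g2 : nat -> R) x : 0 <= x <= 1 ->
  (forall k, (k <= n)%N -> g1 k <= g2 k) ->
  (bernstein n g1).[x] <= (bernstein n g2).[x].
Proof.
move=> x01; elim: n g1 g2 => [|n IH] g1 g2 g12; first by rewrite /= !hornerC g12.
rewrite !bernsteinS lerD// ler_wpM2l ?subr_ge0//; try by case/andP: x01.
  by apply: IH => k kn; apply: g12; exact: leqW.
by apply: IH => k kn; exact: g12.
Qed.

Lemma bernstein_lin n (g1 g2 : nat -> R) c x :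
  (bernstein n (fun k => c * g1 k + g2 k)).[x] =
  c * (bernstein n g1).[x] + (bernstein n g2).[x].
Proof.
elim: n g1 g2 => [|n IH] g1 g2; first by rewrite /= !hornerC.
by rewrite !bernsteinS IH (IH (fun i => g1 i.+1) (fun i => g2 i.+1)); ring.
Qed.

Lemma bernstein_cst n (c : R) x : (bernstein n (fun=> c)).[x] = c.
Proof.
elim: n => [|n IH]; first by rewrite /= hornerC.
by rewrite bernsteinS IH; ring.
Qed.

(** The second moment of the binomial law about [c]. *)
Lemma bernstein_variance n c x : (bernstein n (fun k => (k%:R - c) ^+ 2)).[x] =
  n%:R * x * (1 - x) + (n%:R * x - c) ^+ 2.
Proof.
elim: n c => [|n IH] c; first by rewrite /= hornerC; ring.
rewrite bernsteinS IH.
rewrite (_ : (fun i => (i.+1%:R - c) ^+ 2) = (fun i => (i%:R - (c - 1)) ^+ 2)).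
  by rewrite IH -natr1; ring.
by apply/funext => i; rewrite -natr1; ring.
Qed.

(** Bernstein's argument. The bound [L |z|] of the error at distance [z] is
    replaced by [L (z^2 / eta + eta)], whose mean is computed from the variance
    [x (1 - x) / n] of the sample mean. *)
Lemma lipschitz_poly_approx01 (h : R -> R) L e : 0 < e -> 0 <= L ->
  (forall x y, 0 <= x <= 1 -> 0 <= y <= 1 -> `|h x - h y| <= L * `|x - y|) ->
  exists q : {poly R}, forall x, 0 <= x <= 1 -> `|h x - q.[x]| <= e.
Proof.
move=> e0 L0 hL.
pose eta := e / (2 * (L + 1)).
have L1 : 0 < 2 * (L + 1) by lra.
have eta0 : 0 < eta by rewrite divr_gt0.
pose n := (Num.truncn (eta ^- 2)).+1.
have n0 : 0 < n%:R :> R by rewrite ltr0n.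
have nn : eta ^- 2 <= n%:R by rewrite ltW// truncnS_gt.
exists (bernstein n (fun k => h (k%:R / n%:R))) => x x01.
have main (sg : R) : `|sg| = 1 ->
    sg * (h x - (bernstein n (fun k => h (k%:R / n%:R))).[x]) <= e.
  move=> sg1.
  have -> : sg * (h x - (bernstein n (fun k => h (k%:R / n%:R))).[x]) =
      (bernstein n (fun k => (- sg) * h (k%:R / n%:R) + sg * h x)).[x].
    by rewrite bernstein_lin bernstein_cst; ring.
  apply: (@le_trans _ _ (bernstein n (fun k =>
      (L / (eta * n%:R ^+ 2)) * (k%:R - n%:R * x) ^+ 2 + L * eta)).[x]).
    apply: bernstein_le => // k kn.
    have kn01 : 0 <= (k%:R / n%:R : R) <= 1.
      by rewrite divr_ge0//= ler_pdivrMr// mul1r ler_nat.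
    have -> : - sg * h (k%:R / n%:R) + sg * h x = sg * (h x - h (k%:R / n%:R)) by ring.
    apply: (le_trans (ler_norm _)); rewrite normrM sg1 mul1r.
    apply: (le_trans (hL _ _ x01 kn01)).
    set z := x - _.
    have -> : L / (eta * n%:R ^+ 2) * (k%:R - n%:R * x) ^+ 2 + L * eta =
        L * (z ^+ 2 / eta + eta).
      by rewrite /z; field; rewrite !gt_eqF.
    rewrite ler_wpM2l//.
    have -> : z ^+ 2 / eta + eta = (`|z| ^+ 2 + eta ^+ 2) / eta.
      by rewrite real_normK ?num_real//; field; rewrite gt_eqF.
    rewrite ler_pdivlMr//; have := normr_ge0 z; nra.
  rewrite bernstein_lin bernstein_cst bernstein_variance subrr expr0n addr0.
  have -> : L / (eta * n%:R ^+ 2) * (n%:R * x * (1 - x)) = L * (x * (1 - x) * (n%:R^-1 / eta)).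
    by field; rewrite !gt_eqF.
  have n1 : n%:R^-1 / eta <= eta.
    by rewrite ler_pdivrMr// -expr2 -[leRHS]invrK lef_pV2// posrE invr_gt0 exprn_gt0.
  have n2 : 0 <= n%:R^-1 / eta by rewrite divr_ge0// ?invr_ge0// ltW.
  have x1 : x * (1 - x) * (n%:R^-1 / eta) <= eta.
    by rewrite (le_trans _ n1)// ler_piMl//; move: x01 => /andP[]; nra.
  have : L * (x * (1 - x) * (n%:R^-1 / eta)) <= L * eta by rewrite ler_wpM2l.
  have -> : e = 2 * (L * eta) + 2 * eta by rewrite /eta; field; rewrite gt_eqF//; lra.
  lra.
have := main 1 (normr1 _); have := main (-1) (normrN1 _).
by rewrite ler_norml mulN1r mul1r; lra.
Qed.

Lemma lipschitz_poly_approx (h : R -> R) a b L e : a < b -> 0 < e -> 0 <= L ->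
  (forall x y, a <= x <= b -> a <= y <= b -> `|h x - h y| <= L * `|x - y|) ->
  exists q : {poly R}, forall x, a <= x <= b -> `|h x - q.[x]| <= e.
Proof.
move=> ab e0 L0 hL.
have ba0 : 0 < b - a by rewrite subr_gt0.
have [||q qP] := @lipschitz_poly_approx01 (fun t => h (a + t * (b - a))) (L * (b - a)) e e0.
- by rewrite mulr_ge0// ltW.
- move=> x y x01 y01; apply: (le_trans (hL _ _ _ _)); [nra|nra|].
  have -> : a + x * (b - a) - (a + y * (b - a)) = (x - y) * (b - a) by ring.
  by rewrite normrM (gtr0_norm ba0) mulrA mulrAC.
exists (q \Po ((b - a)^-1 *: ('X - a%:P))) => x xab.
rewrite horner_comp hornerZ hornerXsubC.
have := qP ((b - a)^-1 * (x - a)).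
rewrite (_ : a + (b - a)^-1 * (x - a) * (b - a) = x); last by field; rewrite gt_eqF.
move: xab => /andP[ax xb]; apply.
by rewrite mulrC divr_ge0 ?subr_ge0 ?(ltW ab)//= ler_pdivrMr// mul1r lerD2r.
Qed.

Lemma poly_primitive (q : {poly R}) : exists Q : {poly R}, Q^`() = q.
Proof.
exists (\sum_(i < size q) (q`_i / i.+1%:R) *: 'X^(i.+1)).
rewrite raddf_sum -[RHS]coefK poly_def; apply: eq_bigr => i _.
by rewrite /= derivZ derivXn/= -scalerMnr scalerMnl -[X in X *: _]mulr_natr divfK// pnatr_eq0.
Qed.

(** A primitive of a polynomial close to [f'], with the value of [f] at [a]. *)
Lemma C1_poly_approx (f f' : R -> R) a b L e : 0 < a -> a < b -> 0 < e -> 0 <= L ->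
  (forall s : R, 0 < s -> is_derive s 1 f (f' s)) ->
  (forall x y, a <= x <= b -> a <= y <= b -> `|f' x - f' y| <= L * `|x - y|) ->
  exists Q : {poly R}, forall x, a <= x <= b ->
    `|f x - Q.[x]| <= e /\ `|f' x - Q^`().[x]| <= e.
Proof.
move=> a0 ab e0 L0 df hL.
have ba1 : 0 < b - a + 1 by lra.
pose e1 := e / (b - a + 1).
have e10 : 0 < e1 by rewrite divr_gt0.
have e1e : e1 * (b - a) + e1 = e by rewrite /e1; field; rewrite gt_eqF.
have e1ab : 0 <= e1 * (b - a) by rewrite mulr_ge0 ?ltW// subr_gt0.
have [q qP] := lipschitz_poly_approx ab e10 L0 hL.
have [Q0 Q0q] := poly_primitive q.
exists (Q0 + (f a - Q0.[a])%:P) => x xab; rewrite derivD derivC addr0 Q0q.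
have qx := qP x xab; split; last by apply: (le_trans qx); lra.
have dd (s : R) : 0 < s -> is_derive s 1 (fun s => f s - Q0.[s]) (f' s - q.[s]).
  move=> s0; rewrite -Q0q; exact: is_deriveB (df s s0) (is_derive_poly Q0 s).
have /andP[ax xb] := xab.
have [c /andP[ac cx]] := MVT_pos dd a0 ax.
rewrite hornerD hornerC => E.
have -> : f x - (Q0.[x] + (f a - Q0.[a])) = (f' c - q.[c]) * (x - a) by rewrite -E; ring.
rewrite normrM [X in _ * X]ger0_norm ?subr_ge0//.
have : `|f' c - q.[c]| <= e1 by apply: qP; rewrite ac (le_trans cx).
move=> H; apply: (@le_trans _ _ (e1 * (b - a))); last lra.
by rewrite ler_pM ?subr_ge0// lerD2r.
Qed.

Lemma Ck_horner (V : normedModType R) k (Q : {poly R}) (f : V -> R) :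
  Ck k f -> Ck k (fun x => Q.[f x]).
Proof.
move=> cf; elim/poly_ind: Q => [|Q c IH].
  by under eq_fun do rewrite horner0; exact: Ck_cst.
under eq_fun do rewrite hornerMXaddC.
by apply: Ck_add; [exact: Ck_mul|exact: Ck_cst].
Qed.

Lemma st_smooth_horner d (Q : {poly R}) (f : R -> 'rV[R]_d -> R) :
  st_smooth f -> st_smooth (fun t x => Q.[f t x]).
Proof.
move=> [pf sf]; split=> [t x j|k]; first by rewrite pf.
by apply: Ck_horner; exact: sf.
Qed.
End Bernstein.

(** * Algebra of the densities *)

Section Algebra.
Context (R : realType).

Lemma fdot_row d (a b : 'rV[R]_d) : fdot a b = \sum_j a 0 j * b 0 j.
Proof. by rewrite /fdot big_ord1. Qed.

Lemma fdotC m n (A B : 'M[R]_(m, n)) : fdot A B = fdot B A.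
Proof. by apply: eq_bigr => i _; apply: eq_bigr => j _; rewrite mulrC. Qed.

Lemma fdotDl m n (A B C : 'M[R]_(m, n)) : fdot (A + B) C = fdot A C + fdot B C.
Proof.
rewrite -big_split; apply: eq_bigr => i _; rewrite -big_split.
by apply: eq_bigr => j _; rewrite mxE mulrDl.
Qed.

Lemma fdotZl m n c (A B : 'M[R]_(m, n)) : fdot (c *: A) B = c * fdot A B.
Proof.
rewrite mulr_sumr; apply: eq_bigr => i _; rewrite mulr_sumr.
by apply: eq_bigr => j _; rewrite mxE mulrA.
Qed.

Lemma fdotNl m n (A B : 'M[R]_(m, n)) : fdot (- A) B = - fdot A B.
Proof. by rewrite -scaleN1r fdotZl mulN1r. Qed.

Lemma fdotBl m n (A B C : 'M[R]_(m, n)) : fdot (A - B) C = fdot A C - fdot B C.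
Proof. by rewrite fdotDl fdotNl. Qed.

Lemma fdotDr m n (A B C : 'M[R]_(m, n)) : fdot A (B + C) = fdot A B + fdot A C.
Proof. by rewrite ![fdot A _]fdotC fdotDl. Qed.

Lemma fdotBr m n (A B C : 'M[R]_(m, n)) : fdot A (B - C) = fdot A B - fdot A C.
Proof. by rewrite ![fdot A _]fdotC fdotBl. Qed.

Lemma fdotZr m n c (A B : 'M[R]_(m, n)) : fdot A (c *: B) = c * fdot A B.
Proof. by rewrite ![fdot A _]fdotC fdotZl. Qed.

Lemma fdot_tr m n (A B : 'M[R]_(m, n)) : fdot A^T B^T = fdot A B.
Proof.
rewrite /fdot exchange_big; apply: eq_bigr => i _; apply: eq_bigr => j _.
by rewrite !mxE.
Qed.

Lemma fdot_ge0 m n (A : 'M[R]_(m, n)) : 0 <= fdot A A.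
Proof. by rewrite sumr_ge0// => i _; rewrite sumr_ge0// => j _; rewrite -expr2 sqr_ge0. Qed.

Lemma fnorm_sqr m n (A : 'M[R]_(m, n)) : fnorm A ^+ 2 = fdot A A.
Proof. by rewrite /fnorm sqr_sqrtr// fdot_ge0. Qed.

Lemma fnorm_ge0 m n (A : 'M[R]_(m, n)) : 0 <= fnorm A.
Proof. exact: sqrtr_ge0. Qed.

Lemma sqr_le_fdot m n (A : 'M[R]_(m, n)) i j : A i j ^+ 2 <= fdot A A.
Proof.
rewrite /fdot (bigD1 i)//= (bigD1 j)//= -expr2 -addrA lerDl addr_ge0//.
  by apply: sumr_ge0 => k _; rewrite -expr2 sqr_ge0.
by apply: sumr_ge0 => k _; apply: sumr_ge0 => l _; rewrite -expr2 sqr_ge0.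
Qed.

Lemma fdot_eq0 m n (A : 'M[R]_(m, n)) : fdot A A = 0 -> A = 0.
Proof.
move=> A0; apply/matrixP => i j; rewrite mxE; apply/eqP.
by rewrite -sqrf_eq0 eq_le sqr_ge0 andbT -A0 sqr_le_fdot.
Qed.

Lemma fdot_cauchy m n (A B : 'M[R]_(m, n)) : `|fdot A B| <= fnorm A * fnorm B.
Proof.
rewrite -(@ler_pXn2r _ 2)// ?nnegrE ?mulr_ge0 ?fnorm_ge0// exprMn !fnorm_sqr.
rewrite real_normK ?num_real//.
have := fdot_ge0 B; rewrite le_eqVlt => /predU1P[/esym B0|B0].
  by rewrite (fdot_eq0 B0) fdotC -(scale0r (0 : 'M[R]_(m, n))) !fdotZl !mul0r expr0n mulr0.
have := fdot_ge0 (fdot B B *: A - fdot A B *: B).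
rewrite !(fdotBl, fdotBr, fdotZl, fdotZr) (fdotC B A).
set a := fdot A A; set b := fdot B B; set c := fdot A B => H.
rewrite -(ler_pM2l B0) -/b -subr_ge0; apply: (le_trans H).
by rewrite le_eqVlt; apply/orP; left; apply/eqP; ring.
Qed.

Lemma fdot_outer d (a b : 'rV[R]_d) (A : 'M[R]_d) :
  fdot (outer a b) A = \sum_i \sum_j a 0 j * b 0 i * A i j.
Proof. by apply: eq_bigr => i _; apply: eq_bigr => j _; rewrite mxE. Qed.

Lemma fnorm_outer d (a b : 'rV[R]_d) : fnorm (outer a b) = fnorm a * fnorm b.
Proof.
rewrite -sqrtrM ?fdot_ge0//; congr (Num.sqrt _).
rewrite fdot_outer !fdot_row mulr_sumr; apply: eq_bigr => i _.
by rewrite mulr_suml; apply: eq_bigr => j _; rewrite mxE; ring.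
Qed.

Lemma outer_bound d (a b : 'rV[R]_d) (A : 'M[R]_d) V : fnorm A <= V ->
  `|fdot (outer a b) A| <= V * (fnorm a * fnorm b).
Proof.
move=> AV; apply: (le_trans (fdot_cauchy _ _)); rewrite fnorm_outer mulrC.
by rewrite ler_wpM2r// mulr_ge0// fnorm_ge0.
Qed.

Lemma trace_bound d (A : 'M[R]_d) V : fnorm A <= V -> `|\sum_j A j j| <= d%:R * V.
Proof.
move=> AV; apply: (le_trans (ler_norm_sum _ _ _)).
have -> : d%:R * V = \sum_(j < d) V by rewrite sumr_const card_ord mulr_natl.
apply: ler_sum => j _; apply: (le_trans _ AV).
by rewrite -(@ler_pXn2r _ 2)// ?nnegrE ?fnorm_ge0// fnorm_sqr real_normK ?num_real// sqr_le_fdot.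
Qed.

Lemma symm_sym d (A : 'M[R]_d) : (symm A)^T = symm A.
Proof. by rewrite /symm linearZ/= linearD/= trmxK addrC. Qed.

Lemma fdot_symm d (A B : 'M[R]_d) : A^T = A -> fdot A (symm B) = fdot A B.
Proof.
move=> As; rewrite /symm fdotZr fdotDr -[fdot A B^T]fdot_tr As trmxK.
by field.
Qed.

Lemma symmB d (A B : 'M[R]_d) : symm (A - B) = symm A - symm B.
Proof. by rewrite /symm linearB/= -scalerBr; congr (_ *: _); rewrite opprD addrACA. Qed.

Lemma fnorm_symm d (A : 'M[R]_d) : fnorm (symm A) <= fnorm A.
Proof.
have H : fnorm (symm A) ^+ 2 <= fnorm (symm A) * fnorm A.
  rewrite fnorm_sqr fdot_symm ?symm_sym//.
  exact: le_trans (ler_norm _) (fdot_cauchy _ _).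
have := fnorm_ge0 (symm A); rewrite le_eqVlt => /predU1P[<-|n0].
  exact: fnorm_ge0.
by rewrite -(ler_pM2l n0) -expr2.
Qed.

(** The identities below hold up to terms that are antisymmetric in the two
    indices. *)
Lemma sum_swap d (A B f : 'I_d -> 'I_d -> R) :
  (forall i j, A i j = B i j + (f i j - f j i)) ->
  \sum_i \sum_j A i j = \sum_i \sum_j B i j.
Proof.
move=> AB; under eq_bigr do under eq_bigr do rewrite AB.
under eq_bigr do rewrite big_split/= sumrB.
rewrite big_split/= sumrB [X in _ - X]exchange_big/=.
by rewrite subrr addr0.
Qed.

Lemma sum2D d (f g : 'I_d -> 'I_d -> R) :
  \sum_i \sum_j (f i j + g i j) = \sum_i \sum_j f i j + \sum_i \sum_j g i j.
Proof. by rewrite -big_split; apply: eq_bigr => i _; rewrite -big_split. Qed.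

Lemma sum2N d (f : 'I_d -> 'I_d -> R) :
  \sum_i \sum_j - f i j = - \sum_i \sum_j f i j.
Proof. by rewrite -sumrN; apply: eq_bigr => i _; rewrite -sumrN. Qed.

(** Monotonicity trades the unknown stress for the stress of the reference
    gradient, which can be integrated by parts. *)
Lemma viscous_bound d (S : 'M[R]_d -> 'M[R]_d) (G D : 'M[R]_d) : stress_law S ->
  - fdot (S (symm G)) (symm G) + fdot (S (symm G)) D
    <= - fdot (S (symm D)) (G - D).
Proof.
move=> HS; have := stress_mono HS (symm_sym G) (symm_sym D).
have sG := stress_sym HS (symm_sym G); have sD := stress_sym HS (symm_sym D).
rewrite fdotBr !fdotBl.
rewrite -(fdot_symm D sG) -(fdot_symm (G - D) sD) symmB fdotBr; lra.
Qed.

(** With [u] the velocity of the solution and [v] the reference velocity, [a] its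
    time derivative and [D] its gradient: the part of the balance that comes from
    inertia, sorted into the acceleration tested with [u - v] and a quadratic
    form. *)
Lemma convective_identity d (u v a : 'I_d -> R) (D : 'I_d -> 'I_d -> R) :
  - (\sum_i u i * a i) - (\sum_i \sum_j u j * u i * D i j)
  + (\sum_i v i * a i + \sum_j u j * \sum_i v i * D i j) =
  - (\sum_i (u i - v i) * (a i + \sum_j v j * D i j))
  - (\sum_i \sum_j (u j - v j) * (u i - v i) * D i j).
Proof.
have -> : \sum_j u j * \sum_i v i * D i j = \sum_i v i * \sum_j u j * D i j.
  under eq_bigr do rewrite mulr_sumr.
  rewrite exchange_big; apply: eq_bigr => i _; rewrite mulr_sumr.
  by apply: eq_bigr => j _; ring.
rewrite -!sumrN -!big_split/=; apply: eq_bigr => i _.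
have -> : \sum_j u j * u i * D i j = u i * \sum_j u j * D i j.
  by rewrite mulr_sumr; apply: eq_bigr => j _; ring.
have -> : \sum_j (u j - v j) * (u i - v i) * D i j =
    (u i - v i) * (\sum_j u j * D i j - \sum_j v j * D i j).
  by rewrite -sumrB mulr_sumr; apply: eq_bigr => j _; ring.
by ring.
Qed.

(** The last sum is the divergence of [p(r) v]. *)
Lemma pressure_identity d (rho r pr p'r prho rt : R) (u v rr D : 'I_d -> R) :
  r != 0 ->
  - (prho * \sum_j D j) - (rho * (p'r / r * rt) + \sum_j rho * u j * (p'r / r * rr j))
  + p'r * rt =
  - (rho * \sum_j (u j - v j) * (r^-1 * (p'r * rr j)))
  - (rho - r) * (p'r / r * rt + (\sum_j v j * (p'r / r * rr j)) + p'r * \sum_j D j)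
  - (prho - pr - p'r * (rho - r)) * \sum_j D j
  - (\sum_j (pr * D j + v j * (p'r * rr j))).
Proof.
move=> r0; rewrite big_split/= -[\sum_j pr * D j]mulr_sumr.
have -> : \sum_j rho * u j * (p'r / r * rr j) = (rho * (p'r / r)) * \sum_j u j * rr j.
  by rewrite mulr_sumr; apply: eq_bigr => j _; ring.
have -> : \sum_j (u j - v j) * (r^-1 * (p'r * rr j)) =
    (p'r / r) * (\sum_j u j * rr j - \sum_j v j * rr j).
  by rewrite -sumrB mulr_sumr; apply: eq_bigr => j _; ring.
have -> : \sum_j v j * (p'r / r * rr j) = (p'r / r) * \sum_j v j * rr j.
  by rewrite mulr_sumr; apply: eq_bigr => j _; ring.
have -> : \sum_j v j * (p'r * rr j) = p'r * \sum_j v j * rr j.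
  by rewrite mulr_sumr; apply: eq_bigr => j _; ring.
by field.
Qed.

(** The symmetry of [O] and exchanges of indices match all terms. What is left
    besides the quadratic form of [w - om] is [w . Psi + div Psi] for the field
    [Psi] defined below. *)
Lemma capillary_identity d (w om u v omt T : 'I_d -> R)
    (D O P Q W : 'I_d -> 'I_d -> R) : (forall i j, O i j = O j i) ->
  - (\sum_i w i * \sum_j P i j) - (\sum_i \sum_j w j * w i * D i j)
  + ((\sum_i T i) + (\sum_i om i * omt i)
     + \sum_j u j * ((\sum_i W i j) + \sum_i om i * O i j)) =
  (\sum_i (u i - v i) * \sum_j (W j i + om j * O i j))
  - (\sum_i (w i - om i) * (omt i + (\sum_j v j * O i j)
       + \sum_j (om j * D j i + Q i j)))
  - (\sum_i \sum_j (w j - om j) * (w i - om i) * D i j)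
  + ((\sum_i w i * (omt i + \sum_j (O i j * v j + (Q i j - P i j) - om j * D i j)))
     + \sum_i (T i + \sum_j (O i j * D j i + v j * W i j
                             - (om j * Q j i + D i j * O j i)))).
Proof.
move=> Osym.
have E1 : \sum_j u j * ((\sum_i W i j) + \sum_i om i * O i j) =
    \sum_i \sum_j (u i * W j i + u i * om j * O j i).
  apply: eq_bigr => i _; rewrite -big_split/= mulr_sumr.
  by apply: eq_bigr => j _; ring.
have E2 : \sum_i w i * \sum_j P i j = \sum_i \sum_j w i * P i j.
  by apply: eq_bigr => i _; rewrite mulr_sumr.
have E3 : \sum_i (u i - v i) * \sum_j (W j i + om j * O i j) =
    \sum_i \sum_j (u i - v i) * (W j i + om j * O i j).
  by apply: eq_bigr => i _; rewrite mulr_sumr.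
have E4 : \sum_i (w i - om i) * (omt i + (\sum_j v j * O i j)
       + \sum_j (om j * D j i + Q i j)) = \sum_i (w i - om i) * omt i +
    \sum_i \sum_j (w i - om i) * (v j * O i j + (om j * D j i + Q i j)).
  rewrite -big_split/=; apply: eq_bigr => i _; rewrite -addrA -big_split/= mulrDr.
  by rewrite mulr_sumr.
have E5 : \sum_i w i * (omt i + \sum_j (O i j * v j + (Q i j - P i j) - om j * D i j)) =
    \sum_i w i * omt i +
    \sum_i \sum_j w i * (O i j * v j + (Q i j - P i j) - om j * D i j).
  by rewrite -big_split/=; apply: eq_bigr => i _; rewrite mulrDr mulr_sumr.
have E6 : \sum_i (w i - om i) * omt i = \sum_i w i * omt i - \sum_i om i * omt i.
  by rewrite -sumrB; apply: eq_bigr => i _; ring.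
rewrite E1 E2 E3 E4 E5 E6 [\sum_i (T i + _)]big_split/=.
have : \sum_i \sum_j (- (w i * P i j) - w j * w i * D i j
      + (u i * W j i + u i * om j * O j i)) =
   \sum_i \sum_j ((u i - v i) * (W j i + om j * O i j)
     - (w i - om i) * (v j * O i j + (om j * D j i + Q i j))
     - (w j - om j) * (w i - om i) * D i j
     + w i * (O i j * v j + (Q i j - P i j) - om j * D i j)
     + (O i j * D j i + v j * W i j - (om j * Q j i + D i j * O j i))).
  apply: (@sum_swap d _ _ (fun i j => - (v j * W i j) + v i * om j * O i j
     - O i j * D j i - om i * Q i j - om i * (w j - om j) * D i j)) => i j.
  rewrite (Osym j i); ring.
rewrite !(sum2D, sum2N).
lra.
Qed.
End Algebra.

(** * The weak equations *)

Section Slice.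
Context (R : realType) (d : nat) (T : R).
Local Notation X := 'rV[R]_d.
Local Notation TR := (measurableTypeR R).
Local Notation mu := (@lebesgue_measure R).
Implicit Types (f g : R -> X -> R) (F G : R -> R).

Lemma tintegrableD (f g : X -> R) : tintegrable f -> tintegrable g ->
  tintegrable (fun x => f x + g x).
Proof. exact: rintD measurableT _ _. Qed.

Lemma tintegrableB (f g : X -> R) : tintegrable f -> tintegrable g ->
  tintegrable (fun x => f x - g x).
Proof. exact: rintB measurableT _ _. Qed.

Lemma tintegrableZ c (f : X -> R) : tintegrable f -> tintegrable (fun x => c * f x).
Proof. exact: rintZ measurableT c _. Qed.

Lemma tintegrable_sum (I : finType) (F : I -> X -> R) :
  (forall i, tintegrable (F i)) -> tintegrable (fun x => \sum_i F i x).
Proof.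
exact: (@rint_sum _ _ R _ _ measurableT I (fun i y => F i (torus_pt y))).
Qed.

Lemma tintD (f g : X -> R) : tintegrable f -> tintegrable g ->
  tint (fun x => f x + g x) = tint f + tint g.
Proof. by move=> hf hg; exact: RintegralD. Qed.

Lemma tintB (f g : X -> R) : tintegrable f -> tintegrable g ->
  tint (fun x => f x - g x) = tint f - tint g.
Proof. by move=> hf hg; exact: RintegralB. Qed.

Lemma tintZ c (f : X -> R) : tintegrable f -> tint (fun x => c * f x) = c * tint f.
Proof. by move=> hf; exact: RintegralZl. Qed.

Lemma tint_sum (I : finType) (F : I -> X -> R) :
  (forall i, tintegrable (F i)) -> tint (fun x => \sum_i F i x) = \sum_i tint (F i).
Proof.
exact: (@Rintegral_sum _ _ R _ _ measurableT I (fun i y => F i (torus_pt y))).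
Qed.

Lemma tint_le (f g : X -> R) : tintegrable f -> tintegrable g ->
  (forall x, f x <= g x) -> tint f <= tint g.
Proof. by move=> hf hg fg; apply: le_Rintegral => // y _; exact: fg. Qed.

Lemma st_integrableD f g : st_integrable T f -> st_integrable T g ->
  st_integrable T (fun t x => f t x + g t x).
Proof. exact: rintD (@measurable_strip R d T) _ _. Qed.

Lemma st_integrableZ c f : st_integrable T f -> st_integrable T (fun t x => c * f t x).
Proof. exact: rintZ (@measurable_strip R d T) _ _. Qed.

Lemma st_integrableN f : st_integrable T f -> st_integrable T (fun t x => - f t x).
Proof. exact: rintN (@measurable_strip R d T) _. Qed.

Lemma st_integrable_sum (I : finType) (F : I -> R -> X -> R) :
  (forall i, st_integrable T (F i)) -> st_integrable T (fun t x => \sum_i F i t x).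
Proof.
exact: (@rint_sum _ _ R _ _ (@measurable_strip R d T) I
  (fun i z => F i z.1 (torus_pt z.2))).
Qed.

Lemma st_integrable_ext f g : st_integrable T f -> (forall t x, f t x = g t x) ->
  st_integrable T g.
Proof.
by move=> hf fg; have <- : f = g by apply/funext => t; apply/funext => x.
Qed.

Lemma st_integrableMr c f : st_cont c -> st_integrable T f ->
  st_integrable T (fun t x => f t x * c t x).
Proof.
by move=> cc hf; apply: st_integrable_ext (st_integrableM cc hf) _ => t x; rewrite mulrC.
Qed.

Lemma st_integrable_norm f : st_integrable T f -> st_integrable T (fun t x => `|f t x|).
Proof. exact: integrable_norm. Qed.

Lemma st_dom f g : st_measurable T f -> (forall t x, `|f t x| <= g t x) ->
  st_integrable T g -> st_integrable T f.
Proof. by move=> mf fg; apply: rint_dom => //; exact: measurable_strip. Qed.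

Lemma st_measurableM f g : st_measurable T f -> st_measurable T g ->
  st_measurable T (fun t x => f t x * g t x).
Proof. exact: measurable_funM. Qed.

Lemma aeI (P Q : R -> Prop) : {ae mu, forall t, P t} -> {ae mu, forall t, Q t} ->
  {ae mu, forall t, P t /\ Q t}.
Proof.
move=> hP hQ; have FF := ae_filter_ringOfSetsType mu.
exact: (@filterI _ _ FF _ _ hP hQ).
Qed.

Lemma aeS (P Q : R -> Prop) : (forall t, P t -> Q t) -> {ae mu, forall t, P t} ->
  {ae mu, forall t, Q t}.
Proof.
move=> PQ; have FF := ae_filter_ringOfSetsType mu.
exact: (@filterS _ _ FF _ _ PQ).
Qed.

(** A space-time integrable function is integrable in space at almost every time
    only; the calculus of such almost everywhere defined integrals is collected
    in this predicate. *)
Definition slice F f :=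
  [/\ st_integrable T f,
      forall t, 0 <= t <= T -> mu.-integrable `[0, t] (fun s => (F s)%:E) &
      {ae mu, forall t, 0 <= t <= T -> F t = tint (f t)}].

Lemma slice_tint f : st_integrable T f -> slice (fun t => tint (f t)) f.
Proof.
move=> hf; split=> //; first by move=> t; exact: st_integrable_time.
by have FF := ae_filter_ringOfSetsType mu; apply: (@filterE _ _ FF).
Qed.

Lemma sliceD F G f g : slice F f -> slice G g ->
  slice (fun t => F t + G t) (fun t x => f t x + g t x).
Proof.
move=> [hf iF eF] [hg iG eG]; split; first exact: st_integrableD.
  by move=> t tT; apply: rintD; [exact: measurable_itv|exact: iF|exact: iG].
have aef := st_integrable_ae hf; have aeg := st_integrable_ae hg.
apply: aeS (aeI (aeI eF eG) (aeI aef aeg)) => t [[{}eF {}eG] [{}aef {}aeg]] tT; rewrite eF// eG// -[LHS]RintegralD//.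
  exact: aef.
exact: aeg.
Qed.

Lemma sliceZ c F f : slice F f -> slice (fun t => c * F t) (fun t x => c * f t x).
Proof.
move=> [hf iF eF]; split; first exact: st_integrableZ.
  by move=> t tT; apply: rintZ; [exact: measurable_itv|exact: iF].
have aef := st_integrable_ae hf.
apply: aeS (aeI eF aef) => t [{}eF {}aef] tT.
rewrite eF// -[LHS]RintegralZl//.
exact: aef.
Qed.

Lemma slice_ext F G f g : slice F f -> (forall t, F t = G t) ->
  (forall t x, f t x = g t x) -> slice G g.
Proof.
move=> sF FG fg; have -> : G = F by apply/funext => t.
by have -> : g = f by apply/funext => t; apply/funext => x.
Qed.

Lemma sliceN F f : slice F f -> slice (fun t => - F t) (fun t x => - f t x).
Proof.
move=> /(sliceZ (-1)) sF; apply: (slice_ext sF) => *; exact: mulN1r.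
Qed.

Lemma sliceB F G f g : slice F f -> slice G g ->
  slice (fun t => F t - G t) (fun t x => f t x - g t x).
Proof. by move=> sF /sliceN; exact: sliceD. Qed.

Lemma slice_null (f : R -> X -> R) : st_integrable T f ->
  {ae mu, forall t, 0 <= t <= T -> tint (f t) = 0} -> slice (fun=> 0) f.
Proof.
move=> hf f0; split=> // [t tT|]; first exact: rint0.
by apply: aeS f0 => t f0 tT; rewrite f0.
Qed.

Lemma slice_mono (F G : R -> R) (f g : R -> X -> R) : slice F f -> slice G g ->
  (forall t x, 0 <= t <= T -> f t x <= g t x) ->
  {ae mu, forall t, 0 <= t <= T -> F t <= G t}.
Proof.
move=> [hf _ eF] [hg _ eG] fg.
apply: aeS (aeI (aeI eF eG) (aeI (st_integrable_ae hf) (st_integrable_ae hg))).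
move=> t [[{}eF {}eG] [{}hf {}hg]] tT; rewrite (eF tT) (eG tT).
by apply: tint_le (hf tT) (hg tT) _ => x; exact: fg.
Qed.

Lemma time_int5 (a b c e f : R -> R) t :
  mu.-integrable `[0, t] (EFin \o a) -> mu.-integrable `[0, t] (EFin \o b) ->
  mu.-integrable `[0, t] (EFin \o c) -> mu.-integrable `[0, t] (EFin \o e) ->
  mu.-integrable `[0, t] (EFin \o f) ->
  time_int t (fun s => - a s - b s + c s - e s + f s) =
  - time_int t a - time_int t b + time_int t c - time_int t e + time_int t f.
Proof.
move=> ia ib ic ie iF; have mt : measurable (`[0, t]%classic : set TR) by exact: measurable_itv.
have j1 := rintB mt (rintN mt ia) ib; have j2 := rintD mt j1 ic; have j3 := rintB mt j2 ie.
rewrite -[- time_int t a](RintegralN mt ia) -[X in _ = X + _ - _ + _](RintegralB mt (rintN mt ia) ib).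
by rewrite -[X in _ = X - _ + _](RintegralD mt j1 ic) -[X in _ = X + _](RintegralB mt j2 ie) -[RHS](RintegralD mt j3 iF).
Qed.

End Slice.

Section WeakForms.
Context (R : realType) (d : nat) (kappa : R) (S : 'M[R]_d -> 'M[R]_d) (p : R -> R).
Context (T rhobar : R) (rho0 : 'rV[R]_d -> R) (u0 : 'rV[R]_d -> 'rV[R]_d).
Context (rho : R -> 'rV[R]_d -> R) (u w : R -> 'rV[R]_d -> 'rV[R]_d).
Context (Gu : R -> 'rV[R]_d -> 'M[R]_d).
Hypothesis Hdata : initial_data rho0 u0.
Hypothesis Hreg : regular S p rhobar T rho u w Gu.
Hypothesis Hsol : weak_solution kappa S p T rho0 u0 rho u w Gu.
Local Notation X := 'rV[R]_d.
Local Notation TR := (measurableTypeR R).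
Local Notation mu := (@lebesgue_measure R).

Lemma rho_ge0 t x : 0 <= rho t x.
Proof. exact: (sol_ge0 Hsol). Qed.

Lemma st_rho : st_integrable T rho.
Proof. by case: (reg_st_energy Hreg). Qed.

Lemma mul_abs_le (a b c : R) : a ^+ 2 <= c -> b ^+ 2 <= c -> `|a * b| <= c.
Proof. by rewrite normrM -(real_normK (num_real a)) -(real_normK (num_real b)); nra. Qed.

(** Moments of order one are bounded by the mass and the energy. *)
Lemma abs_le_sqr (a c : R) : a ^+ 2 <= c -> `|a| <= 1 + c.
Proof. by rewrite -(real_normK (num_real a)); nra. Qed.

Lemma st_ru i : st_integrable T (fun t x => rho t x * u t x 0 i).
Proof.
have [h1 h2 _ _] := reg_st_energy Hreg.
apply: st_dom (st_integrableD h1 h2).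
  exact: st_measurableM (reg_meas_rho Hreg) (reg_meas_u Hreg i).
move=> t x; rewrite normrM ger0_norm ?rho_ge0// -[X in _ <= X + _]mulr1 -mulrDr.
by rewrite ler_wpM2l ?rho_ge0// abs_le_sqr// sqr_le_fdot.
Qed.

Lemma st_rw i : st_integrable T (fun t x => rho t x * w t x 0 i).
Proof.
have [h1 _ h2 _] := reg_st_energy Hreg.
apply: st_dom (st_integrableD h1 h2).
  exact: st_measurableM (reg_meas_rho Hreg) (reg_meas_w Hreg i).
move=> t x; rewrite normrM ger0_norm ?rho_ge0// -[X in _ <= X + _]mulr1 -mulrDr.
by rewrite ler_wpM2l ?rho_ge0// abs_le_sqr// sqr_le_fdot.
Qed.

Lemma st_ruu i j : st_integrable T (fun t x => rho t x * (u t x 0 j * u t x 0 i)).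
Proof.
have [h1 h2 _ _] := reg_st_energy Hreg.
apply: st_dom h2.
  apply: st_measurableM; first exact: reg_meas_rho Hreg.
  exact: st_measurableM (reg_meas_u Hreg j) (reg_meas_u Hreg i).
move=> t x; rewrite normrM ger0_norm ?rho_ge0// ler_wpM2l ?rho_ge0//.
by rewrite mul_abs_le// sqr_le_fdot.
Qed.

Lemma st_rww i j : st_integrable T (fun t x => rho t x * (w t x 0 j * w t x 0 i)).
Proof.
have [h1 _ h2 _] := reg_st_energy Hreg.
apply: st_dom h2.
  apply: st_measurableM; first exact: reg_meas_rho Hreg.
  exact: st_measurableM (reg_meas_w Hreg j) (reg_meas_w Hreg i).
move=> t x; rewrite normrM ger0_norm ?rho_ge0// ler_wpM2l ?rho_ge0//.
by rewrite mul_abs_le// sqr_le_fdot.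
Qed.

Lemma st_rwu i j : st_integrable T (fun t x => rho t x * (w t x 0 j * u t x 0 i)).
Proof.
have [h1 h2 h3 _] := reg_st_energy Hreg.
apply: st_dom (st_integrableD h2 h3).
  apply: st_measurableM; first exact: reg_meas_rho Hreg.
  exact: st_measurableM (reg_meas_w Hreg j) (reg_meas_u Hreg i).
move=> t x; rewrite normrM ger0_norm ?rho_ge0// -mulrDr ler_wpM2l ?rho_ge0//.
by rewrite mul_abs_le// (le_trans (sqr_le_fdot _ 0 _))// ?lerDl ?lerDr fdot_ge0.
Qed.

Section FixedTime.
Variables (t : R) (tT : 0 <= t <= T).

Lemma t_rho : tintegrable (rho t).
Proof. by case: (reg_energy Hreg tT). Qed.

Lemma t_ru i : tintegrable (fun x => rho t x * u t x 0 i).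
Proof.
have [h1 h2 _ _] := reg_energy Hreg tT.
apply: (rint_dom measurableT _ _ (rintD measurableT h1 h2)).
  apply: (st_measurable_section (f := fun t x => rho t x * u t x 0 i) tT).
  exact: st_measurableM (reg_meas_rho Hreg) (reg_meas_u Hreg i).
move=> y _; rewrite normrM ger0_norm ?rho_ge0// -[X in _ <= X + _]mulr1 -mulrDr.
by rewrite ler_wpM2l ?rho_ge0// abs_le_sqr// sqr_le_fdot.
Qed.

Lemma t_rw i : tintegrable (fun x => rho t x * w t x 0 i).
Proof.
have [h1 _ h2 _] := reg_energy Hreg tT.
apply: (rint_dom measurableT _ _ (rintD measurableT h1 h2)).
  apply: (st_measurable_section (f := fun t x => rho t x * w t x 0 i) tT).
  exact: st_measurableM (reg_meas_rho Hreg) (reg_meas_w Hreg i).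
move=> y _; rewrite normrM ger0_norm ?rho_ge0// -[X in _ <= X + _]mulr1 -mulrDr.
by rewrite ler_wpM2l ?rho_ge0// abs_le_sqr// sqr_le_fdot.
Qed.

End FixedTime.

Lemma t_ru_dot t (phi : 'I_d -> R -> X -> R) : 0 <= t <= T ->
  (forall i, st_cont (phi i)) ->
  tintegrable (fun x => \sum_i rho t x * u t x 0 i * phi i t x).
Proof.
move=> tT cphi; apply: tintegrable_sum => i.
have := tintegrableM tT (cphi i) (t_ru tT i).
by under eq_fun do rewrite mulrC.
Qed.

Lemma t_rho_mul t phi : 0 <= t <= T -> st_cont phi ->
  tintegrable (fun x => rho t x * phi t x).
Proof.
move=> tT cphi; have := tintegrableM tT cphi (t_rho tT).
by under eq_fun do rewrite mulrC.
Qed.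

Lemma rho0_measurable : measurable_fun setT (fun y : d.-tuple TR => rho0 (torus_pt y)).
Proof.
have [[mf _] _] := data_H1 Hdata.
rewrite (_ : (fun y : d.-tuple TR => rho0 (torus_pt y)) =
  (fun y => Num.sqrt (rho0 (torus_pt y)) * Num.sqrt (rho0 (torus_pt y)))).
  exact: measurable_funM.
by apply/funext => y; rewrite -expr2 sqr_sqrtr// (data_ge0 Hdata).
Qed.

Lemma init_mass phi : 0 <= T -> st_cont phi ->
  tint (fun x => rho0 x * phi 0 x) = tint (fun x => rho 0 x * phi 0 x).
Proof.
move=> T0 cphi; have t0 : 0 <= (0 : R) <= T by rewrite lexx.
congr fine; apply: ae_eq_integral => //.
- apply/measurable_EFinP; apply: measurable_funM; first exact: rho0_measurable.
  exact: st_measurable_section t0 (st_cont_measurable cphi).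
- by apply: (measurable_int (torus_measure R d)); exact: t_rho_mul.
have FF := ae_filter_ringOfSetsType (torus_measure R d).
apply: (@filterS _ _ FF _ _ _ (sol_init Hsol)) => y /= [+ _] _.
by move=> ->.
Qed.

Lemma init_momentum (phi : 'I_d -> R -> X -> R) : 0 <= T -> (forall i, st_cont (phi i)) ->
  tint (fun x => rho0 x * \sum_i u0 x 0 i * phi i 0 x) =
  tint (fun x => \sum_i rho 0 x * u 0 x 0 i * phi i 0 x).
Proof.
move=> T0 cphi; have t0 : 0 <= (0 : R) <= T by rewrite lexx.
congr fine; apply: ae_eq_integral => //.
- apply/measurable_EFinP.
  rewrite (_ : (fun y : d.-tuple TR => _) = (fun y => \sum_i Num.sqrt (rho0 (torus_pt y)) *
     (Num.sqrt (rho0 (torus_pt y)) * u0 (torus_pt y) 0 i) * phi i 0 (torus_pt y))).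
    apply: measurable_sum => i; apply: measurable_funM; last first.
      exact: st_measurable_section t0 (st_cont_measurable (cphi i)).
    have [[mf _] _] := data_H1 Hdata; have [mg _] := data_L2 Hdata i.
    exact: measurable_funM.
  apply/funext => y; rewrite mulr_sumr; apply: eq_bigr => i _.
  by rewrite [X in _ = X * _]mulrA -expr2 sqr_sqrtr ?(data_ge0 Hdata)// mulrA.
- by apply: (measurable_int (torus_measure R d)); exact: t_ru_dot.
have FF := ae_filter_ringOfSetsType (torus_measure R d).
apply: (@filterS _ _ FF _ _ _ (sol_init Hsol)) => y /= [_ E] _.
rewrite mulr_sumr; congr (_%:E); apply: eq_bigr => i _.
have := congr1 (fun v : X => v 0 i) E; rewrite !mxE => ->.
by rewrite mulrA.
Qed.

(** The initial data may be replaced by the solution at time 0, with which they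
    agree almost everywhere. *)
Lemma mass_eq phi tau : st_smooth phi -> 0 <= tau <= T ->
  tint (fun x => rho tau x * phi tau x) - tint (fun x => rho 0 x * phi 0 x) =
  time_int tau (fun t => tint (fun x => rho t x * Dt phi t x +
    \sum_j rho t x * u t x 0 j * Dx j phi t x)).
Proof.
move=> sphi tauT; have T0 : 0 <= T by case/andP: tauT; exact: le_trans.
rewrite -(init_mass T0 (st_smooth_cont sphi)) (sol_mass Hsol sphi tauT).
apply: eq_Rintegral => t _; congr (Rintegral _ _ _); apply/funext => y.
rewrite DtE fdot_row mulr_sumr; congr (_ + _); apply: eq_bigr => j _.
by rewrite mxE DxE mulrA.
Qed.

Lemma le_eps_eq0 (a C : R) : 0 <= C -> (forall e : R, 0 < e -> `|a| <= e * C) -> a = 0.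
Proof.
move=> C0 aC; apply/eqP; rewrite -normr_le0; apply/ler_addgt0Pl => e e0; rewrite addr0.
have C1 : 0 < C + 1 by lra.
apply: (le_trans (aC (e / (C + 1)) (divr_gt0 e0 C1))).
by rewrite mulrAC ler_pdivrMr// ler_wpM2l ?ltW//; lra.
Qed.

(** The mass equation, tested with [f r] for [f] of class C^1 only: [f] is a
    limit of polynomials in the C^1 norm, and polynomials of a smooth function
    are smooth. *)
Lemma mass_eq_comp (r : R -> X -> R) (f f' : R -> R) m M L tau :
  st_smooth r -> (forall t x, 0 < r t x) -> 0 < m -> m < M ->
  (forall t x, 0 <= t <= T -> m <= r t x <= M) ->
  (forall s : R, 0 < s -> is_derive s 1 f (f' s)) ->
  (forall s, 0 < s -> {for s, continuous f'}) -> 0 <= L ->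
  (forall x y, m <= x <= M -> m <= y <= M -> `|f' x - f' y| <= L * `|x - y|) ->
  0 <= tau <= T ->
  tint (fun x => rho tau x * f (r tau x)) - tint (fun x => rho 0 x * f (r 0 x)) =
  time_int tau (fun t => tint (fun x => rho t x * (f' (r t x) * Dt r t x) +
    \sum_j rho t x * u t x 0 j * (f' (r t x) * Dx j r t x))).
Proof.
move=> sr r0 m0 mM rmM df cf' L0 fL tauT.
have T0 : 0 <= T by case/andP: tauT; exact: le_trans.
have t0 : 0 <= (0 : R) <= T by rewrite lexx.
have cr := st_smooth_cont sr.
have cfr : st_cont (fun t x => f (r t x)).
  by apply: st_cont_comp => // t x; exact: derive_cont (df _ (r0 t x)).
have cf'r : st_cont (fun t x => f' (r t x)).
  by apply: st_cont_comp => // t x; exact: cf'.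
have cDt := st_smooth_cont (st_smooth_Dt sr).
have cDx j := st_smooth_cont (st_smooth_Dx j sr).
pose Kf t x := rho t x * `|Dt r t x| + \sum_j `|rho t x * u t x 0 j * Dx j r t x|.
have hru j : st_integrable T (fun t x => rho t x * u t x 0 j * Dx j r t x).
  exact: st_integrableMr (cDx j) (st_ru j).
have hK : st_integrable T Kf.
  apply: st_integrableD.
    apply: st_integrable_ext (st_integrable_norm (st_integrableMr cDt st_rho)) _ => t x.
    by rewrite normrM ger0_norm ?rho_ge0.
  by apply: st_integrable_sum => j; exact: st_integrable_norm (hru j).
have tK t : 0 <= t <= T -> tintegrable (Kf t).
  move=> tT; apply: tintegrableD.
    have := integrable_norm (tintegrableM tT cDt (t_rho tT)).
    rewrite /tintegrable; apply: eq_integrable => //.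
    by move=> y _ /=; rewrite normrM mulrC ger0_norm ?rho_ge0.
  apply: tintegrable_sum => j.
  have := integrable_norm (tintegrableM tT (cDx j) (t_ru tT j)).
  rewrite /tintegrable; apply: eq_integrable => //.
  by move=> y _ /=; rewrite mulrC.
have Kf0 t x : 0 <= Kf t x.
  by rewrite addr_ge0 ?mulr_ge0 ?rho_ge0// sumr_ge0.
pose C := tint (rho tau) + tint (rho 0) + time_int tau (fun t => tint (Kf t)).
have C0 : 0 <= C.
  rewrite !addr_ge0//; try by apply: Rintegral_ge0 => y _; exact: rho_ge0.
  by apply: Rintegral_ge0 => t _; apply: Rintegral_ge0 => y _; exact: Kf0.
apply/eqP; rewrite -subr_eq0; apply/eqP; apply: (le_eps_eq0 C0) => e e0.
have [Q HQ] := C1_poly_approx m0 mM e0 L0 df fL.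
have sQ := st_smooth_horner Q sr; have cQ := st_smooth_cont sQ.
have HQr t x : 0 <= t <= T ->
    `|f (r t x) - Q.[r t x]| <= e /\ `|f' (r t x) - Q^`().[r t x]| <= e.
  by move=> tT; apply: HQ; exact: rmM.
have EQ := mass_eq sQ tauT.
have dQ t x : derivable (horner Q) (r t x) 1 by exact: derivable_horner.
have DtQ t x : Dt (fun t x => Q.[r t x]) t x = Q^`().[r t x] * Dt r t x.
  by rewrite (Dt_comp sr (dQ t x)) derivE.
have DxQ j t x : Dx j (fun t x => Q.[r t x]) t x = Q^`().[r t x] * Dx j r t x.
  by rewrite (Dx_comp j sr (dQ t x)) derivE.
have side t : 0 <= t <= T ->
    `|tint (fun x => rho t x * f (r t x)) - tint (fun x => rho t x * Q.[r t x])|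
    <= e * tint (rho t).
  move=> tT.
  have ha : tintegrable (fun x => rho t x * f (r t x)) by exact: t_rho_mul tT cfr.
  have hb : tintegrable (fun x => rho t x * Q.[r t x]) by exact: t_rho_mul tT cQ.
  have h1 := tintegrableB ha hb; rewrite -(tintB ha hb).
  apply: (le_trans (le_normr_Rintegral measurableT h1)).
  rewrite -(tintZ e (t_rho tT)).
  apply: le_Rintegral => //.
  - exact: integrable_norm h1.
  - exact: tintegrableZ (t_rho tT).
  move=> y _; rewrite -mulrBr normrM ger0_norm ?rho_ge0// mulrC.
  by rewrite ler_wpM2r ?rho_ge0//; case: (HQr t (torus_pt y) tT).
pose F t x := rho t x * (f' (r t x) * Dt r t x) +
    \sum_j rho t x * u t x 0 j * (f' (r t x) * Dx j r t x).
pose G t x := rho t x * Dt (fun t x => Q.[r t x]) t x +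
    \sum_j rho t x * u t x 0 j * Dx j (fun t x => Q.[r t x]) t x.
have hF : st_integrable T F.
  apply: st_integrableD.
    exact: st_integrableMr (st_contM cf'r cDt) st_rho.
  apply: st_integrable_sum => j.
  exact: st_integrableMr (st_contM cf'r (cDx j)) (st_ru j).
have hG : st_integrable T G.
  apply: st_integrableD.
    exact: st_integrableMr (st_smooth_cont (st_smooth_Dt sQ)) st_rho.
  apply: st_integrable_sum => j.
  exact: st_integrableMr (st_smooth_cont (st_smooth_Dx j sQ)) (st_ru j).
have tF t : 0 <= t <= T -> tintegrable (F t).
  move=> tT; apply: tintegrableD; first exact: t_rho_mul (st_contM cf'r cDt).
  by apply: (t_ru_dot (phi := fun j t x => f' (r t x) * Dx j r t x)) => // j; exact: st_contM.
have tG t : 0 <= t <= T -> tintegrable (G t).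
  move=> tT; apply: tintegrableD.
    exact: t_rho_mul (st_smooth_cont (st_smooth_Dt sQ)).
  by apply: (t_ru_dot (phi := fun j => Dx j (fun t x => Q.[r t x]))) => // j;
    exact: (st_smooth_cont (st_smooth_Dx j sQ)).
have FG t : 0 <= t <= T -> `|tint (F t) - tint (G t)| <= e * tint (Kf t).
  move=> tT; have h1 := tintegrableB (tF t tT) (tG t tT).
  rewrite -(tintB (tF t tT) (tG t tT)).
  apply: (le_trans (le_normr_Rintegral measurableT h1)).
  rewrite -(tintZ e (tK t tT)).
  apply: le_Rintegral => //.
  - exact: integrable_norm h1.
  - exact: tintegrableZ (tK t tT).
  move=> y _; set x := torus_pt y.
  have [_ He] := HQr t x tT.
  rewrite /F /G /Kf DtQ mulrDr mulr_sumr.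
  have -> : rho t x * (f' (r t x) * Dt r t x) +
     \sum_j rho t x * u t x 0 j * (f' (r t x) * Dx j r t x) -
     (rho t x * (Q^`().[r t x] * Dt r t x) +
     \sum_j rho t x * u t x 0 j * Dx j (fun t x => Q.[r t x]) t x) =
     (f' (r t x) - Q^`().[r t x]) * (rho t x * Dt r t x) +
     \sum_j (f' (r t x) - Q^`().[r t x]) * (rho t x * u t x 0 j * Dx j r t x).
    rewrite opprD addrACA -sumrB; congr (_ + _); first by ring.
    by apply: eq_bigr => j _; rewrite DxQ; ring.
  apply: (le_trans (ler_normD _ _)); apply: lerD.
    by rewrite normrM [`|rho t x * _|]normrM (ger0_norm (rho_ge0 t x)) ler_wpM2r// mulr_ge0 ?rho_ge0.
  apply: (le_trans (ler_norm_sum _ _ _)); apply: ler_sum => j _.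
  by rewrite normrM ler_wpM2r.
have mtau : measurable (`[0, tau]%classic : set TR) by exact: measurable_itv.
have iF := st_integrable_time hF tauT; have iG := st_integrable_time hG tauT.
have timeFG : `|time_int tau (fun t => tint (F t)) - time_int tau (fun t => tint (G t))|
    <= e * time_int tau (fun t => tint (Kf t)).
  rewrite -[X in `|X|]RintegralB//.
  apply: (le_trans (le_normr_Rintegral mtau (rintB mtau iF iG))).
  have iK := st_integrable_time hK tauT.
  rewrite -[leRHS]RintegralZl//; apply: le_Rintegral => //.
  - exact: integrable_norm (rintB mtau iF iG).
  - exact: (rintZ mtau e iK).
  move=> t /=; rewrite in_itv/= => /andP[t1 t2]; apply: FG.
  by rewrite t1 (le_trans t2)//; case/andP: tauT.
have S1 := side tau tauT; have S2 := side 0 t0.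
change (`|tint (fun x => rho tau x * f (r tau x)) - tint (fun x => rho 0 x * f (r 0 x))
  - time_int tau (fun t => tint (F t))| <= e * C).
have {}EQ : tint (fun x => rho tau x * Q.[r tau x]) - tint (fun x => rho 0 x * Q.[r 0 x]) =
  time_int tau (fun t => tint (G t)) by exact: EQ.
set a1 := tint _ in S1 *; set a2 := tint _ in S2 *; set a3 := time_int _ _ in timeFG *.
have -> : a1 - a2 - a3 = (a1 - tint (fun x => rho tau x * Q.[r tau x]))
   - (a2 - tint (fun x => rho 0 x * Q.[r 0 x]))
   - (a3 - time_int tau (fun t => tint (G t))) by rewrite -EQ; ring.
apply: (le_trans (ler_normB _ _)); rewrite /C [leRHS]mulrDr lerD//.
by apply: (le_trans (ler_normB _ _)); rewrite mulrDr lerD.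
Qed.
End WeakForms.

(** * The fields A1, A2 and A3 *)

Section MoreCalculus.
Context (R : realType) (d : nat).
Local Notation X := 'rV[R]_d.
Implicit Types (f g : R -> X -> R).

Lemma st_smoothN f : st_smooth f -> st_smooth (fun t x => - f t x).
Proof.
move=> sf; have := st_smoothM (st_smooth_cst d (-1 : R)) sf.
rewrite (_ : (fun t x => -1 * f t x) = fun t x => - f t x)//.
by apply/funext => t; apply/funext => x; rewrite mulN1r.
Qed.

Lemma st_smoothB f g : st_smooth f -> st_smooth g -> st_smooth (fun t x => f t x - g t x).
Proof. by move=> sf /st_smoothN; exact: st_smoothD. Qed.

Lemma DxZ j (c : R) f t x : st_smooth f -> Dx j (fun t x => c * f t x) t x = c * Dx j f t x.
Proof.
move=> sf; rewrite (DxM j t x (st_smooth_cst d c) sf) Dx_cst mulr0 addr0//.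
Qed.

Lemma DtZ (c : R) f t x : st_smooth f -> Dt (fun t x => c * f t x) t x = c * Dt f t x.
Proof.
move=> sf; rewrite (DtM t x (st_smooth_cst d c) sf) Dt_cst mulr0 addr0//.
Qed.

Lemma DxB j f g t x : st_smooth f -> st_smooth g ->
  Dx j (fun t x => f t x - g t x) t x = Dx j f t x - Dx j g t x.
Proof.
move=> sf sg; rewrite (DxD j t x sf (st_smoothN sg)); congr (_ + _).
rewrite -mulN1r -(DxZ j (-1) t x sg); congr (Dx j _ t x).
by apply/funext => s; apply/funext => y; rewrite mulN1r.
Qed.

Lemma Ck_section k (F : R * X -> R) t : Ck k F -> Ck k (fun x => F (t, x)).
Proof.
elim: k F => [|k IH] F.
  move=> cF x; apply: (@continuous_comp _ _ _ (fun x => (t, x)) F); last exact: cF.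
  exact: continuous_pairr.
move=> [dF DF]; split=> [x|h].
  apply: (@differentiable_comp _ _ _ _ (fun x : X => (t, x)) F x); last exact: dF.
  by apply: differentiable_pair; [exact: differentiable_cst|by case: (is_diff_id x)].
rewrite (_ : 'D_h _ = fun x => ('D_((0, h) : R * X) F) (t, x)); first exact: IH (DF _).
by apply/funext => x; exact: (derive_x (fun t x => F (t, x))).
Qed.

Lemma st_smooth_section f t : st_smooth f -> smooth (f t).
Proof. by move=> [_ sf] k; exact: (Ck_section t (sf k)). Qed.

Lemma differentiable_mx (V : normedModType R) m n (M : V -> 'M[R]_(m, n)) x :
  (forall i j, differentiable (fun y => M y i j) x) -> differentiable M x.
Proof.
move=> dM; rewrite (_ : M = \sum_i \sum_j (fun y => M y i j *: delta_mx i j)).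
  apply: differentiable_sum => i; apply: differentiable_sum => j.
  exact: differentiableZl.
apply/funext => y; rewrite [LHS]matrix_sum_delta fct_sumE; apply: eq_bigr => i _.
by rewrite fct_sumE.
Qed.

Lemma dt_mx m n (M : R -> X -> 'M[R]_(m, n)) t x i j :
  (forall k l, st_smooth (fun t x => M t x k l)) ->
  dt M t x i j = Dt (fun t x => M t x i j) t x.
Proof.
move=> sM; rewrite /dt derive1E derive_mx; first by rewrite mxE DtE derive1E.
by apply/derivable_mxP => k l; case: (sM k l) => _ sf; exact: (@derivable_t _ _ (fun t x => M t x k l) t x sf).
Qed.

End MoreCalculus.

Section Fields.
Context (R : realType) (d : nat) (S : 'M[R]_d -> 'M[R]_d) (p : R -> R).
Context (r : R -> 'rV[R]_d -> R) (v : R -> 'rV[R]_d -> 'rV[R]_d).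
Hypotheses (HS : stress_law S) (Hp : pressure_law p).
Hypotheses (sr : st_smooth r) (sv : st_smoothv v) (r0 : forall t x, 0 < r t x).
Local Notation X := 'rV[R]_d.
Local Notation p' := (derive1 p).

Definition vc i : R -> X -> R := fun t x => v t x 0 i.
Definition lnr : R -> X -> R := fun t x => ln (r t x).
Definition om i : R -> X -> R := Dx i lnr.
Definition Sv : R -> X -> 'M[R]_d := fun t x => S (symm (gradv (v t) x)).

Lemma vc_smooth i : st_smooth (vc i). Proof. exact: sv. Qed.
Lemma lnr_smooth : st_smooth lnr. Proof. exact: st_smooth_ln. Qed.
Lemma om_smooth i : st_smooth (om i). Proof. exact: st_smooth_Dx lnr_smooth. Qed.
Local Hint Resolve vc_smooth lnr_smooth om_smooth st_smooth_Dx st_smooth_Dt : core.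

Lemma gradvE t x i j : gradv (v t) x i j = Dx j (vc i) t x.
Proof. by rewrite mxE DxE. Qed.

Lemma divvE t x : divv (v t) x = \sum_j Dx j (vc j) t x.
Proof. by apply: eq_bigr => j _; rewrite DxE. Qed.

Lemma grad_lnE t x i : grad_ln r t x 0 i = om i t x.
Proof. by rewrite mxE /om DxE. Qed.

Lemma grad_ln_comp i : (fun t x => grad_ln r t x 0 i) = om i.
Proof. by apply/funext => t; apply/funext => x; exact: grad_lnE. Qed.

Lemma om_r i t x : om i t x = (r t x)^-1 * Dx i r t x.
Proof.
have dl := is_derive1_ln (r0 t x).
have dl' : derivable (@ln R) (r t x) 1 by case: dl.
have E : derive1 (@ln R) (r t x) = (r t x)^-1 by rewrite derive1E; case: dl => _ ->.
by rewrite /om /lnr (Dx_comp i sr dl') E.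
Qed.

Lemma om_sym i j : Dx j (om i) = Dx i (om j).
Proof. exact: Dx_comm lnr_smooth. Qed.

Lemma gradv_differentiable (z : R * X) : differentiable (fun z : R * X => gradv (v z.1) z.2) z.
Proof.
apply: differentiable_mx => i j.
rewrite (_ : (fun y : R * X => gradv (v y.1) y.2 i j) = uncur (Dx j (vc i))).
  have [_ sf] := st_smooth_Dx j (vc_smooth i); exact: smooth_diff sf.
by apply/funext => y; exact: gradvE.
Qed.

Lemma gradv_x_differentiable t x : differentiable (gradv (v t)) x.
Proof.
apply: differentiable_mx => i j.
rewrite (_ : (fun y : X => gradv (v t) y i j) = Dx j (vc i) t).
  exact: smooth_diff (st_smooth_section t (st_smooth_Dx j (vc_smooth i))).
by apply/funext => y; exact: gradvE.
Qed.

(** [S] is differentiable and no more, hence so is [S(Dv)]; its derivatives need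
    not be continuous. *)
Lemma Sv_differentiable t x : differentiable (Sv t) x.
Proof.
apply: (@differentiable_comp _ _ _ _ (gradv (v t)) (fun B => S (symm B)) x).
  exact: gradv_x_differentiable.
exact: stress_diff.
Qed.

Lemma gradv_periodic t : tperiodic (gradv (v t)).
Proof.
move=> x k; apply/matrixP => i j; rewrite !gradvE.
by case: (st_smooth_Dx j (vc_smooth i)) => pf _; exact: pf.
Qed.

Lemma Sv_cont i j : st_cont (fun t x => Sv t x i j).
Proof.
split=> [t x k|z]; first by rewrite /Sv gradv_periodic.
apply: differentiable_continuous.
have dM : differentiable (fun z : R * X => Sv z.1 z.2) z.
  apply: (@differentiable_comp _ _ _ _ (fun z : R * X => gradv (v z.1) z.2) (fun B => S (symm B)) z).
    exact: gradv_differentiable.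
  exact: stress_diff.
apply: (@differentiable_comp _ _ _ _ (fun z : R * X => Sv z.1 z.2) (fun M : 'M[R]_d => M i j) z) => //.
exact: differentiable_coord.
Qed.

Lemma Sv_derivable t x i j h : derivable (fun y => Sv t y i j) x h.
Proof.
apply: diff_derivable.
apply: (@differentiable_comp _ _ _ _ (Sv t) (fun M : 'M[R]_d => M i j) x).
  exact: Sv_differentiable.
exact: differentiable_coord.
Qed.

Definition divSv t x i := \sum_j pd j (fun y => Sv t y i j) x.

Lemma divm_Sv t x i : divm (Sv t) x 0 i = divSv t x i.
Proof. by rewrite mxE. Qed.

(** The product rule, with [grad ln r = grad r / r]. *)
Lemma div_rSv t x i : (r t x)^-1 * (\sum_j pd j (fun y => (r t y *: Sv t y) i j) x) =
  divSv t x i + \sum_j Sv t x i j * om j t x.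
Proof.
rewrite mulr_sumr -big_split/=; apply: eq_bigr => j _.
have dr : derivable (r t) x (delta_mx 0 j) by case: sr => _ sf; exact: (@derivable_x _ _ r t x _ sf).
rewrite (_ : (fun y => (r t y *: Sv t y) i j) = (r t * (fun y => Sv t y i j))); last first.
  by apply/funext => y; rewrite mxE.
rewrite /pd deriveM//; last exact: Sv_derivable.
rewrite /GRing.scale/= om_r DxE /pd.
by field; rewrite gt_eqF.
Qed.

Lemma pr_derive t x : derivable p (r t x) 1.
Proof. by apply: (pressure_D1 Hp). Qed.

Lemma A1E kappa t x i : A1 kappa S p r v t x 0 i =
  (Dt (vc i) t x + \sum_j vc j t x * Dx j (vc i) t x)
  - (divSv t x i + \sum_j Sv t x i j * om j t x)
  + (r t x)^-1 * (p' (r t x) * Dx i r t x)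
  - kappa * \sum_j (Dx j (Dx i (om j)) t x + om j t x * Dx j (om i) t x).
Proof.
have dp : derivable p (r t x) 1 by exact: pr_derive.
rewrite /A1 [LHS]mxE; congr (_ + _); last first.
  rewrite mxE; congr (- _); rewrite !mxE -mulrA; congr (_ * _).
  rewrite mulr_sumr; apply: eq_bigr => j _.
  rewrite (_ : (fun y => (r t y *: gradv (grad_ln r t) y) i j) =
      (fun t x => r t x * Dx j (om i) t x) t); last first.
    by apply/funext => y; rewrite !mxE DxE -(grad_ln_comp i).
  rewrite -(DxE j (fun t x => r t x * Dx j (om i) t x)).
  rewrite (DxM j t x sr (st_smooth_Dx j (om_smooth i))).
  by rewrite (om_sym i j) om_r; field; rewrite gt_eqF.
rewrite [LHS]mxE; congr (_ + _); last first.
  by rewrite !mxE -(Dx_comp i sr dp) DxE.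
rewrite [LHS]mxE; congr (_ + _); last first.
  by rewrite mxE -div_rSv mxE; congr (- (_ * _)); rewrite mxE.
rewrite [LHS]mxE; congr (_ + _); first by rewrite dt_mx// => k l; rewrite ord1; exact: vc_smooth.
by rewrite mxE; apply: eq_bigr => j _; rewrite DxE.
Qed.

Lemma A2E t x i : A2 r v t x 0 i =
  Dt (om i) t x + (\sum_j vc j t x * Dx j (om i) t x)
  + \sum_j (om j t x * Dx i (vc j) t x + Dx j (Dx i (vc j)) t x).
Proof.
rewrite /A2 [LHS]mxE; congr (_ + _); last first.
  rewrite !mxE mulr_sumr; apply: eq_bigr => j _.
  rewrite (_ : (fun y => (r t y *: (gradv (v t) y)^T) i j) =
      (fun t x => r t x * Dx i (vc j) t x) t); last first.
    by apply/funext => y; rewrite !mxE DxE.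
  rewrite -(DxE j (fun t x => r t x * Dx i (vc j) t x)).
  rewrite (DxM j t x sr (st_smooth_Dx i (vc_smooth j))).
  by rewrite om_r; field; rewrite gt_eqF.
rewrite [LHS]mxE; congr (_ + _).
  rewrite dt_mx; first by rewrite grad_ln_comp.
  by move=> k l; rewrite ord1 grad_ln_comp; exact: om_smooth.
by rewrite mxE; apply: eq_bigr => j _; rewrite DxE -(grad_ln_comp i).
Qed.

Lemma A3E rhobar t x : 0 < rhobar -> A3 p r v rhobar t x =
  p' (r t x) / r t x * Dt r t x
  + (\sum_j vc j t x * (p' (r t x) / r t x * Dx j r t x))
  + p' (r t x) * \sum_j Dx j (vc j) t x.
Proof.
move=> rb0; have dh := derive1_pot_derive Hp rb0 (r0 t x).
have dh1 : derivable (derive1 (pot p rhobar)) (r t x) 1 by case: dh.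
have dh2 : derive1 (derive1 (pot p rhobar)) (r t x) = p' (r t x) / r t x.
  by rewrite derive1E; case: dh => _ ->.
rewrite /A3 divvE fdot_row; congr (_ + _ + _).
  by rewrite -dh2 -(Dt_comp sr dh1) DtE.
apply: eq_bigr => j _; rewrite mxE; congr (_ * _).
by rewrite -dh2 -(Dx_comp j sr dh1) DxE.
Qed.
End Fields.

(** * The pointwise inequality *)

(** The linear arithmetic behind [balance_le], over abstract scalars: the
    hypotheses are the bound for the stress and the identities for inertia,
    pressure and capillarity. *)
Lemma combine_identities (R : realFieldType) (rho kappa r a1 a2 a3 c1 c2 c3 c4 c5 c6
    P dv q1 q2 q3 q4 A3 k1 k2 k3 k4 k5 k6 k7 s1 s2 s3 : R) :
  rho * (- a1 + a2) <= rho * - a3 ->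
  rho * (- c1 - c2 + c3) = rho * (- c4 - c5) ->
  - (P * dv) - q1 + q2 = - (rho * c6) - (rho - r) * A3 - q3 - q4 ->
  kappa * (rho * (- k1 - k2 + k3)) = kappa * (rho * (k4 - k5 - k6 + k7)) ->
  - (rho * a1) - (rho * c1 + rho * c2 - rho * a2 + P * dv
     - kappa * (- (rho * k1) - rho * k2)) + (rho * c3 + kappa * (rho * k3)) - q1 + q2 <=
  - (rho * (c4 - (s1 + s2) + c6 - kappa * k4)) - kappa * (rho * k5) - (rho - r) * A3
  + (- (rho * s1 + rho * (a3 + s3)) + kappa * (rho * k7) - q4)
  + (- (rho * c5) - kappa * (rho * k6) + rho * (s3 - s2) - q3).
Proof. lra. Qed.

Section Pointwise.
Context (R : realType) (d : nat) (kappa : R) (S : 'M[R]_d -> 'M[R]_d) (p : R -> R).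
Context (r : R -> 'rV[R]_d -> R) (v : R -> 'rV[R]_d -> 'rV[R]_d).
Hypotheses (HS : stress_law S) (Hp : pressure_law p).
Hypotheses (sr : st_smooth r) (sv : st_smoothv v) (r0 : forall t x, 0 < r t x).
Local Notation X := 'rV[R]_d.
Local Notation p' := (derive1 p).
Local Notation vc := (vc v).
Local Notation om := (om r).
Let svc i : st_smooth (vc i). Proof. exact: vc_smooth. Qed.
Let som i : st_smooth (om i). Proof. exact: om_smooth. Qed.

(** The smooth field tested against the weighted gradient of the density: time
    derivative and transport of [om], the difference of [grad div v] and the
    Laplacian of [v], and stretching by [grad v]. *)
Definition Psi i : R -> X -> R := fun t x => Dt (om i) t x +
  \sum_j (Dx j (om i) t x * vc j t x
          + (Dx j (Dx i (vc j)) t x - Dx j (Dx j (vc i)) t x)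
          - om j t x * Dx j (vc i) t x).

Lemma Psi_term_smooth i j : st_smooth (fun t x => Dx j (om i) t x * vc j t x
          + (Dx j (Dx i (vc j)) t x - Dx j (Dx j (vc i)) t x)
          - om j t x * Dx j (vc i) t x).
Proof.
apply: st_smoothB; last by apply: st_smoothM => //; exact: st_smooth_Dx.
apply: st_smoothD; first by apply: st_smoothM => //; exact: st_smooth_Dx.
by apply: st_smoothB; do 2 apply: st_smooth_Dx.
Qed.

Lemma Psi_smooth i : st_smooth (Psi i).
Proof.
apply: st_smoothD; first exact: st_smooth_Dt.
by apply: st_smooth_sum => j; exact: Psi_term_smooth.
Qed.

(** The third derivatives of [v] cancel in the divergence. *)
Lemma div_Psi t x : \sum_i Dx i (Psi i) t x =
  \sum_i (Dx i (Dt (om i)) t x + \sum_j (Dx j (om i) t x * Dx i (vc j) t x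
     + vc j t x * Dx j (Dx i (om i)) t x
     - (om j t x * Dx i (Dx j (vc i)) t x + Dx j (vc i) t x * Dx i (om j) t x))).
Proof.
have sO i j : st_smooth (fun t x => Dx j (om i) t x * vc j t x).
  by apply: st_smoothM => //; exact: st_smooth_Dx.
have sQ i j : st_smooth (Dx j (Dx i (vc j))) by do 2 apply: st_smooth_Dx.
have sP i j : st_smooth (Dx j (Dx j (vc i))) by do 2 apply: st_smooth_Dx.
have sQP i j := st_smoothB (sQ i j) (sP i j).
have sD i j : st_smooth (fun t x => om j t x * Dx j (vc i) t x).
  by apply: st_smoothM => //; exact: st_smooth_Dx.
have E i j : Dx i (fun t x => Dx j (om i) t x * vc j t x
          + (Dx j (Dx i (vc j)) t x - Dx j (Dx j (vc i)) t x)
          - om j t x * Dx j (vc i) t x) t x =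
   (Dx j (om i) t x * Dx i (vc j) t x
     + vc j t x * Dx j (Dx i (om i)) t x
     - (om j t x * Dx i (Dx j (vc i)) t x + Dx j (vc i) t x * Dx i (om j) t x))
   + (Dx i (Dx j (Dx i (vc j))) t x - Dx i (Dx j (Dx j (vc i))) t x).
  rewrite (DxB i t x (st_smoothD (sO i j) (sQP i j)) (sD i j)).
  rewrite (DxD i t x (sO i j) (sQP i j)) (DxB i t x (sQ i j) (sP i j)).
  rewrite (DxM i t x (st_smooth_Dx j (som i)) (svc j)).
  rewrite (DxM i t x (som j) (st_smooth_Dx j (svc i))).
  by rewrite (Dx_comm i j (som i)); ring.
rewrite (eq_bigr (fun i => Dx i (Dt (om i)) t x + \sum_j (
   (Dx j (om i) t x * Dx i (vc j) t x
     + vc j t x * Dx j (Dx i (om i)) t x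
     - (om j t x * Dx i (Dx j (vc i)) t x + Dx j (vc i) t x * Dx i (om j) t x))
   + (Dx i (Dx j (Dx i (vc j))) t x - Dx i (Dx j (Dx j (vc i))) t x)))); last first.
  move=> i _.
  rewrite (DxD i t x (st_smooth_Dt (som i)) (st_smooth_sum (Psi_term_smooth i))).
  by rewrite (Dx_sum i t x (Psi_term_smooth i)); congr (_ + _); apply: eq_bigr => j _.
rewrite !big_split/=; congr (_ + _).
apply: (@sum_swap _ _ _ _ (fun i j => Dx i (Dx j (Dx i (vc j))) t x)) => i j.
rewrite (Dx_comm j i (st_smooth_Dx j (svc i))); ring.
Qed.

(** The factor of [rho] in the squares of the relative entropy, apart from the
    terms with [u] and [w.w]; the cross term [- rho w . om] contributes [rho div om]. *)
Definition phi1 : R -> X -> R := fun t x =>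
  2^-1 * (\sum_i vc i t x * vc i t x)
  + (kappa * (\sum_i Dx i (om i) t x) + kappa / 2 * \sum_i om i t x * om i t x).

Let sq (f : 'I_d -> R -> X -> R) (sf : forall i, st_smooth (f i)) :
  st_smooth (fun t x => \sum_i f i t x * f i t x).
Proof. by apply: st_smooth_sum => i; exact: st_smoothM. Qed.

Let sdom : st_smooth (fun t x => \sum_i Dx i (om i) t x).
Proof. by apply: st_smooth_sum => i; exact: st_smooth_Dx. Qed.

Lemma phi1_smooth : st_smooth phi1.
Proof.
by apply: st_smoothD; [|apply: st_smoothD]; (apply: st_smoothM; [exact: st_smooth_cst|]);
  [exact: sq|exact: sdom|exact: sq].
Qed.

Let scst (c : R) (f : R -> X -> R) : st_smooth f -> st_smooth (fun t x => c * f t x).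
Proof. by move=> sf; apply: st_smoothM => //; exact: st_smooth_cst. Qed.

Lemma Dt_phi1 t x : Dt phi1 t x = (\sum_i vc i t x * Dt (vc i) t x) +
  kappa * ((\sum_i Dx i (Dt (om i)) t x) + \sum_i om i t x * Dt (om i) t x).
Proof.
rewrite (DtD t x (scst _ (sq svc)) (st_smoothD (scst _ sdom) (scst _ (sq som)))).
rewrite (DtD t x (scst _ sdom) (scst _ (sq som))).
rewrite (DtZ _ t x (sq svc)) (DtZ _ t x sdom) (DtZ _ t x (sq som)).
rewrite (Dt_sum t x (fun i => st_smoothM (svc i) (svc i))).
rewrite (Dt_sum t x (fun i => st_smoothM (som i) (som i))).
rewrite (Dt_sum t x (fun i => st_smooth_Dx i (som i))).
rewrite mulrDr; congr (_ + (_ + _)).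
- by rewrite mulr_sumr; apply: eq_bigr => i _; rewrite (DtM t x (svc i) (svc i)); field.
- by congr (_ * _); apply: eq_bigr => i _; rewrite (Dt_Dx i (som i)).
- by rewrite !mulr_sumr; apply: eq_bigr => i _; rewrite (DtM t x (som i) (som i)); field.
Qed.

Lemma Dx_phi1 j t x : Dx j phi1 t x = (\sum_i vc i t x * Dx j (vc i) t x) +
  kappa * ((\sum_i Dx j (Dx i (om i)) t x) + \sum_i om i t x * Dx j (om i) t x).
Proof.
rewrite (DxD j t x (scst _ (sq svc)) (st_smoothD (scst _ sdom) (scst _ (sq som)))).
rewrite (DxD j t x (scst _ sdom) (scst _ (sq som))).
rewrite (DxZ j _ t x (sq svc)) (DxZ j _ t x sdom) (DxZ j _ t x (sq som)).
rewrite (Dx_sum j t x (fun i => st_smoothM (svc i) (svc i))).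
rewrite (Dx_sum j t x (fun i => st_smoothM (som i) (som i))).
rewrite (Dx_sum j t x (fun i => st_smooth_Dx i (som i))).
rewrite mulrDr; congr (_ + (_ + _)).
- by rewrite mulr_sumr; apply: eq_bigr => i _; rewrite (DxM j t x (svc i) (svc i)); field.
- by rewrite !mulr_sumr; apply: eq_bigr => i _; rewrite (DxM j t x (som i) (som i)); field.
Qed.

Variables (rhobar : R) (rb0 : 0 < rhobar) (t : R) (x : X).
Variables (rho : R) (u w : X) (G : 'M[R]_d).
Hypothesis rho_ge0 : 0 <= rho.
Local Notation D := (gradv (v t) x).
Local Notation SD := (Sv S v t x).
Local Notation g := (u - v t x).
Local Notation z := (w - grad_ln r t x).

Definition momentum_density : R :=
  rho * fdot u (dt v t x) + rho * fdot (outer u u) D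
  - rho * fdot (S (symm G)) D + p rho * divv (v t) x
  - kappa * (- (rho * fdot w (divm (gradv (v t)) x)) - rho * fdot (outer w w) D).

(** The rate of growth of the relative entropy: dissipation, momentum equation
    tested with [v], mass equation tested with [phi1] and with [H'(r)], whose
    derivative is [p' / r], and the time derivative of [p(r)]. *)
Definition balance_density : R :=
  - (rho * fdot (S (symm G)) (symm G)) - momentum_density
  + (rho * Dt phi1 t x + \sum_j rho * u 0 j * Dx j phi1 t x)
  - (rho * (p' (r t x) / r t x * Dt r t x)
     + \sum_j rho * u 0 j * (p' (r t x) / r t x * Dx j r t x))
  + p' (r t x) * Dt r t x.

Definition remainder_density : R :=
  - (rho * fdot g (A1 kappa S p r v t x))
  - kappa * (rho * fdot z (A2 r v t x))
  - (rho - r t x) * A3 p r v rhobar t x.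

(** The densities of the three integrations by parts; each has zero integral. *)
Definition null_stress : R :=
  rho * fdot g (divm (Sv S v t) x) + rho * fdot (G - D + outer w g) SD.
Definition null_capillary : R :=
  \sum_i (rho * w 0 i * Psi i t x + rho * Dx i (Psi i) t x).
Definition null_pressure : R :=
  \sum_j (p (r t x) * Dx j (vc j) t x + vc j t x * (p' (r t x) * Dx j r t x)).

Definition quadratic_density : R :=
  - (rho * fdot (outer g g) D) - kappa * (rho * fdot (outer z z) D)
  + rho * fdot (outer z g) SD
  - (p rho - p (r t x) - p' (r t x) * (rho - r t x)) * \sum_j D j j.

(** The inequality is [viscous_bound]; inertia, pressure and capillarity
    contribute identities. *)
Lemma balance_le : balance_density <=
  remainder_density + (- null_stress + kappa * null_capillary - null_pressure)
  + quadratic_density.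
Proof.
set V := fun i => vc i t x; set O := fun i => om i t x.
set U := fun i => u 0 i; set W := fun i => w 0 i.
pose Dv i j := Dx j (vc i) t x; pose Om i j := Dx j (om i) t x.
pose P i j := Dx j (Dx j (vc i)) t x; pose Q i j := Dx j (Dx i (vc j)) t x.
pose Wd i j := Dx j (Dx i (om i)) t x.
pose omt i := Dt (om i) t x; pose Tt i := Dx i (Dt (om i)) t x.
pose a i := Dt (vc i) t x; pose rr i := Dx i r t x.
have visc := viscous_bound G D HS.
have conv := convective_identity U V a Dv.
have pres := pressure_identity rho (p (r t x)) (p' (r t x)) (p rho) (Dt r t x) U V rr
  (fun j => Dv j j) (lt0r_neq0 (r0 t x)).
have capi := @capillary_identity R d W O U V omt Tt Dv Om P Q Wd _.
have {}capi := capi (fun i j => congr1 (fun f => f t x) (om_sym sr r0 i j)).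
have gE i : g 0 i = U i - V i by rewrite !mxE.
have zE i : z 0 i = W i - O i by rewrite mxE [(- grad_ln r t x) _ _]mxE grad_lnE.
have DE i j : D i j = Dv i j by rewrite gradvE.
have dtE : fdot u (dt v t x) = \sum_i U i * a i.
  rewrite fdot_row; apply: eq_bigr => i _; rewrite dt_mx// => k l.
  by rewrite ord1; exact: svc.
have uuE (b c : X) (B C : 'I_d -> R) (bB : forall i, b 0 i = B i) (cC : forall i, c 0 i = C i) :
   fdot (outer b c) D = \sum_i \sum_j B j * C i * Dv i j.
  rewrite fdot_outer; apply: eq_bigr => i _; apply: eq_bigr => j _.
  by rewrite bB cC DE.
have A1s : fdot g (A1 kappa S p r v t x) =
   (\sum_i (U i - V i) * (a i + \sum_j V j * Dv i j))
   - (\sum_i g 0 i * divm (Sv S v t) x 0 i + fdot (outer (grad_ln r t x) g) SD)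
   + (\sum_i (U i - V i) * ((r t x)^-1 * (p' (r t x) * rr i)))
   - kappa * (\sum_i (U i - V i) * \sum_j (Wd j i + O j * Om i j)).
  rewrite fdot_row fdot_outer mulr_sumr -big_split/= -sumrB -big_split/= -sumrB.
  apply: eq_bigr => i _; rewrite A1E// divm_Sv gE.
  rewrite (_ : \sum_j grad_ln r t x 0 j * (U i - V i) * Sv S v t x i j =
     (U i - V i) * \sum_j Sv S v t x i j * om j t x); last first.
    by rewrite mulr_sumr; apply: eq_bigr => j _; rewrite grad_lnE; ring.
  have -> : \sum_j (Dx j (Dx i (om j)) t x + om j t x * Dx j (om i) t x) =
     \sum_j (Wd j i + O j * Om i j).
    by apply: eq_bigr => j _; rewrite (Dx_comm j i (som j)).
  by rewrite /a /V /Dv /rr; ring.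
have A2s : fdot z (A2 r v t x) = \sum_i (W i - O i) * (omt i + (\sum_j V j * Om i j)
       + \sum_j (O j * Dv j i + Q i j)).
  by rewrite fdot_row; apply: eq_bigr => i _; rewrite A2E// zE.
have A3s : A3 p r v rhobar t x = p' (r t x) / r t x * Dt r t x
  + (\sum_j V j * (p' (r t x) / r t x * rr j)) + p' (r t x) * \sum_j Dv j j.
  by rewrite A3E.
have divE : divv (v t) x = \sum_j Dv j j by rewrite divvE.
have trE : \sum_j D j j = \sum_j Dv j j by apply: eq_bigr => j _; exact: DE.
have wP : fdot w (divm (gradv (v t)) x) = \sum_i W i * \sum_j P i j.
  rewrite fdot_row; apply: eq_bigr => i _; rewrite mxE; congr (_ * _).
  apply: eq_bigr => j _; rewrite /P [RHS]DxE; congr (pd j _ x).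
  by apply/funext => y; rewrite gradvE.
have ph1 : rho * Dt phi1 t x + \sum_j rho * u 0 j * Dx j phi1 t x =
   rho * (\sum_i V i * a i + \sum_j U j * \sum_i V i * Dv i j)
   + kappa * (rho * ((\sum_i Tt i) + (\sum_i O i * omt i)
     + \sum_j U j * ((\sum_i Wd i j) + \sum_i O i * Om i j))).
  rewrite Dt_phi1.
  have -> : \sum_j rho * u 0 j * Dx j phi1 t x =
    rho * (\sum_j U j * \sum_i V i * Dv i j) +
    kappa * (rho * \sum_j U j * ((\sum_i Wd i j) + \sum_i O i * Om i j)).
    rewrite !mulr_sumr -big_split/=; apply: eq_bigr => j _; rewrite Dx_phi1.
    by rewrite /U /V /Dv /Wd /O /Om; ring.
  by rewrite /V /a /Tt /O /omt; ring.
have capN : null_capillary = rho * ((\sum_i W i * (omt i + \sum_j (Om i j * V j + (Q i j - P i j) - O j * Dv i j)))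
     + \sum_i (Tt i + \sum_j (Om i j * Dv j i + V j * Wd i j
                             - (O j * Q j i + Dv i j * Om j i)))).
  rewrite /null_capillary big_split/= -mulr_sumr div_Psi mulrDr; congr (_ + _).
  by rewrite mulr_sumr; apply: eq_bigr => i _; rewrite -mulrA.
have zgS : fdot (outer z g) SD = fdot (outer w g) SD - fdot (outer (grad_ln r t x) g) SD.
  rewrite !fdot_outer -sumrB; apply: eq_bigr => i _; rewrite -sumrB; apply: eq_bigr => j _.
  by rewrite zE grad_lnE /W /O; ring.
have gdiv : fdot g (divm (Sv S v t) x) = \sum_i g 0 i * divm (Sv S v t) x 0 i by rewrite fdot_row.
rewrite /balance_density /momentum_density /remainder_density /null_stress /quadratic_density.
rewrite capN /null_pressure ph1 A1s A2s A3s divE trE wP dtE zgS gdiv.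
rewrite (uuE u u U U)// (uuE w w W W)// (uuE g g _ _ gE gE) (uuE z z _ _ zE zE).
rewrite fdotDl (fdotC (G - D)) /Sv in visc *.
have {}visc := ler_wpM2l rho_ge0 visc.
have {}conv := congr1 (fun q => rho * q) conv.
have {}capi := congr1 (fun q => kappa * (rho * q)) capi.
exact: combine_identities visc conv pres capi.
Qed.

(** The mixed product of [z] and [g] is split by Young's inequality; the factor
    [kappa^-1] restores the weight of [z] in the relative entropy. *)
Lemma quadratic_le (V BS P : R) : 0 < kappa -> 0 <= BS -> 0 <= P ->
  fnorm D <= V -> fnorm SD <= BS ->
  0 <= rel_pot p rhobar rho (r t x) ->
  `|p rho - p (r t x) - p' (r t x) * (rho - r t x)| <= P * rel_pot p rhobar rho (r t x) ->
  quadratic_density <= (2 * V + BS * (1 + kappa^-1) + d%:R * V * P) *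
    (2^-1 * (rho * fnorm g ^+ 2 + kappa * rho * fnorm z ^+ 2)
     + rel_pot p rhobar rho (r t x)).
Proof.
move=> k0 BS0 P0 DV SB H0 HP.
have V0 : 0 <= V by apply: le_trans DV; exact: fnorm_ge0.
have g0 := fnorm_ge0 g; have z0 := fnorm_ge0 z.
have /ler_normlP[q1 _] := outer_bound g g DV.
have /ler_normlP[q2 _] := outer_bound z z DV.
have /ler_normlP[_ q3] := outer_bound z g SB.
have tr := trace_bound DV.
have q4 : - ((p rho - p (r t x) - p' (r t x) * (rho - r t x)) * \sum_j D j j) <=
    d%:R * V * P * rel_pot p rhobar rho (r t x).
  apply: (le_trans (ler_norm _)); rewrite normrN normrM -[leRHS]mulrA [leRHS]mulrC.
  by rewrite ler_pM.
rewrite /quadratic_density; move: q1 q2 q3 q4 H0.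
set A := fdot _ _; set B := fdot _ _; set C := fdot _ _; set E := _ * \sum_j _.
set h := rel_pot _ _ _ _.
move: A B C E h (fnorm g) (fnorm z) g0 z0 => A B C E h a b a0 b0 q1 q2 q3 q4 H0.
have e1 := ler_wpM2l rho_ge0 q1.
have e2 := ler_wpM2l (ltW k0) (ler_wpM2l rho_ge0 q2).
have e3 := ler_wpM2l rho_ge0 q3.
have dV0 : 0 <= d%:R * V * P by rewrite !mulr_ge0.
have ab : b * a <= (a ^+ 2 + b ^+ 2) / 2.
  by have := sqr_ge0 (a - b); rewrite sqrrB ler_pdivlMr// -mulr_natr; lra.
have e4 : rho * (BS * (b * a)) <= BS / 2 * (rho * a ^+ 2 + rho * b ^+ 2).
  have -> : BS / 2 * (rho * a ^+ 2 + rho * b ^+ 2) = rho * (BS * ((a ^+ 2 + b ^+ 2) / 2)).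
    by field.
  by rewrite !ler_wpM2l.
pose Y := rho * a ^+ 2 + kappa * rho * b ^+ 2.
have Y0 : 0 <= Y.
  by rewrite addr_ge0// !mulr_ge0// ?sqr_ge0// ltW.
have e5 : rho * a ^+ 2 + rho * b ^+ 2 <= (1 + kappa^-1) * Y.
  have ki : 0 < kappa^-1 by rewrite invr_gt0.
  have -> : (1 + kappa^-1) * Y = rho * a ^+ 2 + rho * b ^+ 2 +
     (kappa * rho * b ^+ 2 + kappa^-1 * rho * a ^+ 2).
    by rewrite /Y; field; rewrite gt_eqF.
  by rewrite lerDl addr_ge0// !mulr_ge0// ?sqr_ge0// ltW.
have e6 : BS / 2 * (rho * a ^+ 2 + rho * b ^+ 2) <= BS / 2 * ((1 + kappa^-1) * Y).
  by rewrite ler_wpM2l// divr_ge0.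
have e7 : 0 <= 2 * V * h by rewrite !mulr_ge0.
have e8 : 0 <= BS * (1 + kappa^-1) * h.
  by rewrite !mulr_ge0// addr_ge0// invr_ge0 ltW.
have e9 : 0 <= d%:R * V * P * Y by rewrite mulr_ge0.
have -> : (2 * V + BS * (1 + kappa^-1) + d%:R * V * P) * (2^-1 * (rho * a ^+ 2 + kappa * rho * b ^+ 2) + h)
  = V * (rho * a ^+ 2) + kappa * (V * (rho * b ^+ 2)) + BS / 2 * ((1 + kappa^-1) * Y)
   + d%:R * V * P * Y / 2 + 2 * V * h + BS * (1 + kappa^-1) * h + d%:R * V * P * h.
  by rewrite /Y; field; rewrite gt_eqF.
have -> : V * (rho * a ^+ 2) = rho * (V * (a * a)) by ring.
have -> : kappa * (V * (rho * b ^+ 2)) = kappa * (rho * (V * (b * b))) by ring.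
lra.
Qed.
End Pointwise.

(** * The relative entropy inequality *)

Lemma telescope_le (R : realFieldType) (e e0 dis a a0 b b0 c c0 q q0 : R) : e + dis <= e0 ->
  e - a + b - c + q - (e0 - a0 + b0 - c0 + q0) <=
  - dis - (a - a0) + (b - b0) - (c - c0) + (q - q0).
Proof. lra. Qed.

Section Assembly.
Context (R : realType) (d : nat) (kappa : R) (S : 'M[R]_d -> 'M[R]_d) (p : R -> R).
Context (T rhobar : R) (rho0 : 'rV[R]_d -> R) (u0 : 'rV[R]_d -> 'rV[R]_d).
Context (rho : R -> 'rV[R]_d -> R) (u w : R -> 'rV[R]_d -> 'rV[R]_d).
Context (Gu : R -> 'rV[R]_d -> 'M[R]_d).
Context (r : R -> 'rV[R]_d -> R) (v : R -> 'rV[R]_d -> 'rV[R]_d).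
Hypotheses (HS : stress_law S) (Hp : pressure_law p) (rb0 : 0 < rhobar).
Hypothesis Hdata : initial_data rho0 u0.
Hypothesis Hreg : regular S p rhobar T rho u w Gu.
Hypothesis Hsol : weak_solution kappa S p T rho0 u0 rho u w Gu.
Hypotheses (sr : st_smooth r) (sv : st_smoothv v) (r0 : forall t x, 0 < r t x).
Hypothesis HA1 : st_integrable T (fun t x =>
  rho t x * fdot (u t x - v t x) (A1 kappa S p r v t x)).
Local Notation X := 'rV[R]_d.
Local Notation TR := (measurableTypeR R).
Local Notation mu := (@lebesgue_measure R).
Local Notation p' := (derive1 p).
Local Notation vc := (vc v).
Local Notation om := (om r).
Local Notation h := (derive1 (pot p rhobar)).
Let svc i : st_smooth (vc i). Proof. exact: vc_smooth. Qed.
Let som i : st_smooth (om i). Proof. exact: om_smooth. Qed.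

Lemma st_int_dot (f c : 'I_d -> R -> X -> R) : (forall i, st_integrable T (f i)) ->
  (forall i, st_cont (c i)) -> st_integrable T (fun t x => \sum_i f i t x * c i t x).
Proof. by move=> hf cc; apply: st_integrable_sum => i; exact: st_integrableMr. Qed.

Lemma st_int_dot2 (f c : 'I_d -> 'I_d -> R -> X -> R) :
  (forall i j, st_integrable T (f i j)) -> (forall i j, st_cont (c i j)) ->
  st_integrable T (fun t x => \sum_i \sum_j f i j t x * c i j t x).
Proof. by move=> hf cc; apply: st_integrable_sum => i; exact: st_int_dot. Qed.

Let cvc i : st_cont (vc i). Proof. exact: st_smooth_cont. Qed.
Let com i : st_cont (om i). Proof. exact: st_smooth_cont. Qed.
Let cDx (j : 'I_d) (f : R -> X -> R) : st_smooth f -> st_cont (Dx j f).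
Proof. by move=> sf; exact: st_smooth_cont (st_smooth_Dx j sf). Qed.
Let cDt (f : R -> X -> R) : st_smooth f -> st_cont (Dt f).
Proof. by move=> sf; exact: st_smooth_cont (st_smooth_Dt sf). Qed.
Let cr : st_cont r. Proof. exact: st_smooth_cont. Qed.

Let cpr : st_cont (fun t x => p (r t x)).
Proof. by apply: st_cont_comp => // t x; exact: derive_cont (pressure_derive Hp (r0 t x)). Qed.

Let cp'r : st_cont (fun t x => p' (r t x)).
Proof. by apply: st_cont_comp => // t x; exact: derive_cont (pressure_derive2 Hp (r0 t x)). Qed.

Let cVr : st_cont (fun t x => (r t x)^-1).
Proof. exact: st_smooth_cont (st_smoothV r0 sr). Qed.

Let chr : st_cont (fun t x => h (r t x)).
Proof. by apply: st_cont_comp => // t x; exact: derive_cont (derive1_pot_derive Hp rb0 (r0 t x)). Qed.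

Let cp'Vr : st_cont (fun t x => p' (r t x) / r t x).
Proof. exact: st_contM cp'r cVr. Qed.

(** The integrand is the divergence of [rho Phi], as [rho w] is the gradient of
    [rho]. *)
Lemma tint_weighted_div (Phi : 'I_d -> R -> X -> R) t : 0 <= t <= T ->
  (forall i, st_smooth (Phi i)) ->
  tint (fun x => \sum_i (rho t x * w t x 0 i * Phi i t x + rho t x * Dx i (Phi i) t x)) = 0.
Proof.
move=> tT sP.
have ha i : tintegrable (fun x => rho t x * w t x 0 i * Phi i t x).
  have := tintegrableM tT (st_smooth_cont (sP i)) (t_rw Hreg Hsol tT i).
  by under eq_fun do rewrite mulrC.
have hb i : tintegrable (fun x => rho t x * Dx i (Phi i) t x).
  exact: (t_rho_mul Hreg tT (cDx i (sP i))).
rewrite tint_sum; last by move=> i; exact: tintegrableD (ha i) (hb i).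
rewrite big1// => i _; rewrite (tintD (ha i) (hb i)).
have [pP _] := sP i.
have := reg_log_grad Hreg tT i (pP t) (st_smooth_section t (sP i)).
have -> : (fun x => rho t x * pd i (Phi i t) x) = (fun x => rho t x * Dx i (Phi i) t x).
  by apply/funext => x; rewrite DxE.
by move=> ->; rewrite addrN.
Qed.

Let sphi1 : st_smooth (phi1 kappa r v). Proof. exact: phi1_smooth. Qed.

Let pot_pressure s : 0 < s -> h s * s = pot p rhobar s + p s.
Proof.
move=> s0; rewrite derive1_potE// /pot -/(pot_slope p rhobar s).
by field; rewrite gt_eqF.
Qed.

(** The terms without [s] combine to [p(r)], by [pot_pressure]. *)
Lemma rel_pot_expand s t x :
  rel_pot p rhobar s (r t x) = pot p rhobar s + p (r t x) - s * h (r t x).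
Proof. by rewrite /rel_pot mulrBr pot_pressure//; ring. Qed.

(** The cross term [- kappa rho w . om] is replaced by [kappa rho div om], which
    is part of [phi1]. *)
Lemma rel_entropyE t : 0 <= t <= T ->
  rel_entropy kappa p r v rhobar rho u w t = energy kappa p rhobar rho u w t
  - tint (fun x => \sum_i rho t x * u t x 0 i * vc i t x)
  + tint (fun x => rho t x * phi1 kappa r v t x)
  - tint (fun x => rho t x * h (r t x)) + tint (fun x => p (r t x)).
Proof.
move=> tT; have [i1 i2 i3 i4] := reg_energy Hreg tT.
have iE : tintegrable (fun x => rho t x * fnorm (u t x) ^+ 2
                        + kappa * rho t x * fnorm (w t x) ^+ 2).
  apply: tintegrableD.
    by under eq_fun do rewrite fnorm_sqr; exact: i2.
  under eq_fun do rewrite fnorm_sqr -mulrA.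
  exact: tintegrableZ i3.
have iX := t_ru_dot Hreg Hsol tT cvc.
have iP := t_rho_mul Hreg tT (st_smooth_cont sphi1).
have iN : tintegrable (fun x => \sum_i (rho t x * w t x 0 i * om i t x
    + rho t x * Dx i (om i) t x)).
  apply: tintegrable_sum => i; apply: tintegrableD; last exact: (t_rho_mul Hreg tT (cDx i (som i))).
  have := tintegrableM tT (com i) (t_rw Hreg Hsol tT i).
  by under eq_fun do rewrite mulrC.
have iH := t_rho_mul Hreg tT chr.
have ip := st_cont_tintegrable t cpr.
have E1 : tint (fun x => rho t x * fnorm (u t x - v t x) ^+ 2
    + kappa * rho t x * fnorm (w t x - grad_ln r t x) ^+ 2) =
  tint (fun x => rho t x * fnorm (u t x) ^+ 2 + kappa * rho t x * fnorm (w t x) ^+ 2)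
  - 2 * tint (fun x => \sum_i rho t x * u t x 0 i * vc i t x)
  + 2 * tint (fun x => rho t x * phi1 kappa r v t x)
  - (2 * kappa) * tint (fun x => \sum_i (rho t x * w t x 0 i * om i t x
    + rho t x * Dx i (om i) t x)).
  rewrite -(tintZ 2 iX) -(tintZ 2 iP) -(tintZ (2 * kappa) iN).
  have j1 := tintegrableB iE (tintegrableZ 2 iX).
  have j2 := tintegrableD j1 (tintegrableZ 2 iP).
  rewrite -(tintB iE (tintegrableZ 2 iX)) -(tintD j1 (tintegrableZ 2 iP)).
  rewrite -(tintB j2 (tintegrableZ (2 * kappa) iN)).
  congr tint; apply/funext => x; rewrite !fnorm_sqr !fdot_row big_split/= -mulr_sumr.
  have -> : \sum_j (u t x - v t x) 0 j * (u t x - v t x) 0 j =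
      (\sum_j u t x 0 j * u t x 0 j) - 2 * (\sum_j u t x 0 j * vc j t x)
      + \sum_j vc j t x * vc j t x.
    rewrite mulr_sumr -sumrB -big_split/=; apply: eq_bigr => j _.
    by rewrite mxE [(- _ : X) _ _]mxE /vc; ring.
  have -> : \sum_j (w t x - grad_ln r t x) 0 j * (w t x - grad_ln r t x) 0 j =
      (\sum_j w t x 0 j * w t x 0 j) - 2 * (\sum_j w t x 0 j * om j t x)
      + \sum_j om j t x * om j t x.
    rewrite mulr_sumr -sumrB -big_split/=; apply: eq_bigr => j _.
    by rewrite mxE [(- _ : X) _ _]mxE grad_lnE; ring.
  have -> : \sum_i rho t x * u t x 0 i * vc i t x = rho t x * \sum_i u t x 0 i * vc i t x.
    by rewrite mulr_sumr; apply: eq_bigr => i _; rewrite mulrA.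
  have -> : \sum_i rho t x * w t x 0 i * om i t x = rho t x * \sum_i w t x 0 i * om i t x.
    by rewrite mulr_sumr; apply: eq_bigr => i _; rewrite mulrA.
  by rewrite /phi1; field.
have E2 : tint (fun x => rel_pot p rhobar (rho t x) (r t x)) =
  tint (fun x => pot p rhobar (rho t x)) + tint (fun x => p (r t x))
  - tint (fun x => rho t x * h (r t x)).
  rewrite -(tintD i4 ip) -(tintB (tintegrableD i4 ip) iH).
  by congr tint; apply/funext => x; exact: rel_pot_expand.
rewrite /rel_entropy /energy E1 E2 (tint_weighted_div tT som).
by field.
Qed.

(** The right side of the weak momentum equation for the test field [v]. *)
Definition momentum_rate t : R :=
  tint (fun x => rho t x * fdot (u t x) (dt v t x))
  + tint (fun x => rho t x * fdot (outer (u t x) (u t x)) (gradv (v t) x))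
  - tint (fun x => rho t x * fdot (S (symm (Gu t x))) (gradv (v t) x))
  + tint (fun x => p (rho t x) * divv (v t) x)
  - kappa * hess_log_pairing (rho t) (w t) (gradv (v t)).

Lemma momentum_eq t : 0 <= t <= T ->
  tint (fun x => \sum_i rho t x * u t x 0 i * vc i t x)
  - tint (fun x => \sum_i rho 0 x * u 0 x 0 i * vc i 0 x) = time_int t momentum_rate.
Proof.
move=> tT; have T0 : 0 <= T by case/andP: tT; exact: le_trans.
rewrite -(init_momentum Hdata Hreg Hsol T0 cvc) -(sol_momentum Hsol sv tT).
congr (_ - _); congr tint; apply/funext => x; rewrite fdot_row//.
by rewrite mulr_sumr; apply: eq_bigr => i _; rewrite mulrA.
Qed.

Lemma slice_momentum : slice T momentum_rate (fun t x =>
  momentum_density kappa S p v t x (rho t x) (u t x) (w t x) (Gu t x)).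
Proof.
have cD (i j : 'I_d) : st_cont (Dx j (vc i)) by exact: (cDx j (svc i)).
have hA : st_integrable T (fun t x => rho t x * fdot (u t x) (dt v t x)).
  have cv i : st_cont (Dt (vc i)) by exact: (cDt (svc i)).
  apply: st_integrable_ext (st_int_dot (st_ru Hreg Hsol) cv) _ => t x.
  rewrite fdot_row mulr_sumr; apply: eq_bigr => i _; rewrite -mulrA dt_mx// => k l.
  by rewrite ord1; exact: svc.
have hO (a : R -> X -> X) : (forall i j, st_integrable T (fun t x => rho t x * (a t x 0 j * a t x 0 i))) ->
    st_integrable T (fun t x => rho t x * fdot (outer (a t x) (a t x)) (gradv (v t) x)).
  move=> ha; apply: st_integrable_ext (st_int_dot2 ha cD) _ => t x.
  rewrite fdot_outer mulr_sumr; apply: eq_bigr => i _; rewrite mulr_sumr.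
  by apply: eq_bigr => j _; rewrite gradvE; ring.
have hC : st_integrable T (fun t x => rho t x * fdot (S (symm (Gu t x))) (gradv (v t) x)).
  apply: st_integrable_ext (st_int_dot2 (reg_stress Hreg) cD) _ => t x.
  rewrite /fdot mulr_sumr; apply: eq_bigr => i _; rewrite mulr_sumr.
  by apply: eq_bigr => j _; rewrite gradvE; ring.
have hP : st_integrable T (fun t x => p (rho t x) * divv (v t) x).
  have cdiv : st_cont (fun t x => \sum_j Dx j (vc j) t x) by apply: st_cont_sum => j.
  apply: st_integrable_ext (st_integrableMr cdiv (reg_pressure Hreg)) _ => t x.
  by rewrite divvE.
have hH : st_integrable T (fun t x => rho t x * fdot (w t x) (divm (gradv (v t)) x)).
  have cDD i : st_cont (fun t x => \sum_j Dx j (Dx j (vc i)) t x).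
    by apply: st_cont_sum => j; exact: (cDx j (st_smooth_Dx j (svc i))).
  apply: st_integrable_ext (st_int_dot (st_rw Hreg Hsol) cDD) _ => t x.
  rewrite fdot_row mulr_sumr; apply: eq_bigr => i _; rewrite -mulrA mxE; congr (_ * (_ * _)).
  apply: eq_bigr => j _; rewrite [LHS]DxE; congr (pd j _ x).
  by apply/funext => y; rewrite gradvE.
have sA := slice_tint hA; have sB := slice_tint (hO u (st_ruu Hreg Hsol)).
have sC := slice_tint hC; have sP := slice_tint hP; have sH := slice_tint hH.
have sW := slice_tint (hO w (st_rww Hreg Hsol)).
exact: sliceB (sliceD (sliceB (sliceD sA sB) sC) sP) (sliceZ kappa (sliceB (sliceN sH) sW)).
Qed.

Definition mass_rate (f : R -> X -> R) (g : 'I_d -> R -> X -> R) t : R :=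
  tint (fun x => rho t x * f t x + \sum_j rho t x * u t x 0 j * g j t x).

Lemma slice_mass f g : st_cont f -> (forall j, st_cont (g j)) ->
  slice T (mass_rate f g)
    (fun t x => rho t x * f t x + \sum_j rho t x * u t x 0 j * g j t x).
Proof.
move=> cf cg; apply: slice_tint; apply: st_integrableD.
  exact: st_integrableMr cf (st_rho Hreg).
exact: st_int_dot (st_ru Hreg Hsol) cg.
Qed.

Definition balance_rate t : R :=
  - tint (fun x => rho t x * fdot (S (symm (Gu t x))) (symm (Gu t x)))
  - momentum_rate t
  + mass_rate (Dt (phi1 kappa r v)) (fun j => Dx j (phi1 kappa r v)) t
  - mass_rate (fun t x => p' (r t x) / r t x * Dt r t x)
      (fun j t x => p' (r t x) / r t x * Dx j r t x) t
  + tint (fun x => p' (r t x) * Dt r t x).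

Let chD : st_cont (fun t x => p' (r t x) / r t x * Dt r t x).
Proof. exact: st_contM cp'Vr (cDt sr). Qed.
Let chx j : st_cont (fun t x => p' (r t x) / r t x * Dx j r t x).
Proof. exact: st_contM cp'Vr (cDx j sr). Qed.
Let cpD : st_cont (fun t x => p' (r t x) * Dt r t x).
Proof. exact: st_contM cp'r (cDt sr). Qed.

Lemma slice_balance : slice T balance_rate (fun t x =>
  balance_density kappa S p r v t x (rho t x) (u t x) (w t x) (Gu t x)).
Proof.
have s1 := slice_tint (reg_dissipation Hreg).
have s2 := slice_mass (cDt sphi1) (fun j => cDx j sphi1).
have s3 := slice_mass chD chx.
have s4 := slice_tint (st_cont_integrable T cpD).
exact: sliceD (sliceB (sliceD (sliceB (sliceN s1) slice_momentum) s2) s3) s4.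
Qed.

(** [A1] without the divergence of [S(Dv)], the only part that need not be
    continuous. *)
Let B1 i : R -> X -> R := fun t x =>
  (Dt (vc i) t x + \sum_j vc j t x * Dx j (vc i) t x)
  - \sum_j Sv S v t x i j * om j t x
  + (r t x)^-1 * (p' (r t x) * Dx i r t x)
  - kappa * \sum_j (Dx j (Dx i (om j)) t x + om j t x * Dx j (om i) t x).

Let cSv i j : st_cont (fun t x => Sv S v t x i j).
Proof. exact: Sv_cont. Qed.

Let cB1 i : st_cont (B1 i).
Proof.
have h1 : st_cont (fun t x => \sum_j vc j t x * Dx j (vc i) t x).
  by apply: st_cont_sum => j; exact: st_contM (cvc j) (cDx j (svc i)).
have h2 : st_cont (fun t x => \sum_j Sv S v t x i j * om j t x).
  by apply: st_cont_sum => j; exact: st_contM (cSv i j) (com j).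
have h3 : st_cont (fun t x => \sum_j (Dx j (Dx i (om j)) t x + om j t x * Dx j (om i) t x)).
  apply: st_cont_sum => j; apply: st_contD; first exact: (cDx j (st_smooth_Dx i (som j))).
  exact: st_contM (com j) (cDx j (som i)).
have h4 := st_contM cVr (st_contM cp'r (cDx i sr)).
have h5 := st_contM (st_cont_cst d (- kappa)) h3.
have := st_contD (st_contD (st_contD (st_contD (cDt (svc i)) h1) (st_contN h2)) h4) h5.
by congr st_cont; apply/funext => t; apply/funext => x; rewrite mulNr.
Qed.

Let A1B t x i : A1 kappa S p r v t x 0 i = B1 i t x - divm (Sv S v t) x 0 i.
Proof. by rewrite (A1E HS Hp sr sv r0) divm_Sv /B1; ring. Qed.

Lemma st_int_g (c : 'I_d -> R -> X -> R) : (forall i, st_cont (c i)) ->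
  st_integrable T (fun t x => \sum_i rho t x * ((u t x - v t x) 0 i * c i t x)).
Proof.
move=> cc; have h1 := st_int_dot (st_ru Hreg Hsol) cc.
have cvcc : st_cont (fun t x => \sum_i vc i t x * c i t x).
  by apply: st_cont_sum => i; exact: st_contM.
have h2 := st_integrableMr cvcc (st_rho Hreg).
apply: st_integrable_ext (st_integrableD h1 (st_integrableN h2)) _ => t x.
rewrite mulr_sumr -sumrB; apply: eq_bigr => i _.
by rewrite mxE [(- _ : X) _ _]mxE /vc; ring.
Qed.

(** The divergence of [S(Dv)] inherits integrability from [A1]. *)
Lemma st_int_div : st_integrable T (fun t x =>
  rho t x * fdot (u t x - v t x) (divm (Sv S v t) x)).
Proof.
apply: st_integrable_ext (st_integrableD (st_int_g cB1) (st_integrableN HA1)) _ => t x.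
rewrite !fdot_row !mulr_sumr -sumrB; apply: eq_bigr => i _.
by rewrite A1B; ring.
Qed.

Lemma st_int_stress : st_integrable T (fun t x =>
  rho t x * fdot (Gu t x - gradv (v t) x + outer (w t x) (u t x - v t x)) (Sv S v t x)).
Proof.
have h1 := st_int_dot2 (fun i j => st_integrableD (reg_Gu Hreg i j) (st_rwu Hreg Hsol i j)) cSv.
have c2 (j : 'I_d) : st_cont (fun t x => \sum_i vc i t x * Sv S v t x i j).
  by apply: st_cont_sum => i; exact: st_contM.
have h2 := st_int_dot (st_rw Hreg Hsol) c2.
have c3 : st_cont (fun t x => \sum_i \sum_j Dx j (vc i) t x * Sv S v t x i j).
  by apply: st_cont_sum => i; apply: st_cont_sum => j; exact: st_contM (cDx j (svc i)) (cSv i j).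
have h3 := st_integrableMr c3 (st_rho Hreg).
apply: st_integrable_ext (st_integrableD (st_integrableD h1 (st_integrableN h2)) (st_integrableN h3)) _ => t x.
rewrite fdotDl fdot_outer /fdot.
have -> : \sum_i rho t x * w t x 0 i * (\sum_i0 vc i0 t x * Sv S v t x i0 i) =
  \sum_i \sum_j rho t x * w t x 0 j * (vc i t x * Sv S v t x i j).
  by rewrite exchange_big/=; apply: eq_bigr => j _; rewrite mulr_sumr.
rewrite mulrDr !mulr_sumr -sumrB -sumrB -big_split/=; apply: eq_bigr => i _.
rewrite !mulr_sumr -sumrB -sumrB -big_split/=; apply: eq_bigr => j _.
by rewrite [(Gu t x - _) _ _]mxE [(- gradv _ _) _ _]mxE gradvE [(u t x - _) _ _]mxE [(- v _ _) _ _]mxE /vc; ring.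
Qed.

(** The weighted gradient of [u - v] exists at almost every time; there it is
    tested with [S(Dv)]. *)
Lemma slice_null_stress : slice T (fun=> 0) (fun t x =>
  null_stress S v t x (rho t x) (u t x) (w t x) (Gu t x)).
Proof.
apply: slice_null; first exact: st_integrableD st_int_div st_int_stress.
apply: aeS (aeI (reg_grad Hreg) (aeI (st_integrable_ae st_int_div) (st_integrable_ae st_int_stress))).
move=> t [hg [{}h1 {}h2]] tT; rewrite (tintD (h1 tT) (h2 tT)).
have pv : tperiodic (v t) by move=> x j; apply/rowP => i; case: (svc i) => pf _; exact: pf.
have pS : tperiodic (Sv S v t) by move=> x j; rewrite /Sv (gradv_periodic sv).
have sv' i : smooth (fun x => v t x 0 i) := st_smooth_section t (svc i).
have := hg tT (v t) pv sv' (Sv S v t) pS (Sv_differentiable HS sv t) (h1 tT).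
by move=> ->; rewrite addNr.
Qed.

Lemma slice_null_capillary : slice T (fun=> 0) (fun t x =>
  null_capillary r v t x (rho t x) (w t x)).
Proof.
have sPsi i : st_smooth (Psi r v i) by exact: Psi_smooth.
apply: slice_null.
  apply: st_integrable_sum => i; apply: st_integrableD.
    exact: st_integrableMr (st_smooth_cont (sPsi i)) (st_rw Hreg Hsol i).
  exact: st_integrableMr (cDx i (sPsi i)) (st_rho Hreg).
have FF := ae_filter_ringOfSetsType mu.
by apply: (@filterE _ _ FF) => t tT; exact: tint_weighted_div tT sPsi.
Qed.

Lemma slice_null_pressure : slice T (fun=> 0) (fun t x => null_pressure p r v t x).
Proof.
have cf j : st_cont (fun t x => p (r t x) * Dx j (vc j) t x + vc j t x * (p' (r t x) * Dx j r t x)).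
  apply: st_contD; first exact: st_contM cpr (cDx j (svc j)).
  exact: st_contM (cvc j) (st_contM cp'r (cDx j sr)).
have cN : st_cont (fun t x => null_pressure p r v t x) by exact: st_cont_sum cf.
apply: slice_null; first exact: st_cont_integrable.
have FF := ae_filter_ringOfSetsType mu; apply: (@filterE _ _ FF) => t tT.
have t0 : 0 <= t by case/andP: tT.
rewrite tint_sum; last by move=> j; exact: st_cont_tintegrable t (cf j).
rewrite big1// => j _.
have dp (s : R) x : derivable p (r s x) 1 by exact: pr_derive.
have dpr s x : derivable (fun y => p (r s y)) x (delta_mx 0 j).
  apply: diff_derivable.
  exact: (derive_chain 0 (smooth_diff x (st_smooth_section s sr)) (dp s x)).1.
have dv s x : derivable (vc j s) x (delta_mx 0 j).
  by case: (svc j) => _ sf; exact: (@derivable_x _ _ (vc j) s x _ sf).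
have E : Dx j (fun t x => p (r t x) * vc j t x) =
    (fun t x => p (r t x) * Dx j (vc j) t x + vc j t x * (p' (r t x) * Dx j r t x)).
  apply/funext => s; apply/funext => x; rewrite -(Dx_comp j sr (dp s x)) !DxE.
  exact: (deriveM (dpr s x) (dv s x)).
rewrite -[LHS](congr1 (fun F => tint (F t)) E).
have cp : st_cont (fun t x => p (r t x) * vc j t x) by exact: st_contM.
apply: tint_Dx_eq0 => //.
- by move=> x; exact: (derivableM (dpr t x) (dv t x)).
- by case: cp.
- by rewrite E; exact: cf.
Qed.

Let cA2 i : st_cont (fun t x => A2 r v t x 0 i).
Proof.
have -> : (fun t x => A2 r v t x 0 i) = (fun t x =>
  Dt (om i) t x + (\sum_j vc j t x * Dx j (om i) t x)
  + \sum_j (om j t x * Dx i (vc j) t x + Dx j (Dx i (vc j)) t x)).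
  by apply/funext => t; apply/funext => x; exact: A2E.
apply: st_contD.
  apply: st_contD; first exact: (cDt (som i)).
  by apply: st_cont_sum => j; exact: st_contM (cvc j) (cDx j (som i)).
apply: st_cont_sum => j; apply: st_contD; first exact: st_contM (com j) (cDx i (svc j)).
exact: (cDx j (st_smooth_Dx i (svc j))).
Qed.

Let cA3 : st_cont (fun t x => A3 p r v rhobar t x).
Proof.
have -> : (fun t x => A3 p r v rhobar t x) = (fun t x =>
  p' (r t x) / r t x * Dt r t x
  + (\sum_j vc j t x * (p' (r t x) / r t x * Dx j r t x))
  + p' (r t x) * \sum_j Dx j (vc j) t x).
  by apply/funext => t; apply/funext => x; exact: A3E.
apply: st_contD.
  apply: st_contD; first exact: chD.
  by apply: st_cont_sum => j; exact: st_contM (cvc j) (chx j).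
by apply: st_contM cp'r _; apply: st_cont_sum => j; exact: (cDx j (svc j)).
Qed.

Lemma slice_remainder : slice T (remainder kappa S p r v rhobar rho u w)
  (fun t x => remainder_density kappa S p r v rhobar t x (rho t x) (u t x) (w t x)).
Proof.
have h2 : st_integrable T (fun t x => rho t x * fdot (w t x - grad_ln r t x) (A2 r v t x)).
  have h1 := st_int_dot (st_rw Hreg Hsol) cA2.
  have cc : st_cont (fun t x => \sum_i om i t x * A2 r v t x 0 i).
    by apply: st_cont_sum => i; exact: st_contM (com i) (cA2 i).
  apply: st_integrable_ext (st_integrableD h1 (st_integrableN (st_integrableMr cc (st_rho Hreg)))) _ => t x.
  rewrite fdot_row !mulr_sumr -sumrB; apply: eq_bigr => i _.
  by rewrite [(w t x - _) _ _]mxE [(- grad_ln _ _ _) _ _]mxE grad_lnE; ring.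
have h3 : st_integrable T (fun t x => (rho t x - r t x) * A3 p r v rhobar t x).
  apply: st_integrableMr cA3 _.
  exact: st_integrableD (st_rho Hreg) (st_integrableN (st_cont_integrable T cr)).
exact: sliceB (sliceB (sliceN (slice_tint HA1)) (sliceZ kappa (slice_tint h2))) (slice_tint h3).
Qed.

Definition entropy_density t x : R :=
  2^-1 * (rho t x * fnorm (u t x - v t x) ^+ 2
          + kappa * rho t x * fnorm (w t x - grad_ln r t x) ^+ 2)
  + rel_pot p rhobar (rho t x) (r t x).

Lemma slice_entropy :
  slice T (rel_entropy kappa p r v rhobar rho u w) entropy_density.
Proof.
have [i1 i2 i3 i4] := reg_st_energy Hreg.
have hsq (a : R -> X -> X) (b : R -> X -> X) : (forall i, st_cont (fun t x => b t x 0 i)) ->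
    (forall i, st_integrable T (fun t x => rho t x * a t x 0 i)) ->
    st_integrable T (fun t x => rho t x * fdot (a t x) (a t x)) ->
    st_integrable T (fun t x => rho t x * fnorm (a t x - b t x) ^+ 2).
  move=> cb ha haa.
  have h1 := st_integrableZ (-2) (st_int_dot ha cb).
  have cbb : st_cont (fun t x => \sum_i b t x 0 i * b t x 0 i).
    by apply: st_cont_sum => i; exact: st_contM.
  have h2 := st_integrableMr cbb i1.
  apply: st_integrable_ext (st_integrableD (st_integrableD haa h1) h2) _ => t x.
  rewrite fnorm_sqr !fdot_row !mulr_sumr -!big_split/=; apply: eq_bigr => i _.
  by rewrite [(a t x - _) _ _]mxE [(- b _ _) _ _]mxE; ring.
have h1 := hsq u v cvc (st_ru Hreg Hsol) i2.
have cg i : st_cont (fun t x => grad_ln r t x 0 i) by rewrite grad_ln_comp.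
have h2 := hsq w (grad_ln r) cg (st_rw Hreg Hsol) i3.
have h3 : st_integrable T (fun t x => rho t x * fnorm (u t x - v t x) ^+ 2
          + kappa * rho t x * fnorm (w t x - grad_ln r t x) ^+ 2).
  apply: st_integrableD h1 _.
  by apply: st_integrable_ext (st_integrableZ kappa h2) _ => t x; rewrite mulrA.
have h4 : st_integrable T (fun t x => rel_pot p rhobar (rho t x) (r t x)).
  have := st_integrableD (st_integrableD i4 (st_cont_integrable T cpr))
    (st_integrableN (st_integrableMr chr i1)).
  by move/st_integrable_ext; apply => t x; rewrite rel_pot_expand.
exact: sliceD (sliceZ 2^-1 (slice_tint h3)) (slice_tint h4).
Qed.

Section Bounds.
Variables m M V BS P : R.
Hypotheses (T0 : 0 <= T) (kappa0 : 0 < kappa) (m0 : 0 < m) (BS0 : 0 <= BS) (P0 : 0 <= P).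
Hypothesis rmM : forall t x, 0 <= t <= T -> m <= r t x <= M.
Hypothesis DV : forall t x, 0 <= t <= T -> fnorm (gradv (v t) x) <= V.
Hypothesis SB : forall t x, 0 <= t <= T -> fnorm (Sv S v t x) <= BS.
Hypothesis HP : forall s q, m <= q <= M -> 0 <= s -> 0 <= rel_pot p rhobar s q /\
  `|p s - p q - p' q * (s - q)| <= P * rel_pot p rhobar s q.
Hypothesis HE : energy_inequality kappa S p rhobar T rho u w Gu.
Let K := 2 * V + BS * (1 + kappa^-1) + d%:R * V * P.
Local Notation Erel := (rel_entropy kappa p r v rhobar rho u w).
Local Notation rem := (remainder kappa S p r v rhobar rho u w).

Lemma balance_rate_le :
  {ae mu, forall t, 0 <= t <= T -> balance_rate t <= rem t + K * Erel t}.
Proof.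
have s1 := sliceB (sliceD (sliceN slice_null_stress) (sliceZ kappa slice_null_capillary))
  slice_null_pressure.
have s2 := sliceD (sliceD slice_remainder s1) (sliceZ K slice_entropy).
have E t : rem t + (- 0 + kappa * 0 - 0) + K * Erel t = rem t + K * Erel t.
  by rewrite mulr0 !oppr0 !addr0.
have s3 := slice_ext s2 E (fun _ _ => erefl).
apply: slice_mono slice_balance s3 _ => t x tT.
apply: le_trans (balance_le kappa HS Hp sr sv r0 rb0 t x _ _ _ (rho_ge0 Hsol t x)) _.
rewrite lerD2l.
have [q1 q2] := HP (rmM x tT) (rho_ge0 Hsol t x).
have q := quadratic_le (u t x) (w t x) (rho_ge0 Hsol t x) kappa0 BS0 P0 (DV x tT) (SB x tT) q1 q2.
exact: q.
Qed.

(** The expansion [rel_entropyE] at times [t] and 0, the energy inequality, and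
    the three weak equations add up. *)
Lemma rel_entropy_growth t : 0 <= t <= T ->
  Erel t - Erel 0 <= time_int t balance_rate.
Proof.
move=> tT; have t00 : 0 <= (0 : R) <= T by rewrite lexx.
have t0 : 0 <= t by case/andP: tT.
have mM : m <= M by case/andP: (rmM 0 t00) => [/le_trans]; apply.
have [L L0 hL] := pressure_quot_lipschitz Hp m0 (ler_wpDr (@ler01 R) mM).
have E1 := momentum_eq tT.
have E2 := mass_eq Hdata Hreg Hsol sphi1 tT.
(* [M + 1] instead of [M], since the approximation needs a proper interval *)
have mM1 : m < M + 1 by rewrite (le_lt_trans mM)// ltrDl.
have rmM1 s x : 0 <= s <= T -> m <= r s x <= M + 1.
  by move=> /(rmM x)/andP[-> /le_trans-> //]; rewrite lerDl.
have ch' s : 0 < s -> {for s, continuous (fun s => p' s / s)}.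
  move=> s0; apply: cvgM; first exact: derive_cont (pressure_derive2 Hp s0).
  by apply: cvgV; [rewrite gt_eqF|exact: cvg_id].
have E3 := @mass_eq_comp R d kappa S p T rhobar rho0 u0 rho u w Gu Hdata Hreg Hsol
  r h (fun s => p' s / s) m (M + 1) L t sr r0 m0 mM1 rmM1
  (fun s s0 => derive1_pot_derive Hp rb0 s0) ch' L0 hL tT.
have E4 : tint (fun x => p (r t x)) - tint (fun x => p (r 0 x)) =
    time_int t (fun s => tint (fun x => p' (r s x) * Dt r s x)).
  have dp s x : derivable p (r s x) 1 by exact: pr_derive.
  have E : Dt (fun s x => p (r s x)) = (fun s x => p' (r s x) * Dt r s x).
    by apply/funext => s; apply/funext => x; rewrite (Dt_comp sr (dp s x)).
  have dpr s x : derivable (fun s => p (r s x)) s 1.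
    apply/derivable1_diffP.
    have dr : differentiable (fun s => r s x) s.
      by apply/derivable1_diffP; case: sr => _ sf; exact: (@derivable_t _ _ r s x sf).
    exact: (@derive_chain R R p (fun s => r s x) s 1 dr (dp s x)).1.
  have cpE : st_cont (Dt (fun s x => p (r s x))) by rewrite E.
  have := tint_FTC t0 cpr cpE dpr.
  by rewrite E.
have HEt := HE tT.
have [_ i1 _] := slice_tint (reg_dissipation Hreg).
have [_ i2 _] := slice_momentum.
have [_ i3 _] := slice_mass (cDt sphi1) (fun j => cDx j sphi1).
have [_ i4 _] := slice_mass chD chx.
have [_ i5 _] := slice_tint (st_cont_integrable T cpD).
rewrite (time_int5 (i1 t tT) (i2 t tT) (i3 t tT) (i4 t tT) (i5 t tT)).
rewrite !rel_entropyE// -E1 -E4 /mass_rate -E2 -E3.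
exact: telescope_le HEt.
Qed.

Lemma rel_entropy_bound t : 0 <= t <= T ->
  Erel t <= Erel 0 * expR (K * t) + time_int t (fun s => rem s * expR (K * (t - s))).
Proof.
have TT : 0 <= T <= T by rewrite T0 lexx.
have [_ iE _] := slice_entropy; have [_ iR _] := slice_remainder.
have [_ iB _] := slice_balance.
have V0 : 0 <= V by apply: le_trans (DV 0 (introT andP (conj (lexx 0) T0))); exact: fnorm_ge0.
have K0 : 0 <= K.
  by rewrite /K !addr_ge0// !mulr_ge0// addr_ge0// invr_ge0 ltW.
apply: (gronwall K0 (iE T TT) (iR T TT)) => s sT.
rewrite -lerBlDl; apply: le_trans (rel_entropy_growth sT) _.
have ms : measurable (`[0, s]%classic : set TR) by exact: measurable_itv.
have H : {ae mu, forall q, `[0, s]%classic q -> balance_rate q <= rem q + K * Erel q}.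
  apply: aeS balance_rate_le => q H; rewrite /= in_itv/= => /andP[q0 qs].
  by apply: H; rewrite q0 (le_trans qs)//; case/andP: sT.
exact: (ae_le_Rintegral ms (iB s sT) (rintD ms (iR s sT) (rintZ ms K (iE s sT))) H).
Qed.
End Bounds.
End Assembly.

(** * The constant *)

Lemma st_range_bounds (R : realType) (d : nat) (T : R) (f : R -> 'rV[R]_d -> R) B :
  (forall t x, 0 <= t <= T -> `|f t x| <= B) ->
  forall t x, 0 <= t <= T -> inf (st_range T f) <= f t x <= sup (st_range T f).
Proof.
move=> fB t x tT; have fin : st_range T f (f t x) by exists (t, x).
apply/andP; split.
  apply: ge_inf fin; exists (- B) => _ [[s y] /= sT <-].
  by have := fB s y sT; rewrite ler_norml => /andP[].
apply: ub_le_sup fin; exists B => _ [[s y] /= sT <-].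
by apply: le_trans (fB s y sT); exact: ler_norm.
Qed.

Lemma inf_st_range_gt0 (R : realType) (d : nat) (T : R) (f : R -> 'rV[R]_d -> R) :
  0 <= T -> st_cont f -> (forall t x, 0 < f t x) -> 0 < inf (st_range T f).
Proof.
move=> T0 cf f0; have [z zT hz] := st_cont_min T0 cf.
apply: lt_le_trans (f0 z.1 z.2) _; apply: lb_le_inf.
  by exists (f 0 0), (0, 0) => //=; rewrite lexx.
by move=> _ [[s y] /= sT <-]; exact: hz.
Qed.

(** The square of the norm is continuous on space-time. *)
Lemma fnorm_gradv_bounded (R : realType) (d : nat) (T : R) (v : R -> 'rV[R]_d -> 'rV[R]_d) :
  st_smoothv v -> exists B, forall t x, 0 <= t <= T -> `|fnorm (gradv (v t) x)| <= B.
Proof.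
move=> sv.
have cD (i j : 'I_d) : st_cont (Dx j (vc v i)) := st_smooth_cont (st_smooth_Dx j (sv i)).
have cF : st_cont (fun t x => \sum_i \sum_j Dx j (vc v i) t x * Dx j (vc v i) t x).
  by apply: st_cont_sum => i; apply: st_cont_sum => j; exact: st_contM.
have [B B0 hB] := st_cont_bounded T cF.
exists (Num.sqrt B) => t x tT; rewrite ger0_norm ?fnorm_ge0//.
rewrite /fnorm ler_sqrt//; apply: le_trans (hB t x tT).
rewrite (_ : fdot _ _ = \sum_i \sum_j Dx j (vc v i) t x * Dx j (vc v i) t x) ?ler_norm//.
by apply: eq_bigr => i _; apply: eq_bigr => j _; rewrite gradvE.
Qed.

Theorem corollary2p3 (R : realType) (d : nat) (kappa : R)
    (S : 'M[R]_d -> 'M[R]_d) (p : R -> R) :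
  d = 2%N \/ d = 3%N -> 0 < kappa -> stress_law S -> pressure_law p ->
  exists C : R -> R -> R -> R,
  forall (T rhobar : R) (rho0 : 'rV[R]_d -> R) (u0 : 'rV[R]_d -> 'rV[R]_d)
    (rho : R -> 'rV[R]_d -> R) (u w : R -> 'rV[R]_d -> 'rV[R]_d)
    (Gu : R -> 'rV[R]_d -> 'M[R]_d),
  0 < T -> 0 < rhobar ->
  initial_data rho0 u0 ->
  regular S p rhobar T rho u w Gu ->
  weak_solution kappa S p T rho0 u0 rho u w Gu ->
  energy_inequality kappa S p rhobar T rho u w Gu ->
  forall (r : R -> 'rV[R]_d -> R) (v : R -> 'rV[R]_d -> 'rV[R]_d),
  st_smooth r -> st_smoothv v -> (forall t x, 0 < r t x) ->
  st_integrable T (fun t x =>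
    rho t x * fdot (u t x - v t x) (A1 kappa S p r v t x)) ->
  let K := C (inf (st_range T r)) (sup (st_range T r))
             (sup (st_range T (fun t x => fnorm (gradv (v t) x)))) in
  forall t, 0 <= t <= T ->
    rel_entropy kappa p r v rhobar rho u w t
    <= rel_entropy kappa p r v rhobar rho u w 0 * expR (K * t)
       + time_int t (fun s =>
           remainder kappa S p r v rhobar rho u w s * expR (K * (t - s))).
Proof.
move=> _ kappa0 HS Hp.
have [q [C0 [c [c1 [q1 C00 _ _ [hS _]]]]]] := stress_growth HS.
(* the constant of [rel_pressure_le] as a function of the range of [r]; ranges
   that are not compact intervals of positive numbers do not occur below *)
have hP z : exists P : R, 0 <= P /\
    (0 < z.1 -> z.1 <= z.2 -> forall rhobar r s : R, 0 < rhobar -> z.1 <= r <= z.2 -> 0 <= s ->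
    0 <= rel_pot p rhobar s r /\
    `|p s - p r - derive1 p r * (s - r)| <= P * rel_pot p rhobar s r).
  case: z => m M /=.
  case: (ltP 0 m) => [m0|m0]; last by exists 0.
  case: (leP m M) => [mM|Mm]; last by exists 0.
  by have [P P0 hP] := rel_pressure_le Hp m0 mM; exists P.
have [Pf hPf] := choice hP.
exists (fun m M V => 2 * V + (C0 * V `^ (q - 1)) * (1 + kappa^-1) + d%:R * V * Pf (m, M)).
move=> T rhobar rho0 u0 rho u w Gu T0 rb0 Hdata Hreg Hsol HE r v sr sv r0 HA1 K.
have cr := st_smooth_cont sr.
have [Br _ hBr] := st_cont_bounded T cr.
have rmM := st_range_bounds hBr.
have [Bv hBv] := fnorm_gradv_bounded T sv.
have DV t x : 0 <= t <= T -> fnorm (gradv (v t) x) <= sup (st_range T (fun t x => fnorm (gradv (v t) x))).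
  by move=> /(st_range_bounds hBv x)/andP[].
have t00 : 0 <= (0 : R) <= T by rewrite lexx ltW.
have m0 := inf_st_range_gt0 (ltW T0) cr r0.
have mM : inf (st_range T r) <= sup (st_range T r).
  by have /andP[h1 h2] := rmM 0 0 t00; exact: le_trans h1 h2.
have V0 := le_trans (fnorm_ge0 _) (DV 0 0 t00).
have SB t x : 0 <= t <= T -> fnorm (Sv S v t x) <=
    C0 * sup (st_range T (fun t x => fnorm (gradv (v t) x))) `^ (q - 1).
  move=> tT; apply: le_trans (hS _ (symm_sym _)) _; rewrite ler_pM2l//.
  apply: ge0_ler_powR; rewrite ?nnegrE ?fnorm_ge0 ?subr_ge0//.
  exact: le_trans (fnorm_symm _) (DV t x tT).
have BS0 : 0 <= C0 * sup (st_range T (fun t x => fnorm (gradv (v t) x))) `^ (q - 1).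
  by rewrite mulr_ge0 ?powR_ge0 ?ltW.
have [P0 {}hP] := hPf (inf (st_range T r), sup (st_range T r)).
move=> t tT.
apply: (rel_entropy_bound HS Hp rb0 Hdata Hreg Hsol sr sv r0 HA1 (ltW T0) kappa0 m0 BS0 P0 rmM DV SB _ HE tT).
by move=> s z zmM s0; exact: hP m0 mM _ _ _ rb0 zmM s0.
Qed.
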